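(* Let $\mu$ be a probability measure on $[0,\infty)$ satisfying the following assumption: there exists an open interval $I\subset(0,\infty)$ with $1\in I$ such that the limit $F_\mu(x):=\lim_{y\downarrow0}F_\mu(x+\mathrm{i}y)\in\mathbb{C}^+\cup\mathbb{R}$ exists for each $x\in I$, and the map $F_\mu\colon I\to\mathbb{C}^+\cup\mathbb{R}$ is continuous at $1$. Assume further that $F_\mu(1)\in\mathbb{C}^+\cup(1,\infty)$, and write $\log(1-F_\mu(1)-\mathrm{i}0)=\beta-\mathrm{i}\gamma$ with $(\beta,\gamma)\in\mathbb{R}\times(0,\pi]$. Then for each compact set $K\subset(0,\infty)$, the Lebesgue density of $(\mu^{\langle t\rangle})^{1/t}$ on $K$ (which exists for all sufficiently small $t$) satisfies $$\frac{d(\mu^{\langle t\rangle})^{1/t}}{dx}(x)\longrightarrow\frac{\gamma}{\pi x\,[(\log x-\beta)^2+\gamma^2]}\qquad\text{as }t\downarrow0$$ uniformly for $x\in K$, where $\mu^{\langle t\rangle}$ is the multiplicative Boolean convolution power. In particular, $(\mu^{\langle t\rangle})^{1/t}$ converges weakly to the law of $e^{\mathbf{C}_{\beta,\gamma}}$, where $\mathbf{C}_{\beta,\gamma}$ has the Cauchy distribution with density $\frac{\gamma}{\pi}\frac{1}{(x-\beta)^2+\gamma^2}$.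
   Context: $\mathbb{C}^+$ is the open upper half-plane. $G_\mu(z)=\int\frac{\mu(dx)}{z-x}$, $F_\mu=1/G_\mu$, $\eta_\mu(z)=1-zF_\mu(1/z)$. For a probability measure $\mu$ on $[0,\infty)$ and $0\le t\le1$, the multiplicative Boolean convolution power $\mu^{\langle t\rangle}$ is the probability measure on $[0,\infty)$ (it exists, by a theorem of Bercovici) determined by $$\frac{\eta_{\mu^{\langle t\rangle}}(z)}{z}=\left(\frac{\eta_\mu(z)}{z}\right)^t,\qquad z\in(-\infty,0).$$ For $p\ge0$ and $\nu$ on $[0,\infty)$, $\nu^p$ is the push-forward of $\nu$ by $x\mapsto x^p$. The quantity $\log(1-F_\mu(1)-\mathrm{i}0)$ is the principal logarithm of $1-F_\mu(1)$ when $F_\mu(1)\in\mathbb{C}^+$, and equals $\log(F_\mu(1)-1)-\mathrm{i}\pi$ when $F_\mu(1)\in(1,\infty)$. *)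

(* Defs.v *)
From HB Require Import structures.
From mathcomp Require Import all_boot all_order all_algebra.
From mathcomp Require Import complex.
From mathcomp Require Import all_classical all_reals all_analysis.
From mathcomp Require Import measurable_realfun ring.

Set Implicit Arguments.
Unset Strict Implicit.
Unset Printing Implicit Defensive.

Import Order.TTheory GRing.Theory Num.Theory.
Import numFieldNormedType.Exports.

Local Open Scope classical_set_scope.
Local Open Scope ring_scope.
Local Open Scope complex_scope.

Section transforms.
Context {R : realType}.
Implicit Types (mu nu : probability R R) (z : R[i]) (x t : R).

Definition on_nonneg mu : Prop := mu `[0, +oo[%classic = 1%E.

(* The complex integral is taken componentwise. The library's convention
   0^-1 = 0 is met only at x = z for real z. *)
Definition G_transform mu z : R[i] :=
  (\int[mu]_x complex.Re ((z - x%:C)^-1))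
  +i* (\int[mu]_x complex.Im ((z - x%:C)^-1)).

Definition F_transform mu z : R[i] := (G_transform mu z)^-1.

Definition eta_transform mu z : R[i] := 1 - z * F_transform mu z^-1.

(* [R[i]^o] is [R[i]] with the topology of its complex modulus. *)
Definition F_vertical mu x : R -> R[i]^o := fun y => F_transform mu (x +i* y).

Definition F_boundary mu x : R[i]^o := lim (F_vertical mu x y @[y --> 0^'+]).

(* For x < 0 and mu carried by [0, +oo[, eta_mu(x) / x is real and nonnegative,
   so its t-th power is the real power of its real part. *)
Definition is_mboolean_power mu t nu : Prop :=
  on_nonneg nu /\
  forall x, x < 0 ->
    eta_transform nu x%:C / x%:C =
    ((complex.Re (eta_transform mu x%:C / x%:C)) `^ t)%:C.

End transforms.

Section complex_log.
Context {R : realType}.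
Implicit Types z w : R[i].

(* Principal argument, with values in ]-pi, pi] for z != 0. *)
Definition carg z : R :=
  let theta := acos (complex.Re z / ComplexField.Normc.normc z) in
  if 0 <= complex.Im z then theta else - theta.

Definition clog z : R[i] := ln (ComplexField.Normc.normc z) +i* carg z.

(* log (1 - w - i0), for w in the open upper half-plane or in ]1, +oo[ *)
Definition log_one_minus_i0 w : R[i] :=
  if 0 < complex.Im w then clog (1 - w)
  else ln (complex.Re w - 1) -i* pi.

Lemma log_one_minus_i0_strip w :
  0 < complex.Im w \/ complex.Im w = 0 /\ 1 < complex.Re w ->
  0 < - complex.Im (log_one_minus_i0 w) <= pi.
Proof.
case: w => a b /=; rewrite /log_one_minus_i0 /=; case=> [b0|[-> a1]]; last first.
  by rewrite ltxx/= opprK pi_gt0 lexx.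
rewrite b0 /= /carg /= sub0r oppr_ge0 leNgt b0 /= opprK sqrrN.
set n := Num.sqrt _.
have n0 : 0 < n by rewrite sqrtr_gt0 ltr_wpDl ?sqr_ge0// exprn_gt0.
have : `|1 - a| < n.
  by rewrite -sqrtr_sqr ltr_sqrt ?ltrDl ?exprn_gt0// ltr_wpDl ?sqr_ge0// exprn_gt0.
rewrite ltr_norml => /andP[h1 h2].
have : -1 <= (1 - a) / n < 1.
  by rewrite ler_pdivlMr// mulN1r (ltW h1)/= ltr_pdivrMr// mul1r.
move=> /[dup] h /andP[l u].
by rewrite acos_gt0//= acos_lepi// l ltW.
Qed.

End complex_log.

Section measures.
Context {R : realType}.
Implicit Types (mu nu : probability R R) (p : R).

Definition power_map p (x : R) : R := x `^ p.

HB.instance Definition _ p :=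
  @isMeasurableFun.Build _ _ R R (power_map p) (@measurable_powR R p).

Definition power_pushforward nu p : probability R R :=
  distribution nu (power_map p).

Definition is_density_on (K : set R) nu (f : R -> R) : Prop :=
  [/\ measurable_fun K f,
      forall x, K x -> 0 <= f x
    & forall A : set R, measurable A -> A `<=` K ->
        nu A = (\int[lebesgue_measure]_(x in A) (f x)%:E)%E].

Definition weak_cvg (T : Type) (F : set_system T) (P : T -> probability R R) nu
    : Prop :=
  forall h : R -> R, continuous h -> [bounded h x | x in setT] ->
    \int[P t]_x h x @[t --> F] --> \int[nu]_x h x.

End measures.

Section cauchy_distribution.
Context {R : realType}.
Implicit Types (beta gamma x : R).
Local Notation mu := (@lebesgue_measure R).

Definition cauchy_pdf beta gamma x : R :=
  gamma / pi * ((x - beta) ^+ 2 + gamma ^+ 2)^-1.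

Definition exp_cauchy_pdf beta gamma x : R :=
  gamma / (pi * x * ((ln x - beta) ^+ 2 + gamma ^+ 2)).

Definition cauchy_prob beta gamma (gamma_gt0 : 0 < gamma) : set R -> \bar R :=
  fun A => (\int[mu]_(x in A) (cauchy_pdf beta gamma x)%:E)%E.

Variables (beta gamma : R).
Hypothesis gamma_gt0 : 0 < gamma.

Lemma cauchy_pdf_ge0 x : 0 <= cauchy_pdf beta gamma x.
Proof.
rewrite /cauchy_pdf mulr_ge0 ?divr_ge0 ?pi_ge0 ?ltW//.
by rewrite invr_gt0 ltr_wpDl ?sqr_ge0// exprn_gt0.
Qed.

Let F (x : R^o) : R^o := (x - beta) / gamma.

Let F'E : F^`()%classic = cst gamma^-1.
Proof.
apply/funext => x; rewrite /F derive1E deriveM// deriveD// derive_cst scaler0.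
by rewrite add0r derive_id derive_cst addr0 scaler1.
Qed.

Let G (x : R) : R := pi^-1 * (oneDsqr x)^-1.

Let G_ge0 x : 0 <= G x.
Proof. by rewrite mulr_ge0 ?invr_ge0 ?pi_ge0. Qed.

Let continuous_G : continuous G.
Proof. by move=> x; apply: cvgM; [exact: cvg_cst|exact: continuous_oneDsqrV]. Qed.

Let cauchy_pdfE x : cauchy_pdf beta gamma x = ((G \o F) * F^`()%classic) x.
Proof.
rewrite F'E /cauchy_pdf /G /F /oneDsqr !fctE/=.
have h1 : gamma ^+ 2 + (x - beta) ^+ 2 != 0.
  by rewrite gt_eqF// ltr_pwDl ?sqr_ge0// exprn_gt0.
have h2 : gamma != 0 by rewrite gt_eqF.
have : (pi : R) != 0 by rewrite gt_eqF// pi_gt0.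
by move: (pi : R) => p h3; field; rewrite h1 h2.
Qed.

Lemma measurable_cauchy_pdf : measurable_fun setT (cauchy_pdf beta gamma).
Proof.
apply: continuous_measurable_fun => x; apply: cvgM; first exact: cvg_cst.
apply: cvgV; first by rewrite gt_eqF// ltr_wpDl ?sqr_ge0// exprn_gt0.
apply: (@cvgD _ R^o); last exact: cvg_cst.
apply: (cvg_comp (fun x => x - beta) (fun x => x ^+ 2)).
  by apply: (@cvgB _ R^o) => //; [exact: cvg_id|exact: cvg_cst].
exact: sqr_continuous.
Qed.

Lemma integral_cauchy_pdf :
  (\int[mu]_x (cauchy_pdf beta gamma x)%:E = 1)%E.
Proof.
under eq_integral do rewrite cauchy_pdfE.
rewrite -increasing_ge0_integration_by_substitutionT//; first last.
- apply/gt0_cvgMly; last exact: cvg_addrr.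
  by rewrite invr_gt0.
- apply/gt0_cvgMlNy; last exact: cvg_addrr_Ny.
  by rewrite invr_gt0.
- by rewrite F'E; exact: is_cvg_cst.
- by rewrite F'E; exact: is_cvg_cst.
- by rewrite F'E => ?; exact: cvg_cst.
- by move=> x y xy; rewrite /F ltr_pM2r ?invr_gt0// ltrD2r.
rewrite ge0_symfun_integralT//; last first.
  by move=> x; rewrite /G /oneDsqr/= sqrrN.
have -> : [set x : R | 0 <= x] = `[0, +oo[%classic by rewrite set_itvcy.
under eq_integral do rewrite /G EFinM.
rewrite ge0_integralZl//=; last 2 first.
- apply/measurable_EFinP; apply: measurable_funTS.
  exact: continuous_measurable_fun continuous_oneDsqrV.
- by rewrite lee_fin invr_ge0 pi_ge0.
rewrite integral0y_oneDsqr -!EFinM; congr EFin.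
have : (pi : R) != 0 by rewrite gt_eqF// pi_gt0.
by move: (pi : R) => p p_neq0; field.
Qed.

Local Notation cauchy := (cauchy_prob beta gamma_gt0).

Let cauchy0 : cauchy set0 = 0%E.
Proof. by rewrite /cauchy_prob integral_set0. Qed.

Let cauchy_ge0 A : (0 <= cauchy A)%E.
Proof.
by rewrite /cauchy_prob integral_ge0//= => x _; rewrite lee_fin cauchy_pdf_ge0.
Qed.

Let cauchy_sigma_additive : semi_sigma_additive cauchy.
Proof.
move=> /= A mA tA mUA; rewrite /cauchy_prob; apply: cvg_toP.
  apply: ereal_nondecreasing_is_cvgn => m n mn.
  apply: lee_sum_nneg_natr => // k _ _; apply: integral_ge0 => /= x _.
  by rewrite lee_fin cauchy_pdf_ge0.
rewrite ge0_integral_bigcup//=.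
- apply/measurable_funTS/measurableT_comp => //.
  exact: measurable_cauchy_pdf.
- by move=> x _; rewrite lee_fin cauchy_pdf_ge0.
Qed.

HB.instance Definition _ := isMeasure.Build _ _ _
  cauchy cauchy0 cauchy_ge0 cauchy_sigma_additive.

Let cauchy_setT : cauchy [set: R] = 1%E.
Proof. by rewrite /cauchy_prob integral_cauchy_pdf. Qed.

HB.instance Definition _ :=
  @Measure_isProbability.Build _ _ R cauchy cauchy_setT.

End cauchy_distribution.

Definition exp_cauchy_prob {R : realType} (beta gamma : R)
    (gamma_gt0 : 0 < gamma) : probability R R :=
  distribution (cauchy_prob beta gamma_gt0) (@expR R).

(* Main.v *)
Require Import Defs.
From HB Require Import structures.
From mathcomp Require Import all_boot all_order all_algebra.
From mathcomp Require Import complex.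
From mathcomp Require Import all_classical all_reals all_analysis.
From mathcomp Require Import measurable_realfun ring lra.

(** The function z - F_mu(z) is eta_mu(1/z) / (1/z); call it B for mu and A for
    nu = mu^<t>.  By definition A = B^t on the negative axis.  Both functions are
    analytic off the half-line [0, +oo[, and B maps the upper half-plane into the
    open lower half-plane as soon as mu is not a Dirac mass, which the hypothesis
    on F_mu(1) excludes.  With the branch of the logarithm whose imaginary part
    lies in [-pi, 0], the equality therefore continues to
      A(z) = exp(t log B(z))    for z in the upper half-plane
    ([eta_quotient_power]).  Letting z tend to a real x near 1 gives the boundary
    value of F_nu = z - A(z), and Stieltjes inversion gives nu, near 1, the density
      -(1/pi) Im 1/D(x),   D(x) = x - exp(t log(x - F_mu(x)))
    ([cvg_boundary_density], [stieltjes_inversion]).  The density at y of the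
    push-forward by x |-> x^(1/t) is t y^(t-1) times this one at x = y^t.

    As t tends to 0 the point y^t tends to 1, where log(x - F_mu(x)) tends to
    beta - i gamma by continuity of F_mu at 1.  Expanding the exponentials,
    D(y^t) / t tends to ln y - beta + i gamma, so that the density tends to
    gamma / (pi y ((ln y - beta)^2 + gamma^2)).  The limit exists jointly in (t, y),
    and compactness turns this into uniform convergence ([cvg_rescaled_density],
    [uniform_of_joint_limit]).  Weak convergence follows because all masses are 1:
    on a segment that carries almost all the mass of the limit law Q, the uniform
    bound gives Q <= P_t + (a small measure), and this one-sided comparison,
    tested on M + h and M - h for |h| <= M, already controls the integral of h
    ([weak_cvg_of_domination]).

    The continuation uses no contour integrals.  Clearing denominators in the
    relation A' B = t A B' gives an expression ([wronskian]) that is polynomial in z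
    and in the moments of the resolvents 1/(z - x).  In the chart
    z = -a^2 (1 + h)^2, which sends the disc |h| < 1 into the plane slit along
    [0, +oo[ and its real diameter into the negative axis, these moments are power
    series with polynomially growing coefficients, a class of functions stable
    under sums, products and integration and subject to the identity theorem
    ([analytic_family], [analytic_family_eq0]).  Hence A' B = t A B' on the slit
    plane, and A exp(-t log B) is constant along the path s |-> -a^2 (1 + s h)^2. *)

Set Implicit Arguments.
Unset Strict Implicit.
Unset Printing Implicit Defensive.

Import Order.TTheory GRing.Theory Num.Theory.
Import numFieldNormedType.Exports.

Local Open Scope classical_set_scope.
Local Open Scope ring_scope.
Local Open Scope complex_scope.

Local Notation normc := ComplexField.Normc.normc.
Local Notation normcM := ComplexField.Normc.normcM.
Local Notation normcV := ComplexField.Normc.normcV.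
Local Notation Re := complex.Re.
Local Notation Im := complex.Im.

(** * Complex modulus and complex-valued integrals *)

Section complex_modulus.
Context {R : realType}.
Implicit Types z w : R[i].

Lemma normc_ge0 z : 0 <= normc z.
Proof. by case: z => a b; exact: sqrtr_ge0. Qed.

Lemma normc_gt0 z : (0 < normc z) = (z != 0).
Proof.
rewrite lt_neqAle normc_ge0 andbT eq_sym; congr negb.
apply/eqP/eqP => [/ComplexField.Normc.eq0_normc//|->].
exact: ComplexField.Normc.normc0.
Qed.

Lemma normc0 : normc (0 : R[i]) = 0.
Proof. exact: ComplexField.Normc.normc0. Qed.

Lemma normc1 : normc (1 : R[i]) = 1.
Proof. exact: ComplexField.Normc.normc1. Qed.

Lemma sqr_normcE z : normc z ^+ 2 = Re z ^+ 2 + Im z ^+ 2.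
Proof. by case: z => a b /=; rewrite sqr_sqrtr// addr_ge0 ?sqr_ge0. Qed.

Lemma normc_real (r : R) : normc r%:C = `|r|.
Proof. by rewrite /= expr0n addr0 sqrtr_sqr. Qed.

Lemma norm_Re_le z : `|Re z| <= normc z.
Proof.
by case: z => a b /=; rewrite -sqrtr_sqr ler_wsqrtr// lerDl sqr_ge0.
Qed.

Lemma norm_Im_le z : `|Im z| <= normc z.
Proof.
by case: z => a b /=; rewrite -sqrtr_sqr ler_wsqrtr// lerDr sqr_ge0.
Qed.

Lemma normc_le_ReIm z : normc z <= `|Re z| + `|Im z|.
Proof.
rewrite -(@ler_pXn2r _ 2) ?nnegrE ?normc_ge0 ?addr_ge0//.
rewrite sqr_normcE sqrrD !real_normK ?num_real//.
by rewrite lerD2r lerDl mulrn_wge0 ?mulr_ge0.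
Qed.

Lemma normcX z n : normc (z ^+ n) = normc z ^+ n.
Proof.
elim: n => [|n IH]; first by rewrite !expr0 normc1.
by rewrite !exprS normcM IH.
Qed.

Lemma ler_normc_sum (I : Type) (s : seq I) (F : I -> R[i]) :
  normc (\sum_(i <- s) F i) <= \sum_(i <- s) normc (F i).
Proof.
elim/big_ind2 : _ => [|x1 x2 y1 y2 h1 h2|//].
  by rewrite normc0.
by apply: (le_trans (le_normcD _ _)); exact: lerD.
Qed.

Lemma ler_normcB z w : normc z - normc w <= normc (z - w).
Proof. by rewrite lerBlDr -[X in normc X <= _](subrK w) le_normcD. Qed.

Lemma ReD z w : Re (z + w) = Re z + Re w.
Proof. by case: z => ? ?; case: w => ? ?. Qed.

Lemma ImD z w : Im (z + w) = Im z + Im w.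
Proof. by case: z => ? ?; case: w => ? ?. Qed.

Lemma ReM z w : Re (z * w) = Re z * Re w - Im z * Im w.
Proof. by case: z => ? ?; case: w => ? ?. Qed.

Lemma ImM z w : Im (z * w) = Re z * Im w + Im z * Re w.
Proof. by case: z => ? ?; case: w => ? ?. Qed.

Lemma ReN z : Re (- z) = - Re z.
Proof. by case: z => ? ?. Qed.

Lemma ImN z : Im (- z) = - Im z.
Proof. by case: z => ? ?. Qed.

Lemma ReV z : Re z^-1 = Re z * (normc z ^+ 2)^-1.
Proof. by rewrite sqr_normcE; case: z. Qed.

Lemma ImV z : Im z^-1 = - (Im z * (normc z ^+ 2)^-1).
Proof. by rewrite sqr_normcE; case: z. Qed.

Lemma complex_ext z w : Re z = Re w -> Im z = Im w -> z = w.
Proof. by case: z => a b; case: w => c d /= -> ->. Qed.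

End complex_modulus.

Section complex_integral.
Context {R : realType} {d : measure_display} {T : measurableType d}.
Variables (D : set T) (mD : measurable D).

Definition cmeas (f : T -> R[i]) :=
  measurable_fun D (fun x => Re (f x)) /\ measurable_fun D (fun x => Im (f x)).

Lemma cmeas_cst c : cmeas (fun=> c).
Proof. by split; apply: measurable_cst. Qed.

Lemma cmeasD f g : cmeas f -> cmeas g -> cmeas (fun x => f x + g x).
Proof.
move=> [f1 f2] [g1 g2]; split.
  by under eq_fun do rewrite ReD; exact: measurable_funD.
by under eq_fun do rewrite ImD; exact: measurable_funD.
Qed.

Lemma cmeasN f : cmeas f -> cmeas (fun x => - f x).
Proof.
move=> [f1 f2]; split.
  by under eq_fun do rewrite ReN; exact: measurable_funN.
by under eq_fun do rewrite ImN; exact: measurable_funN.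
Qed.

Lemma cmeasM f g : cmeas f -> cmeas g -> cmeas (fun x => f x * g x).
Proof.
move=> [f1 f2] [g1 g2]; split.
  by under eq_fun do rewrite ReM; apply: measurable_funB; exact: measurable_funM.
by under eq_fun do rewrite ImM; apply: measurable_funD; exact: measurable_funM.
Qed.

Lemma cmeasX f n : cmeas f -> cmeas (fun x => f x ^+ n).
Proof.
move=> mf; elim: n => [|n IH]; first exact: cmeas_cst.
by under eq_fun do rewrite exprS; exact: cmeasM.
Qed.

Lemma cmeas_sum n (f : 'I_n -> T -> R[i]) : (forall i, cmeas (f i)) ->
  cmeas (fun x => \sum_(i < n) f i x).
Proof.
move=> mf; elim: n f mf => [|n IH] f mf.
  by under eq_fun do rewrite big_ord0; exact: cmeas_cst.
by under eq_fun do rewrite big_ord_recl; apply: cmeasD => //; exact: IH.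
Qed.

(** For a nonnegative number the inverse is the real power of exponent -1, at 0 as well;
    that power is a measurable function on the whole line. *)
Lemma measurable_fun_inv_ge0 (f : T -> R) : (forall x, 0 <= f x) ->
  measurable_fun D f -> measurable_fun D (fun x => (f x)^-1).
Proof.
move=> f0 mf; under eq_fun do rewrite -powR_inv1//.
exact: (measurableT_comp (@measurable_powR R (-1)) mf).
Qed.

Lemma cmeasV f : cmeas f -> cmeas (fun x => (f x)^-1).
Proof.
move=> [f1 f2].
have m : measurable_fun D (fun x => (normc (f x) ^+ 2)^-1).
  apply: measurable_fun_inv_ge0 => [x|]; first exact: sqr_ge0.
  under eq_fun do rewrite sqr_normcE.
  by apply: measurable_funD; exact: measurable_funX.
split.
  by under eq_fun do rewrite ReV; apply: measurable_funM.
by under eq_fun do rewrite ImV; apply: measurable_funN; apply: measurable_funM.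
Qed.

Variable mu : {finite_measure set T -> \bar R}.

Definition cint (f : T -> R[i]) : R[i] :=
  (\int[mu]_(x in D) Re (f x)) +i* (\int[mu]_(x in D) Im (f x)).

Definition cbounded (f : T -> R[i]) :=
  exists M, forall x, D x -> normc (f x) <= M.

Lemma bounded_integrable (f : T -> R) M : measurable_fun D f ->
  (forall x, D x -> `|f x| <= M) -> mu.-integrable D (EFin \o f).
Proof.
move=> mf fM; apply: measurable_bounded_integrable => //.
  by rewrite -ge0_fin_numE// fin_num_measure.
exists M; split; first exact: num_real.
by move=> y My x Dx /=; rewrite (le_trans (fM _ Dx))// ltW.
Qed.

Lemma cint_integrable f : cmeas f -> cbounded f ->
  mu.-integrable D (EFin \o (fun x => Re (f x))) /\ mu.-integrable D (EFin \o (fun x => Im (f x))).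
Proof.
move=> [f1 f2] [M fM]; split; apply: (bounded_integrable (M := M)) => // x Dx.
  exact: le_trans (norm_Re_le _) (fM _ Dx).
exact: le_trans (norm_Im_le _) (fM _ Dx).
Qed.

Lemma eq_cint f g : (forall x, D x -> f x = g x) -> cint f = cint g.
Proof.
by move=> fg; congr (_ +i* _); apply: eq_Rintegral => x /set_mem Dx; rewrite fg.
Qed.

Lemma cintD f g : cmeas f -> cbounded f -> cmeas g -> cbounded g ->
  cint (fun x => f x + g x) = cint f + cint g.
Proof.
move=> mf bf mg bg.
have [f1 f2] := cint_integrable mf bf; have [g1 g2] := cint_integrable mg bg.
rewrite /cint; under eq_Rintegral do rewrite ReD.
under [X in _ +i* X]eq_Rintegral do rewrite ImD.
by rewrite !RintegralD.
Qed.

Lemma cintZ c f : cmeas f -> cbounded f ->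
  cint (fun x => c * f x) = c * cint f.
Proof.
move=> mf bf.
have [f1 f2] := cint_integrable mf bf.
rewrite /cint; under eq_Rintegral do rewrite ReM.
under [X in _ +i* X]eq_Rintegral do rewrite ImM.
have iZ (r : R) (g : T -> R) : mu.-integrable D (EFin \o g) ->
    mu.-integrable D (EFin \o (fun x => r * g x)).
  by move=> ig; exact: (@integrableZl _ _ _ mu D mD r _ ig).
rewrite RintegralB ?RintegralD//; try exact: iZ.
rewrite !RintegralZl//; apply: complex_ext; rewrite ?ReM ?ImM//=.
Qed.

(** The factor 2 comes from bounding the real and imaginary parts separately. *)
Lemma normc_cint_le f M : cmeas f -> (forall x, D x -> normc (f x) <= M) ->
  normc (cint f) <= 2 * (M * fine (mu D)).
Proof.
move=> mf fM.
have [f1 f2] : mu.-integrable D (EFin \o (fun x => Re (f x))) /\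
               mu.-integrable D (EFin \o (fun x => Im (f x))).
  by apply: cint_integrable => //; exists M.
apply: (le_trans (normc_le_ReIm _)); rewrite /= mulr_natl mulr2n.
have H g : mu.-integrable D (EFin \o g) ->
    (forall x, D x -> `|g x| <= M) -> `|\int[mu]_(x in D) g x| <= M * fine (mu D).
  move=> ig gM; apply: (le_trans (le_normr_Rintegral mD ig)).
  rewrite -Rintegral_cst//; apply: le_Rintegral => //.
    exact: integrable_norm.
  apply: (bounded_integrable (M := `|M|)) => //; exact: measurable_cst.
by apply: lerD; apply: H => // x Dx;
  [exact: le_trans (norm_Re_le _) (fM _ Dx)|exact: le_trans (norm_Im_le _) (fM _ Dx)].
Qed.

End complex_integral.

(** * Power series without coefficients, and their identity theorem *)

Section analytic_families.
Context {R : realType} {d : measure_display} {T : measurableType d}.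
Variables (D : set T) (mD : measurable D).
Implicit Types (f g : T -> R[i] -> R[i]) (h : R[i]).
Local Notation cmeas := (cmeas D).

(** The functions h |-> f x h that are power series on the unit disc whose n-th remainder
    grows at most polynomially in n on each smaller disc, uniformly in x.  The series is
    replaced by its successive remainders: if f x h is the sum of the c_m h^m, then
    fs n x h is the sum of the c_(n+m) h^m.  Coefficients are the values
    fs n x 0, and no infinite sum has to be formed. *)
Definition analytic_family f := exists fs : nat -> T -> R[i] -> R[i],
  [/\ forall x h, D x -> normc h < 1 -> f x h = fs 0 x h,
      forall n x h, D x -> normc h < 1 ->
        fs n x h = fs n x 0 + h * fs n.+1 x h,
      forall n h, normc h < 1 -> cmeas (fs n ^~ h)
    & exists k : nat, forall r : R, 0 <= r < 1 -> exists2 M : R, 0 <= M &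
        forall n x h, D x -> normc h <= r -> normc (fs n x h) <= M * n.+1%:R ^+ k].

Lemma normc0_le (r : R) : 0 <= r -> normc (0 : R[i]) <= r.
Proof. by rewrite normc0. Qed.

Lemma normc0_lt1 : normc (0 : R[i]) < 1.
Proof. by rewrite normc0. Qed.

Lemma eq_analytic_family f g :
  (forall x h, D x -> normc h < 1 -> f x h = g x h) ->
  analytic_family f -> analytic_family g.
Proof.
move=> fg [fs [f0 fS mf bf]]; exists fs; split => // x h Dx h1.
by rewrite -fg// f0.
Qed.

Lemma analytic_family_cst (c : T -> R[i]) : cmeas c -> cbounded D c ->
  analytic_family (fun x _ => c x).
Proof.
move=> mc [M cM]; exists (fun n x _ => if n == 0%N then c x else 0); split => //.
- by move=> [|n] x h _ _ /=; rewrite mulr0 addr0.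
- by move=> [|n] h _ /=; [|exact: cmeas_cst].
- exists 0%N => r r01; exists `|M| => // -[|n] x h Dx hr; rewrite expr0 mulr1.
    exact: le_trans (cM _ Dx) (ler_norm _).
  exact: normc0_le.
Qed.

Lemma analytic_family_id : analytic_family (fun _ h => h).
Proof.
exists (fun n x h => if n is m.+1 then if m is 0%N then 1 else 0 else h); split.
- by [].
- by move=> [|[|n]] x h _ _; rewrite ?mulr1 ?mulr0 ?add0r ?addr0.
- by move=> [|[|n]] h _ /=; exact: cmeas_cst.
- exists 0%N => r /andP[r0 r1]; exists 1 => // -[|[|n]] x h Dx hr;
    rewrite expr0 mulr1.
  + exact: le_trans hr (ltW r1).
  + by rewrite normc1.
  + by rewrite normc0.
Qed.

Lemma ler_natX (k l n : nat) : (k <= l)%N -> n.+1%:R ^+ k <= n.+1%:R ^+ l :> R.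
Proof. by move=> kl; apply: ler_weXn2l => //; rewrite ler1n. Qed.

Lemma analytic_familyD f g : analytic_family f -> analytic_family g ->
  analytic_family (fun x h => f x h + g x h).
Proof.
move=> [fs [f0 fS mf [k bf]]] [gs [g0 gS mg [l bg]]].
exists (fun n x h => fs n x h + gs n x h); split.
- by move=> x h Dx h1; rewrite f0// g0.
- by move=> n x h Dx h1; rewrite fS// gS// mulrDr addrACA.
- by move=> n h h1; apply: cmeasD; [exact: mf|exact: mg].
- exists (k + l)%N => r r01; have [M M0 fM] := bf _ r01; have [N N0 gN] := bg _ r01.
  exists (M + N); first exact: addr_ge0.
  move=> n x h Dx hr; rewrite (le_trans (le_normcD _ _))// mulrDl lerD//.
    by rewrite (le_trans (fM _ _ _ _ _))// ler_wpM2l// ler_natX// leq_addr.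
  by rewrite (le_trans (gN _ _ _ _ _))// ler_wpM2l// ler_natX// leq_addl.
Qed.

(** The remainders of a product are Cauchy products: the n-th one collects the
    coefficients of f below n against the matching remainders of g, and the n-th
    remainder of f against g itself.  The n + 1 terms raise the growth exponent by 1. *)
Lemma analytic_familyM f g : analytic_family f -> analytic_family g ->
  analytic_family (fun x h => f x h * g x h).
Proof.
move=> [fs [f0 fS mf [k bf]]] [gs [g0 gS mg [l bg]]].
exists (fun n x h =>
  \sum_(i < n) fs i x 0 * gs (n - i)%N x h + fs n x h * gs 0%N x h); split.
- by move=> x h Dx h1; rewrite big_ord0 add0r f0// g0.
- move=> n x h Dx h1.
  rewrite big_ord_recr/= subSn// subnn mulrDr mulrDr mulr_sumr.
  rewrite [X in _ = _ + (X + _ + _)](eq_bigr (fun i : 'I_n => fs i x 0 * gs (n - i)%N x h -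
                     fs i x 0 * gs (n - i)%N x 0)); last first.
    move=> i _; rewrite -mulrBr mulrCA; congr (_ * _).
    by rewrite subSn ?(ltnW (ltn_ord i))// [in RHS]gS// addrAC subrr add0r.
  rewrite sumrB (mulrA h (fs n.+1 x h)).
  have -> : h * fs n.+1 x h = fs n x h - fs n x 0 by rewrite [in RHS]fS// addrAC subrr add0r.
  have -> : h * (fs n x 0 * gs 1%N x h) = fs n x 0 * (gs 0%N x h - gs 0%N x 0).
    by rewrite [gs 0%N x h in RHS]gS// [in RHS]addrAC subrr add0r mulrCA.
  by ring.
- move=> n h h1; apply: cmeasD; last by apply: cmeasM; [exact: mf|exact: mg].
  apply: cmeas_sum => i; apply: cmeasM; last exact: mg.
  by apply: mf; exact: normc0_lt1.
- exists (k + l).+1%N => r r01; have [M M0 fM] := bf _ r01; have [N N0 gN] := bg _ r01.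
  have r0 : 0 <= r by case/andP: r01.
  exists (M * N); first exact: mulr_ge0.
  move=> n x h Dx hr.
  have H i j h1 h2 : (i <= n)%N -> (j <= n)%N -> normc h1 <= r -> normc h2 <= r ->
     normc (fs i x h1 * gs j x h2) <= M * N * n.+1%:R ^+ (k + l).
    move=> il jl hr1 hr2; rewrite normcM exprD mulrACA.
    apply: ler_pM; rewrite ?normc_ge0//.
      apply: (le_trans (fM _ _ _ Dx hr1)); rewrite ler_wpM2l//.
      by rewrite lerXn2r ?nnegrE// ler_nat.
    apply: (le_trans (gN _ _ _ Dx hr2)); rewrite ler_wpM2l//.
    by rewrite lerXn2r ?nnegrE// ler_nat.
  apply: (le_trans (le_normcD _ _)).
  rewrite exprS mulrCA -[in X in _ <= X * _]natr1 mulrDl mul1r; apply: lerD; last exact: H.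
  apply: (le_trans (ler_normc_sum _ _)).
  rewrite mulr_natl -[X in _ *+ X]card_ord -sumr_const ler_sum// => i _.
  by apply: H; rewrite ?leq_subr ?normc0_le// ltnW.
Qed.

Lemma normc_1D (c h : R[i]) : normc c <= 1 -> 1 - normc h <= normc (1 + c * h).
Proof.
move=> c1; rewrite -[c * h]opprK; apply: le_trans (ler_normcB _ _).
rewrite normc1 lerB// normcN normcM.
by rewrite ler_piMl// normc_ge0.
Qed.

Lemma geom_denom_neq0 (c h : R[i]) : normc c <= 1 -> normc h < 1 -> 1 + c * h != 0.
Proof.
by move=> c1 h1; rewrite -normc_gt0 (lt_le_trans _ (normc_1D h c1))// subr_gt0.
Qed.

Lemma analytic_family_geom (c : T -> R[i]) : cmeas c ->
  (forall x, D x -> normc (c x) <= 1) ->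
  analytic_family (fun x h => (1 + c x * h)^-1).
Proof.
move=> mc c1; exists (fun n x h => (- c x) ^+ n * (1 + c x * h)^-1); split => //.
- by move=> x h _ _; rewrite expr0 mul1r.
- move=> n x h Dx h1; have := geom_denom_neq0 (c1 _ Dx) h1.
  rewrite mulr0 addr0 invr1 mulr1 exprS => nz.
  by field.
- move=> n h _; apply: cmeasM; first by apply: cmeasX; exact: cmeasN.
  apply: cmeasV; apply: cmeasD; first exact: cmeas_cst.
  by apply: cmeasM => //; exact: cmeas_cst.
- exists 0%N => r /andP[r0 r1]; exists (1 - r)^-1.
    by rewrite invr_ge0 subr_ge0 ltW.
  move=> n x h Dx hr; rewrite expr0 mulr1 normcM normcX normcN.
  rewrite -[leRHS]mul1r ler_pM ?exprn_ge0 ?normc_ge0//.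
    by rewrite exprn_ile1 ?normc_ge0// c1.
  rewrite normcV lef_pV2 ?posrE ?subr_gt0//.
    by apply: le_trans (normc_1D h (c1 _ Dx)); rewrite lerB.
  by apply: lt_le_trans (normc_1D h (c1 _ Dx)); rewrite subr_gt0 (le_lt_trans hr).
Qed.

Lemma analytic_familyX f n : analytic_family f ->
  analytic_family (fun x h => f x h ^+ n).
Proof.
move=> af; elim: n => [|n IH].
  apply: analytic_family_cst; first exact: cmeas_cst.
  by exists 1 => x _; rewrite -[leLHS]/(normc 1) normc1.
by under eq_fun do under eq_fun do rewrite exprS; exact: analytic_familyM.
Qed.

(** Remainders are integrated one by one; the uniformity in x of the growth bound is
    what makes this work. *)
Lemma analytic_family_int (mu : {finite_measure set T -> \bar R}) f :
  analytic_family f ->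
  analytic_family (fun _ h => cint D mu (f ^~ h)).
Proof.
move=> [fs [f0 fS mf [k bf]]].
have cb n h : normc h < 1 -> cbounded D (fs n ^~ h).
  move=> h1; have [|M _ fM] := bf (normc h); first by rewrite normc_ge0.
  by exists (M * n.+1%:R ^+ k) => x Dx; exact: fM.
exists (fun n _ h => cint D mu (fs n ^~ h)); split.
- by move=> x h Dx h1; apply: eq_cint => y Dy; exact: f0.
- move=> n x h Dx h1; have z1 := normc0_lt1.
  rewrite -cintZ//; [|exact: mf|exact: cb].
  rewrite -cintD//; [|exact: mf|exact: cb| |].
  + by apply: eq_cint => y Dy; exact: fS.
  + by apply: cmeasM; [exact: cmeas_cst|exact: mf].
  + have [N hN] := cb n.+1 _ h1; exists (normc h * N) => y Dy.
    by rewrite normcM ler_wpM2l ?normc_ge0// hN.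
- by move=> n h h1; exact: cmeas_cst.
- exists k => r r01; have [M M0 fM] := bf _ r01.
  exists (2 * (M * fine (mu D))).
    by rewrite !mulr_ge0// fine_ge0.
  move=> n x0 h _ hr.
  apply: (le_trans (normc_cint_le (M := M * n.+1%:R ^+ k) mD _ _ _)).
  + by apply: mf; case/andP: r01 => _; exact: le_lt_trans.
  + by move=> x Dx'; exact: fM.
  + by rewrite -!mulrA ler_wpM2l// ler_wpM2l// mulrC.
Qed.

(** On the real diameter the remainders vanish by induction: the recursion divides
    the n-th one by h, and the value at h = 0 is the limit.  Then f x h equals
    h^n fs n x h for every n, which is at most |h|^n times a power of n. *)
Lemma analytic_family_eq0 f x : D x -> analytic_family f ->
  (forall r : R, -1 < r < 1 -> f x r%:C = 0) ->
  forall h, normc h < 1 -> f x h = 0.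
Proof.
move=> Dx [fs [f0 fS _ [k bf]]] fr0 h h1.
have r1 (r : R) : -1 < r < 1 -> normc r%:C < 1 by rewrite normc_real ltr_norml.
have fs0 n (r : R) : -1 < r < 1 -> fs n x r%:C = 0.
  elim: n r => [r rr|n IH]; first by rewrite -f0 ?fr0// r1.
  have z0 : fs n x 0 = 0 by rewrite (IH 0)// ltrN10 ltr01.
  have nz (r : R) : -1 < r < 1 -> r != 0 -> fs n.+1 x r%:C = 0.
    move=> rr rn0; have := fS n x r%:C Dx (r1 _ rr).
    rewrite IH// z0 add0r => /esym/eqP; rewrite mulf_eq0 => /orP[/eqP[]/eqP|/eqP//].
    by rewrite (negbTE rn0).
  move=> r rr; have [->|] := eqVneq r 0; last exact: nz.
  have /bf[M M0 fM] : 0 <= (2^-1 : R) < 1 by rewrite invr_ge0 ler0n/= invf_lt1// ltr1n.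
  set N := M * n.+3%:R ^+ k.
  have N0 : 0 <= N by rewrite mulr_ge0// exprn_ge0.
  have H (r' : R) : 0 < r' <= 2^-1 -> normc (fs n.+1 x 0) <= r' * N.
    move=> /andP[r'0 r'2].
    have rr' : -1 < r' < 1.
      by rewrite (lt_trans _ r'0) ?ltrN10//= (le_lt_trans r'2)// invf_lt1// ltr1n.
    have := fS n.+1 x r'%:C Dx (r1 _ rr').
    rewrite nz ?gt_eqF// => /esym/eqP; rewrite addr_eq0 => /eqP ->.
    rewrite normcN normcM normc_real gtr0_norm//.
    by rewrite ler_wpM2l ?(ltW r'0)// fM// normc_real gtr0_norm.
  apply: ComplexField.Normc.eq0_normc; apply/eqP.
  rewrite eq_le normc_ge0 andbT; apply/ler_addgt0Pl => e e0; rewrite addr0.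
  have N1 : 0 < N + 1 by rewrite ltr_wpDl.
  have m0 : 0 < Num.min 2^-1 (e / (N + 1)) by rewrite lt_min invr_gt0 ltr0n divr_gt0.
  apply: (le_trans (H (Num.min 2^-1 (e / (N + 1))) _)); first by rewrite m0 ge_min lexx.
  apply: (@le_trans _ _ (e / (N + 1) * N)).
    by rewrite ler_wpM2r// ge_min lexx orbT.
  by rewrite -mulrA ler_piMr ?(ltW e0)// mulrC ler_pdivrMr// mul1r lerDl.
have fh n : f x h = h ^+ n * fs n x h.
  rewrite f0//; elim: n => [|n ->]; first by rewrite expr0 mul1r.
  by rewrite fS// (fs0 n 0) ?ltrN10 ?ltr01// add0r exprSr mulrA.
have [M M0 fM] := bf (normc h) ltac:(by rewrite normc_ge0).
apply: ComplexField.Normc.eq0_normc; apply/eqP.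
rewrite eq_le normc_ge0 andbT.
have [->|hn0] := eqVneq h 0.
  by rewrite (fr0 0) ?normc0// ltrN10 ltr01.
have h0 : 0 < normc h by rewrite normc_gt0.
set c := - ln (normc h) / k.+1%:R.
have c0 : 0 < c by rewrite divr_gt0// oppr_gt0 ln_lt0// h0.
(* With |h| = exp(- c (k + 1)), the decay of |h|^n pays for k + 1 factors n + 1, each
   of them at most a constant times exp(c n).  The remainder uses only k of these
   factors, and the last one forces f x h = 0. *)
have hE n : normc h ^+ n = expR (- (c * n%:R)) ^+ k.+1.
  rewrite -expRM_natl -{1}(lnK h0) -expRM_natl; congr expR.
  have : k.+1%:R != 0 :> R by rewrite pnatr_eq0.
  by rewrite /c; move: (k.+1%:R : R) => K K0; field.
have nE n : n.+1%:R <= (1 + c^-1) * expR (c * n%:R).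
  apply: (@le_trans _ _ ((1 + c^-1) * (1 + c * n%:R))).
    clear -c0; move: (c : R) c0 => {}c c0.
    rewrite mulrDr mulr1 mulrDl mul1r mulKf ?gt_eqF// -natr1 -subr_ge0.
    rewrite (_ : _ - _ = c^-1 + c * n%:R) ?addr_ge0 ?mulr_ge0 ?invr_ge0// ?(ltW c0)//.
    by move: (c^-1) => x2; ring.
  by rewrite ler_wpM2l ?expR_ge1Dx// addr_ge0// invr_ge0 ltW.
set B := M * (1 + c^-1) ^+ k.+1.
have H n : normc (f x h) * n.+1%:R <= B.
  rewrite (fh n) normcM normcX hE -mulrA.
  apply: (@le_trans _ _ (expR (- (c * n%:R)) ^+ k.+1 * (M * n.+1%:R ^+ k.+1))).
    rewrite ler_wpM2l ?exprn_ge0 ?expR_ge0// exprSr mulrA ler_wpM2r// fM//.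
  rewrite mulrCA /B ler_wpM2l// -exprMn lerXn2r ?nnegrE ?mulr_ge0 ?expR_ge0//.
    by rewrite addr_ge0// invr_ge0 ltW.
  rewrite mulrC -ler_pdivlMr ?expR_gt0// -expRN opprK.
  exact: nE.
apply/ler_addgt0Pl => e e0; rewrite addr0 leNgt; apply/negP => eh.
have := H (Num.truncn (B / e)); apply/negP; rewrite -ltNge.
apply: (@lt_le_trans _ _ (e * (Num.truncn (B / e)).+1%:R)).
  by rewrite -ltr_pdivrMl// mulrC truncnS_gt.
by rewrite ler_wpM2r// ltW.
Qed.

End analytic_families.

(** * Resolvent moments of a measure on the half-line *)

Section cauchy_transform.
Context {R : realType}.
Implicit Types (mu nu : probability R R) (z w : R[i]).

Definition halfline : set R := `[0, +oo[%classic.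
Local Notation D0 := halfline.

Lemma measurable_halfline : measurable D0.
Proof. exact: measurable_itv. Qed.
Let mD0 := measurable_halfline.

(** Membership in the complement of [0, +oo[. *)
Definition offcut z := (Im z != 0) || (Re z < 0).

Lemma offcut_dist z : offcut z -> exists2 e : R, 0 < e &
  forall x, D0 x -> e <= normc (z - x%:C).
Proof.
case/orP => [h|h].
  exists `|Im z|; first by rewrite normr_gt0.
  by move=> x _; rewrite (le_trans _ (norm_Im_le _))// ImD ImN /= subr0.
exists (- Re z); first by rewrite oppr_gt0.
move=> x; rewrite /D0 /= in_itv/= andbT => x0.
apply: (le_trans _ (norm_Re_le _)); rewrite ReD ReN /=.
by rewrite ltr0_norm ?opprB ?lerDr// subr_lt0 (lt_le_trans h).
Qed.

Lemma offcut_neq0 z x : offcut z -> D0 x -> z - x%:C != 0.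
Proof.
by move=> /offcut_dist[e e0 H] Dx; rewrite -normc_gt0 (lt_le_trans e0)// H.
Qed.

Lemma cmeas_id (D : set R) : measurable D -> cmeas D (fun x => x%:C).
Proof. by move=> mD; split => /=; [exact: measurable_id|exact: measurable_cst]. Qed.

Lemma cmeas_resolvent (D : set R) z : measurable D -> cmeas D (fun x => (z - x%:C)^-1).
Proof.
move=> mD; apply: cmeasV => //; apply: cmeasD => //.
by apply: cmeasN => //; exact: cmeas_id.
Qed.

Lemma cbounded_resolvent n z : offcut z -> cbounded D0 (fun x => (z - x%:C)^-1 ^+ n).
Proof.
move=> /offcut_dist[e e0 H]; exists (e^-1 ^+ n) => x Dx.
rewrite normcX normcV lerXn2r ?nnegrE ?invr_ge0 ?normc_ge0 ?(ltW e0)//.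
by rewrite lef_pV2 ?posrE ?H// (lt_le_trans e0)// H.
Qed.

(** The first moment is the Cauchy transform and the second one is minus its
    derivative; integrating over [0, +oo[ only makes the resolvent bounded on the
    range of integration for every z off that half-line. *)
Definition resolvent_moment mu n z : R[i] :=
  cint D0 mu (fun x => (z - x%:C)^-1 ^+ n).

Lemma on_nonneg_ae mu : on_nonneg mu -> {ae mu, forall x, D0 x}.
Proof.
move=> h; exists (~` D0); split => //; first exact: measurableC.
by rewrite probability_setC// /D0 [X in (_ - X)%E]h subee.
Qed.

Lemma G_transformE mu z : on_nonneg mu ->
  G_transform mu z = resolvent_moment mu 1 z.
Proof.
move=> h.
have H (f : R -> R) : measurable_fun setT f ->
    \int[mu]_x f x = \int[mu]_(x in D0) f x.
  move=> mf; rewrite [RHS]Rintegral_mkcond /Rintegral; congr fine.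
  apply: ae_eq_integral => //.
  - exact/measurable_EFinP.
  - apply/measurable_EFinP/measurable_restrict => //.
    by rewrite setTI; exact: measurable_funTS.
  - have [N [mN N0 sN]] := on_nonneg_ae h.
    exists N; split => //; apply: subset_trans sN.
    by move=> x /= xn Dx; apply: xn => _; rewrite patchE mem_set.
have [m1 m2] := @cmeas_resolvent setT z measurableT.
by rewrite /G_transform /resolvent_moment /cint !H.
Qed.

Lemma fine_mu_halfline mu : on_nonneg mu -> fine (mu D0) = 1.
Proof. by rewrite /D0 => ->. Qed.

Lemma integrable_resolvent (mu : probability R R) n z : offcut z ->
  mu.-integrable D0 (EFin \o (fun x => Re ((z - x%:C)^-1 ^+ n))) /\
  mu.-integrable D0 (EFin \o (fun x => Im ((z - x%:C)^-1 ^+ n))).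
Proof.
move=> oz; apply: cint_integrable => //.
  by apply: cmeasX => //; exact: cmeas_resolvent.
exact: cbounded_resolvent.
Qed.

(** The remainder of the first-order expansion of 1/(w - x) at z is exactly
    (w - z)^2 / ((w - x) (z - x)^2).  The quadratic bound is kept, rather than mere
    differentiability, because it composes with quadratic curves. *)
Lemma resolvent_moment_taylor mu z : offcut z -> exists2 K : R, 0 <= K &
  exists2 e : R, 0 < e & forall w, normc (w - z) <= e ->
  normc (resolvent_moment mu 1 w - resolvent_moment mu 1 z
         + (w - z) * resolvent_moment mu 2 z) <= K * normc (w - z) ^+ 2.
Proof.
move=> oz; have [e e0 H] := offcut_dist oz.
set e2 := e / 2; have e20 : 0 < e2 by rewrite divr_gt0.
set K := e2^-1 * (e^-1) ^+ 2.
have K0 : 0 <= K by rewrite mulr_ge0 ?invr_ge0 ?exprn_ge0 ?invr_ge0// ltW.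
exists (2 * (K * fine (mu D0))); first by rewrite mulr_ge0// mulr_ge0// fine_ge0.
exists e2 => // w wz.
have Hw x : D0 x -> e2 <= normc (w - x%:C).
  move=> Dx; have -> : w - x%:C = (z - x%:C) - (z - w) by ring.
  apply: le_trans (ler_normcB _ _).
  by rewrite lerBrDr -normcN opprB (le_trans (lerD (lexx _) wz))// /e2 -splitr H.
have nw x : D0 x -> w - x%:C != 0.
  by move=> Dx; rewrite -normc_gt0 (lt_le_trans e20)// Hw.
have nz x : D0 x -> z - x%:C != 0 by move=> Dx; exact: offcut_neq0.
have mr n v : cmeas D0 (fun x => (v - x%:C)^-1 ^+ n).
  by apply: cmeasX => //; exact: cmeas_resolvent.
have bw : cbounded D0 (fun x => (w - x%:C)^-1 ^+ 1).
  exists e2^-1 => x Dx; rewrite expr1 normcV lef_pV2 ?posrE ?Hw//.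
  by rewrite (lt_le_trans e20)// Hw.
have bz n : cbounded D0 (fun x => (z - x%:C)^-1 ^+ n) by exact: cbounded_resolvent.
have bM (c : R[i]) f : cbounded D0 f -> cbounded D0 (fun x => c * f x).
  move=> [M fM]; exists (normc c * M) => x Dx.
  by rewrite normcM ler_wpM2l ?normc_ge0// fM.
have bD f g : cbounded D0 f -> cbounded D0 g -> cbounded D0 (fun x => f x + g x).
  move=> [M fM] [N gN]; exists (M + N) => x Dx.
  by rewrite (le_trans (le_normcD _ _))// lerD ?fM ?gN.
rewrite /resolvent_moment -[X in normc (_ - X + _)]mul1r -mulNr.
rewrite -!cintZ// -!cintD//; last 6 first.
- by apply: cmeasD => //; apply: cmeasM => //; exact: cmeas_cst.
- by apply: bD => //; exact: bM.
- by apply: cmeasM => //; exact: cmeas_cst.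
- exact: bM.
- by apply: cmeasM => //; exact: cmeas_cst.
- exact: bM.
set f := (F in cint D0 mu F).
have -> : cint D0 mu f = cint D0 mu
    (fun x : R => (w - z) ^+ 2 * ((w - x%:C)^-1 * ((z - x%:C)^-1) ^+ 2)).
  by apply: eq_cint => x Dx; rewrite /f; have := nw _ Dx; have := nz _ Dx => ? ?; field; apply/andP.
apply: (le_trans (normc_cint_le (M := normc (w - z) ^+ 2 * K) mD0 _ _ _)) => //.
- by apply: cmeasM => //; apply: cmeasM => //; exact: cmeas_resolvent.
- move=> x Dx; rewrite normcM normcX ler_wpM2l ?sqr_ge0// normcM normcX !normcV.
  rewrite ler_pM ?exprn_ge0 ?invr_ge0 ?normc_ge0//.
    by rewrite lef_pV2 ?posrE ?Hw// (lt_le_trans e20)// Hw.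
  rewrite lerXn2r ?nnegrE ?invr_ge0 ?normc_ge0 ?(ltW e0)//.
  by rewrite lef_pV2 ?posrE ?H// (lt_le_trans e0)// H.
- by rewrite le_eqVlt; apply/orP; left; apply/eqP; ring.
Qed.

Definition nondegenerate mu := forall c : R, ~ {ae mu, forall x, x = c}.

Section half_line_integrals.
Variable mu : probability R R.
Hypothesis mu_nonneg : on_nonneg mu.

Lemma Rintegral_eq0_ae (f : R -> R) : measurable_fun D0 f ->
  mu.-integrable D0 (EFin \o f) -> (forall x, D0 x -> 0 <= f x) ->
  \int[mu]_(x in D0) f x = 0 -> {ae mu, forall x, D0 x -> f x = 0}.
Proof.
move=> mf intf f0 If.
have : (\int[mu]_(x in D0) `|(EFin \o f) x| = 0)%E.
  rewrite (eq_integral (EFin \o f)); last first.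
    by move=> x /set_mem Dx /=; rewrite ger0_norm// f0.
  rewrite -[LHS]fineK; first by congr EFin.
  exact: integrable_fin_num.
move=> /ae_eq_integral_abs => /(_ mD0 (measurable_int _ intf)).
by apply: filterS => x /= + Dx => /(_ Dx) [].
Qed.

Lemma Rintegral_gt0_halfline (f : R -> R) : measurable_fun D0 f ->
  mu.-integrable D0 (EFin \o f) -> (forall x, D0 x -> 0 < f x) ->
  0 < \int[mu]_(x in D0) f x.
Proof.
move=> mf intf f0; rewrite lt_neqAle eq_sym Rintegral_ge0 ?andbT; last first.
  by move=> x Dx; rewrite ltW// f0.
apply/eqP => If.
have h := Rintegral_eq0_ae mf intf (fun x Dx => ltW (f0 x Dx)) If.
have h2 := on_nonneg_ae mu_nonneg.
have : {ae mu, forall x : R, False}.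
  by apply: filterS2 h h2 => x /= e Dx; have := f0 _ Dx; rewrite e// ltxx.
have PF : ProperFilter (almost_everywhere mu).
  have mu0 : (0 < mu [set: R])%E by rewrite probability_setT lte01.
  exact: (ae_properfilter_algebraOfSetsType mu0).
by move=> /(@filter_ex _ _ PF)[].
Qed.

Local Notation g z := (resolvent_moment mu 1 z).

(** Q is the integral of 1/|z - x|^2.  The strict inequality is the positivity of the
    variance of x |-> 1/(z - x), which vanishes only for a Dirac mass. *)
Lemma resolvent_moment_Im z : Im z != 0 -> exists2 Q : R, 0 < Q &
  Im (g z) = - (Im z * Q) /\ (nondegenerate mu -> normc (g z) ^+ 2 < Q).
Proof.
move=> yn0; have oz : offcut z by rewrite /offcut yn0.
have [i1 i2] := integrable_resolvent mu 1 oz.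
pose r x := Re ((z - x%:C)^-1 ^+ 1); pose i x := Im ((z - x%:C)^-1 ^+ 1).
rewrite -/r -/i in i1 i2.
have bd x : D0 x -> `|r x| <= `|Im z|^-1 /\ `|i x| <= `|Im z|^-1.
  move=> Dx; have : normc ((z - x%:C)^-1 ^+ 1) <= `|Im z|^-1.
    rewrite expr1 normcV lef_pV2 ?posrE ?normr_gt0// ?normc_gt0 ?offcut_neq0//.
    by rewrite (le_trans _ (norm_Im_le _))// ImD ImN /= subr0.
  by move=> h; split; [exact: le_trans (norm_Re_le _) h|exact: le_trans (norm_Im_le _) h].
have mr : measurable_fun D0 r by have /measurable_EFinP := measurable_int _ i1.
have mi : measurable_fun D0 i by have /measurable_EFinP := measurable_int _ i2.
pose q x := r x ^+ 2 + i x ^+ 2.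
have mq : measurable_fun D0 q by apply: measurable_funD; exact: measurable_funX.
have iq : mu.-integrable D0 (EFin \o q).
  apply: (@bounded_integrable _ _ _ _ mD0 mu _ (`|Im z|^-1 ^+ 2 + `|Im z|^-1 ^+ 2)) => // x Dx.
  have [b1 b2] := bd _ Dx.
  rewrite ger0_norm ?addr_ge0 ?sqr_ge0// lerD// -[leLHS]real_normK ?num_real//.
    by rewrite lerXn2r ?nnegrE ?invr_ge0.
  by rewrite lerXn2r ?nnegrE ?invr_ge0.
have qE x : D0 x -> q x = (normc (z - x%:C) ^+ 2)^-1.
  by move=> Dx; rewrite /q /r /i -sqr_normcE normcX normcV expr1 exprVn.
have q0 x : D0 x -> 0 < q x.
  by move=> Dx; rewrite qE// invr_gt0 exprn_gt0// normc_gt0 offcut_neq0.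
have iE x : D0 x -> i x = - Im z * q x.
  by move=> Dx; rewrite qE// /i expr1 ImV ImD ImN /= subr0 mulNr.
pose Q := \int[mu]_(x in D0) q x.
have Q0 : 0 < Q by exact: Rintegral_gt0_halfline.
exists Q => //.
have gI : Im (g z) = - (Im z * Q).
  rewrite /= -mulNr -RintegralZl//; apply: eq_Rintegral => x /set_mem Dx.
  exact: iE.
split => // mu_nd.
pose a := Re (g z); pose b := Im (g z).
pose v x := q x + (-2 * a) * r x + ((-2 * b) * i x + (a ^+ 2 + b ^+ 2)).
have iZ (c : R) (f : R -> R) : mu.-integrable D0 (EFin \o f) ->
    mu.-integrable D0 (EFin \o (fun x => c * f x)).
  by move=> If; exact: (@integrableZl _ _ _ mu D0 mD0 c _ If).
have iD (f h : R -> R) : mu.-integrable D0 (EFin \o f) ->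
    mu.-integrable D0 (EFin \o h) -> mu.-integrable D0 (EFin \o (fun x => f x + h x)).
  by move=> If Ih; exact: (@integrableD _ _ _ mu D0 mD0 _ _ If Ih).
have ic (c : R) : mu.-integrable D0 (EFin \o (fun=> c)).
  by apply: (@bounded_integrable _ _ _ _ mD0 mu _ `|c|) => //; exact: measurable_cst.
have iv : mu.-integrable D0 (EFin \o v).
  by apply: (iD _ _); [apply: (iD _ _) => //; exact: iZ|apply: (iD _ _) => //; exact: iZ].
have vE x : v x = (r x - a) ^+ 2 + (i x - b) ^+ 2 by rewrite /v /q; ring.
have IV : \int[mu]_(x in D0) v x = Q - (a ^+ 2 + b ^+ 2).
  rewrite /v RintegralD//; [|by apply: (iD _ _) => //; exact: iZ|by apply: (iD _ _) => //; exact: iZ].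
  rewrite RintegralD//; last exact: iZ.
  rewrite [X in _ + X]RintegralD//; last exact: iZ.
  rewrite !RintegralZl// Rintegral_cst// fine_mu_halfline// mulr1.
  have -> : \int[mu]_(x in D0) q x = Q by [].
  have -> : \int[mu]_(x in D0) r x = a by [].
  have -> : \int[mu]_(x in D0) i x = b by [].
  by ring.
rewrite sqr_normcE -/a -/b -subr_gt0 -IV lt_neqAle eq_sym Rintegral_ge0 ?andbT; last first.
  by move=> x _; rewrite vE addr_ge0// sqr_ge0.
apply/eqP => V0.
have mv : measurable_fun D0 v by have /measurable_EFinP := measurable_int _ iv.
have /(_ _) h := Rintegral_eq0_ae mv iv _ V0.
have {}h : {ae mu, forall x, D0 x -> v x = 0}.
  by apply: h => x _; rewrite vE addr_ge0// sqr_ge0.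
have h2 := on_nonneg_ae mu_nonneg.
have h3 : {ae mu, forall x, x = Re (z - (g z)^-1)}.
  apply: filterS2 h h2 => x /= + Dx => /(_ Dx); rewrite vE => /eqP.
  rewrite paddr_eq0 ?sqr_ge0// !sqrf_eq0 !subr_eq0 => /andP[/eqP h1' /eqP h2'].
  have -> : g z = (z - x%:C)^-1 by
    apply: complex_ext; [rewrite -[LHS]/a -h1' /r expr1|rewrite -[LHS]/b -h2' /i expr1].
  by rewrite invrK opprB addrCA subrr addr0.
exact: (mu_nd _ h3).
Qed.

(** The bound on s g(s) says that the integral of x / (x - s) is positive. *)
Lemma resolvent_moment_neg (s : R) : s < 0 ->
  exists2 gs : R, g s%:C = gs%:C & gs < 0 /\ (nondegenerate mu -> s * gs < 1).
Proof.
move=> s0; have oz : offcut s%:C by rewrite /offcut /= s0 orbT.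
have [i1 _] := integrable_resolvent mu 1 oz.
have sx (x : R) : D0 x -> s - x < 0.
  by rewrite /D0 /= in_itv/= andbT => x0; rewrite subr_lt0 (lt_le_trans s0).
have E x : (s%:C - x%:C)^-1 ^+ 1 = ((s - x)^-1)%:C.
  by rewrite expr1 -rmorphB /= fmorphV.
have i1' : mu.-integrable D0 (EFin \o (fun x : R => (s - x)^-1)).
  have -> // : (fun x : R => (s - x)^-1) = fun x => Re ((s%:C - x%:C)^-1 ^+ 1).
  by apply/funext => x; rewrite E.
have mr : measurable_fun D0 (fun x : R => (s - x)^-1).
  by have /measurable_EFinP := measurable_int _ i1'.
pose gs := \int[mu]_(x in D0) (s - x)^-1.
exists gs.
  apply: complex_ext; first by apply: eq_Rintegral => x _; rewrite E.
  rewrite -[RHS](mul0r (fine (mu D0))) -Rintegral_cst//.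
  by apply: eq_Rintegral => x _; rewrite E.
have iZ (c : R) (f : R -> R) : mu.-integrable D0 (EFin \o f) ->
    mu.-integrable D0 (EFin \o (fun x => c * f x)).
  by move=> If; exact: (@integrableZl _ _ _ mu D0 mD0 c _ If).
have iD (f h : R -> R) : mu.-integrable D0 (EFin \o f) ->
    mu.-integrable D0 (EFin \o h) -> mu.-integrable D0 (EFin \o (fun x => f x + h x)).
  by move=> If Ih; exact: (@integrableD _ _ _ mu D0 mD0 _ _ If Ih).
have ic (c : R) : mu.-integrable D0 (EFin \o (fun=> c)).
  by apply: (@bounded_integrable _ _ _ _ mD0 mu _ `|c|) => //; exact: measurable_cst.
split.
  rewrite -oppr_gt0 /gs -mulN1r -RintegralZl//.
  apply: Rintegral_gt0_halfline; [exact: measurable_funM|exact: iZ|].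
  by move=> x Dx; rewrite mulN1r oppr_gt0 invr_lt0 sx.
move=> mu_nd; pose f (x : R) := 1 + (- s) * (s - x)^-1.
have If : mu.-integrable D0 (EFin \o f) by apply: (iD _ _) => //; exact: iZ.
have fE x : D0 x -> f x = x / (x - s).
  move=> Dx; have := sx _ Dx => h; rewrite /f; field.
  by rewrite (lt_eqF h) gt_eqF// -oppr_lt0 opprB.
have f0 x : D0 x -> 0 <= f x.
  move=> Dx; rewrite fE// divr_ge0//; first by move: Dx; rewrite /D0/= in_itv/= andbT.
  by rewrite ltW// -oppr_lt0 opprB sx.
have mf : measurable_fun D0 f by have /measurable_EFinP := measurable_int _ If.
have IE : \int[mu]_(x in D0) f x = 1 - s * gs.
  rewrite RintegralD//; last exact: iZ.
  by rewrite RintegralZl// Rintegral_cst// fine_mu_halfline// mulr1 mulNr.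
rewrite -subr_gt0 -IE lt_neqAle eq_sym Rintegral_ge0 ?andbT//.
apply/eqP => V0.
have h := Rintegral_eq0_ae mf If f0 V0.
have h2 := on_nonneg_ae mu_nonneg.
apply: (mu_nd 0).
apply: filterS2 h h2 => x /= + Dx => /(_ Dx); rewrite fE// => /eqP.
rewrite mulf_eq0 invr_eq0 subr_eq0 => /orP[/eqP//|/eqP xs].
by have := sx _ Dx; rewrite xs subrr ltxx.
Qed.

End half_line_integrals.

End cauchy_transform.

(** * Derivatives along curves, exponential and logarithm *)

Section curves.
Context {R : realType}.
Implicit Types (f g : R -> R[i]) (s t : R) (d e w : R[i]).

(** Complex derivatives are used along real curves only, where they reduce to
    derivatives of the two components. *)
Definition curve_derive f s d :=
  is_derive s 1 (fun u => Re (f u)) (Re d) /\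
  is_derive s 1 (fun u => Im (f u)) (Im d).

Lemma is_derive_quadratic (f : R -> R) (s d K e : R) : 0 < e ->
  (forall u, `|u| <= e -> `|f (s + u) - f s - u * d| <= K * u ^+ 2) ->
  is_derive s 1 f d.
Proof.
move=> e0 H.
have C : (fun h : R => h^-1 *: ((f \o shift s) (h *: 1) - f s)) @ 0^' --> d.
  apply/cvgrPdist_le => eps eps0.
  have K1 : 0 < `|K| + 1 by rewrite ltr_wpDl.
  exists (Num.min e (eps / (`|K| + 1))) => /=; first by rewrite lt_min e0 divr_gt0.
  move=> h /=; rewrite sub0r normrN lt_min => /andP[he hK] h0.
  rewrite /GRing.scale /= mulr1 [h + s]addrC.
  have -> : d - h^-1 * (f (s + h) - f s) = - (h^-1 * (f (s + h) - f s - h * d)).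
    by field.
  rewrite normrN normrM normfV ler_pdivrMl ?normr_gt0//.
  apply: (le_trans (H _ (ltW he))).
  rewrite -(real_normK (num_real h)) expr2 mulrCA ler_wpM2l//.
  apply: (@le_trans _ _ ((`|K| + 1) * `|h|)).
    by rewrite ler_wpM2r// (le_trans (ler_norm K))// lerDl.
  by rewrite mulrC -ler_pdivlMr// ltW.
by apply: DeriveDef; [exact: cvgP C|exact: cvg_lim C].
Qed.

Lemma is_derive_congr (f : R -> R) (s a b : R) :
  is_derive s 1 f a -> a = b -> is_derive s 1 f b.
Proof. by move=> ? <-. Qed.

(** This rule and those for products, opposites and squares keep the function in
    applied form and take the derivative as a free value, so that they can be applied
    to the components of a curve by unification. *)
Lemma is_derive_addf (f g : R -> R) (s a b : R) : is_derive s 1 f a ->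
  is_derive s 1 g b -> is_derive s 1 (fun u => f u + g u) (a + b).
Proof. by move=> df dg; exact: (@is_deriveD _ _ _ f g s 1 a b df dg). Qed.

Lemma is_derive_mulf (f g : R -> R) (s a b : R) : is_derive s 1 f a ->
  is_derive s 1 g b -> is_derive s 1 (fun u => f u * g u) (a * g s + f s * b).
Proof.
move=> df dg; apply: (is_derive_congr (@is_deriveM _ _ f g s 1 a b df dg)).
by rewrite /GRing.scale /= addrC [g s * a]mulrC.
Qed.

Lemma is_derive_oppf (f : R -> R) (s a : R) : is_derive s 1 f a ->
  is_derive s 1 (fun u => - f u) (- a).
Proof. by move=> df; exact: (@is_deriveN _ _ _ f s 1 a df). Qed.

Lemma is_derive_sqrf (f : R -> R) (s a : R) : is_derive s 1 f a ->
  is_derive s 1 (fun u => f u ^+ 2) (2 * f s * a).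
Proof.
move=> df; under eq_fun do rewrite expr2.
by eapply is_derive_congr; [exact: is_derive_mulf|rewrite -mulrA mulr_natl mulr2n mulrC].
Qed.

Lemma curve_derive_quadratic f s d (K e : R) : 0 < e ->
  (forall u : R, `|u| <= e -> normc (f (s + u) - f s - u%:C * d) <= K * u ^+ 2) ->
  curve_derive f s d.
Proof.
move=> e0 H; split; apply: (is_derive_quadratic (K := K) e0) => u ue;
  apply: le_trans (H u ue).
- apply: le_trans (norm_Re_le _).
  by rewrite !ReD !ReN ReM /= mul0r subr0.
- apply: le_trans (norm_Im_le _).
  by rewrite !ImD !ImN ImM /= mul0r addr0.
Qed.

Lemma curve_derive_eq f s d e : curve_derive f s d -> d = e -> curve_derive f s e.
Proof. by move=> ? <-. Qed.

Lemma curve_derive_cst w s : curve_derive (fun=> w) s 0.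
Proof. by split; exact: is_derive_cst. Qed.

Lemma curve_deriveD f g s d e : curve_derive f s d -> curve_derive g s e ->
  curve_derive (fun u => f u + g u) s (d + e).
Proof.
move=> [f1 f2] [g1 g2]; split.
  rewrite ReD; under eq_fun do rewrite ReD; exact: is_derive_addf.
rewrite ImD; under eq_fun do rewrite ImD; exact: is_derive_addf.
Qed.

Lemma curve_deriveN f s d : curve_derive f s d ->
  curve_derive (fun u => - f u) s (- d).
Proof.
move=> [f1 f2]; split.
  rewrite ReN; under eq_fun do rewrite ReN; exact: is_derive_oppf.
rewrite ImN; under eq_fun do rewrite ImN; exact: is_derive_oppf.
Qed.

Lemma curve_deriveM f g s d e : curve_derive f s d -> curve_derive g s e ->
  curve_derive (fun u => f u * g u) s (d * g s + f s * e).
Proof.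
move=> [f1 f2] [g1 g2]; split.
  under eq_fun do rewrite ReM.
  apply: (is_derive_congr (is_derive_addf (is_derive_mulf f1 g1)
    (is_derive_oppf (is_derive_mulf f2 g2)))).
  by rewrite !ReD !ReM /GRing.scale /=; ring.
under eq_fun do rewrite ImM.
apply: (is_derive_congr (is_derive_addf (is_derive_mulf f1 g2) (is_derive_mulf f2 g1))).
by rewrite !ImD !ImM /GRing.scale /=; ring.
Qed.

Lemma is_derive_inv (f : R -> R) s (d : R) : f s != 0 -> is_derive s 1 f d ->
  is_derive s 1 (fun u => (f u)^-1) (- (f s) ^- 2 * d).
Proof.
move=> fs0 [df <-]; apply: DeriveDef; first exact: derivableV.
by rewrite deriveV.
Qed.

Lemma curve_deriveV f s d : f s != 0 -> curve_derive f s d ->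
  curve_derive (fun u => (f u)^-1) s (- d * (f s)^-1 ^+ 2).
Proof.
move=> fs0 [f1 f2].
have n0 : Re (f s) ^+ 2 + Im (f s) ^+ 2 != 0.
  by rewrite -sqr_normcE sqrf_eq0 gt_eqF// normc_gt0.
have N : is_derive s 1 (fun u => (Re (f u) ^+ 2 + Im (f u) ^+ 2)^-1)
    (- (Re (f s) ^+ 2 + Im (f s) ^+ 2) ^- 2 *
       (2 * Re (f s) * Re d + 2 * Im (f s) * Im d)).
  apply: is_derive_inv => //.
  apply: (is_derive_congr (is_derive_addf (is_derive_sqrf f1) (is_derive_sqrf f2))).
  by ring.
have cE : (f s)^-1 ^+ 2 = (Re (f s) -i* Im (f s)) ^+ 2 *
     (((Re (f s) ^+ 2 + Im (f s) ^+ 2)^-1) ^+ 2)%:C.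
  have -> : (f s)^-1 = (Re (f s) -i* Im (f s)) * ((Re (f s) ^+ 2 + Im (f s) ^+ 2)^-1)%:C.
    apply: complex_ext; rewrite ?ReV ?ImV ?ReM ?ImM /= sqr_normcE.
      by rewrite mulr0 subr0.
    by rewrite mulr0 add0r mulNr.
  by rewrite exprMn rmorphXn.
split.
  under eq_fun do rewrite ReV sqr_normcE.
  apply: (is_derive_congr (is_derive_mulf f1 N)).
  rewrite cE !expr2 !(ReM, ImM, ReN, ImN) /=.
  by field.
under eq_fun do rewrite ImV sqr_normcE.
apply: (is_derive_congr (is_derive_oppf (is_derive_mulf f2 N))).
rewrite cE !expr2 !(ReM, ImM, ReN, ImN) /=.
by field.
Qed.

Lemma curve_derive_cvg f s d : curve_derive f s d ->
  (Re (f u) @[u --> s] --> Re (f s)) /\ (Im (f u) @[u --> s] --> Im (f s)).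
Proof.
move=> [[f1 _] [f2 _]]; split.
  by apply: differentiable_continuous; exact/derivable1_diffP.
by apply: differentiable_continuous; exact/derivable1_diffP.
Qed.

Definition cexp w : R[i] := (expR (Re w) * cos (Im w)) +i* (expR (Re w) * sin (Im w)).

(** The branch of the logarithm on the closed lower half-plane minus 0 with imaginary
    part in [-pi, 0]; at a negative real number it takes the value approached from below. *)
Definition lower_log w : R[i] := ln (normc w) -i* acos (Re w / normc w).

Lemma cexpD w z : cexp (w + z) = cexp w * cexp z.
Proof.
apply: complex_ext; rewrite ?ReM ?ImM /= ReD ImD expRD ?cosD ?sinD; ring.
Qed.

Lemma cexp0 : cexp 0 = 1.
Proof. by apply: complex_ext; rewrite /= expR0 ?cos0 ?sin0 ?mulr1 ?mulr0. Qed.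

Lemma cexp_neq0 w : cexp w != 0.
Proof.
apply/eqP => h; have := cexpD w (- w); rewrite subrr cexp0 h mul0r.
by move/eqP; rewrite oner_eq0.
Qed.

Lemma curve_derive_cexp f s d : curve_derive f s d ->
  curve_derive (fun u => cexp (f u)) s (cexp (f s) * d).
Proof.
move=> [f1 f2].
have E : is_derive s 1 (fun u => expR (Re (f u))) (expR (Re (f s)) * Re d).
  exact: (is_derive1_comp (f := @expR R)).
have C : is_derive s 1 (fun u => cos (Im (f u))) (- sin (Im (f s)) * Im d).
  exact: (is_derive1_comp (f := @cos R)).
have S : is_derive s 1 (fun u => sin (Im (f u))) (cos (Im (f s)) * Im d).
  exact: (is_derive1_comp (f := @sin R)).
split.
  apply: (is_derive_congr (is_derive_mulf E C)).
  by rewrite ReM /GRing.scale /=; ring.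
apply: (is_derive_congr (is_derive_mulf E S)).
by rewrite ImM /GRing.scale /=; ring.
Qed.

Lemma lower_ratio w : Im w < 0 -> -1 < Re w / normc w < 1.
Proof.
move=> w0; have n0 : 0 < normc w.
  by rewrite normc_gt0; apply: contraTneq w0 => ->; rewrite ltxx.
rewrite ltr_pdivlMr// ltr_pdivrMr// mulN1r mul1r -ltr_norml.
rewrite -(@ltr_pXn2r _ 2) ?nnegrE ?(ltW n0)// real_normK ?num_real// sqr_normcE.
by rewrite ltrDl exprn_even_gt0//= lt_eqF.
Qed.

Lemma curve_derive_lower_log f s d : Im (f s) < 0 -> curve_derive f s d ->
  curve_derive (fun u => lower_log (f u)) s (d / f s).
Proof.
move=> w0 [f1 f2]; have n0 : 0 < normc (f s).
  by rewrite normc_gt0; apply: contraTneq w0 => ->; rewrite ltxx.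
have q0 : 0 < Re (f s) ^+ 2 + Im (f s) ^+ 2 by rewrite -sqr_normcE exprn_gt0.
set a := Re (f s) in f1 q0 *; set b := Im (f s) in f2 q0 w0 *.
set n := normc (f s) in n0 *.
have nE : n ^+ 2 = a ^+ 2 + b ^+ 2 by rewrite sqr_normcE.
have nn0 : n != 0 by rewrite gt_eqF.
have N : is_derive s 1 (fun u => normc (f u)) ((a * Re d + b * Im d) / n).
  have -> : (fun u => normc (f u)) = Num.sqrt \o (fun u => Re (f u) ^+ 2 + Im (f u) ^+ 2).
    apply/funext => u /=; rewrite -[LHS]ger0_norm ?normc_ge0//.
    by rewrite -sqrtr_sqr sqr_normcE.
  have D := is_derive_addf (is_derive_sqrf f1) (is_derive_sqrf f2).
  apply: (is_derive_congr (is_derive1_comp (is_derive1_sqrt _) D)) => //.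
  by rewrite -/a -/b -nE sqrtr_sqr ger0_norm ?(ltW n0)//; field.
have L : is_derive s 1 (fun u => ln (normc (f u))) ((a * Re d + b * Im d) / n ^+ 2).
  apply: (is_derive_congr (is_derive1_comp (is_derive1_ln n0) N)).
  by rewrite -/n; field.
have Q : is_derive s 1 (fun u => Re (f u) / normc (f u))
    (Re d / n - a * (a * Re d + b * Im d) / n ^+ 3).
  apply: (is_derive_congr (is_derive_mulf f1 (is_derive_inv nn0 N))).
  by rewrite -/n -/a /GRing.scale /=; field.
have A : is_derive s 1 (fun u => acos (Re (f u) / normc (f u)))
    ((Re d / n - a * (a * Re d + b * Im d) / n ^+ 3) * (n / b)).
  have lr := @lower_ratio (f s) w0.
  apply: (is_derive_congr (@is_derive1_comp _ (@acos R)
    (fun u => Re (f u) / normc (f u)) s _ _ (is_derive1_acos lr) Q)).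
  rewrite -/n -/a mulrC; congr (_ * _).
  have -> : 1 - (a / n) ^+ 2 = (- b / n) ^+ 2.
    by rewrite !exprMn sqrrN exprVn nE; field; rewrite gt_eqF.
  rewrite sqrtr_sqr ger0_norm ?divr_ge0 ?oppr_ge0 ?(ltW n0) ?(ltW w0)//.
  by field; rewrite nn0 lt_eqF.
have b0 : b != 0 by rewrite lt_eqF.
split.
  by apply: is_derive_congr L _; rewrite ReM ReV ImV -/a -/b -/n; field.
apply: (is_derive_congr (is_derive_oppf A)).
rewrite ImM ReV ImV -/a -/b -/n.
have -> : Re d / n = Re d * (a ^+ 2 + b ^+ 2) / n ^+ 3 by rewrite -nE; field.
by field; rewrite ?b0 ?nn0.
Qed.

Lemma is_derive0_cst_oc (f : R -> R) (a b : R) : a < b ->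
  (forall x, a < x <= b -> is_derive x 1 f 0) -> forall x, a < x <= b -> f x = f b.
Proof.
move=> ab df x /andP[ax xb].
have [||c _] := @MVT_segment _ f (fun=> 0) x b xb.
- by move=> y; rewrite in_itv/= => /andP[xy yb]; apply: df; rewrite (lt_trans ax xy) ltW.
- apply: derivable_within_continuous => y; rewrite in_itv/= => /andP[xy yb].
  by apply: ex_derive; apply: df; rewrite (lt_le_trans ax xy) yb.
by rewrite mul0r => /eqP; rewrite subr_eq0 => /eqP ->.
Qed.

End curves.

(** * The function z - F(z) and the relation A' B = t A B' *)

Section wronskian.
Context {R : realType}.
Implicit Types (mu nu : probability R R) (z w h : R[i]) (a s t : R).
Local Notation D0 := (@halfline R).
Local Notation g1 mu z := (resolvent_moment mu 1 z).
Local Notation g2 mu z := (resolvent_moment mu 2 z).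

(** This is eta(1/z) / (1/z), that is z - F(z), for a measure on the half-line. *)
Definition eta_quotient mu z : R[i] := z - (g1 mu z)^-1.

Lemma resolvent_moment_neq0 mu z : on_nonneg mu -> offcut z -> g1 mu z != 0.
Proof.
move=> h oz; have [y0|y0] := eqVneq (Im z) 0.
  have x0 : Re z < 0 by move: oz; rewrite /offcut y0 eqxx.
  have -> : z = (Re z)%:C by apply: complex_ext.
  have [gs -> [g0 _]] := resolvent_moment_neg h x0.
  by rewrite eq_complex /= eqxx andbT lt_eqF.
have [Q Q0 [gI _]] := resolvent_moment_Im h y0.
apply/eqP => g0; move/eqP : gI; rewrite g0 eq_sym /= oppr_eq0 mulf_eq0 (negbTE y0) /=.
by rewrite gt_eqF.
Qed.

(** With the constant Q of the lemma on imaginary parts, Im(z - 1/g) is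
    Im z (1 - Q / |g|^2), and Q > |g|^2. *)
Lemma Im_eta_quotient_lt0 mu z : on_nonneg mu -> nondegenerate mu -> 0 < Im z ->
  Im (eta_quotient mu z) < 0.
Proof.
move=> h nd y0; have y1 : Im z != 0 by rewrite gt_eqF.
have [Q Q0 [gI /(_ nd) gQ]] := resolvent_moment_Im h y1.
have n0 : 0 < normc (g1 mu z) ^+ 2.
  by rewrite exprn_gt0// normc_gt0 resolvent_moment_neq0// /offcut y1.
rewrite /eta_quotient ImD ImN ImV gI mulNr opprK -mulrA -[X in X - _]mulr1 -mulrBr.
by rewrite pmulr_rlt0// subr_lt0 ltr_pdivlMr// mul1r.
Qed.

Lemma eta_quotient_neg mu s : on_nonneg mu -> s < 0 ->
  exists2 b : R, eta_quotient mu s%:C = b%:C & (nondegenerate mu -> 0 < b).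
Proof.
move=> h s0; have [gs gE [g0 g1]] := resolvent_moment_neg h s0.
exists (s - gs^-1); first by rewrite /eta_quotient gE -fmorphV -rmorphB.
move=> /g1 sg; have -> : s - gs^-1 = (1 - s * gs) / - gs.
  by field; rewrite lt_eqF.
by rewrite divr_gt0 ?subr_gt0// oppr_gt0.
Qed.

Lemma curve_derive_resolvent mu (c : R -> R[i]) s (d : R[i]) (K : R) :
  offcut (c s) -> (forall u : R, normc (c (s + u) - c s - u%:C * d) <= K * u ^+ 2) ->
  curve_derive (fun u => g1 mu (c u)) s (- (d * g2 mu (c s))).
Proof.
move=> oz cd; have [K1 K10 [e e0 H]] := resolvent_moment_taylor mu oz.
have K0 : 0 <= K by have := cd 1; rewrite expr1n mulr1; apply: le_trans; exact: normc_ge0.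
pose L := normc d + K + 1.
have L0 : 0 < L by rewrite ltr_wpDl// addr_ge0// normc_ge0.
have d0 : 0 < Num.min 1 (e / L) by rewrite lt_min ltr01 divr_gt0.
apply: (curve_derive_quadratic (K := K1 * L ^+ 2 + normc (g2 mu (c s)) * K) d0) => u.
rewrite le_min => /andP[u1 ue].
have cL : normc (c (s + u) - c s) <= L * `|u|.
  rewrite -[X in normc X](subrK (u%:C * d)) (le_trans (le_normcD _ _))//.
  rewrite normcM normc_real (_ : L * `|u| = (K + 1) * `|u| + `|u| * normc d); last first.
    by rewrite /L; ring.
  rewrite lerD// (le_trans (cd u))// -(real_normK (num_real u)) expr2 mulrDl mul1r.
  by rewrite ler_wpDr// ler_wpM2l// ler_piMl.
rewrite (_ : _ - _ = (g1 mu (c (s + u)) - g1 mu (c s) + (c (s + u) - c s) * g2 mu (c s))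
   - (c (s + u) - c s - u%:C * d) * g2 mu (c s)); last by ring.
apply: (le_trans (le_normcD _ _)); rewrite normcN [in leRHS]mulrDl lerD//.
  rewrite (le_trans (H _ _))//.
    by rewrite (le_trans cL)// mulrC -ler_pdivlMr.
  rewrite -mulrA ler_wpM2l// -(real_normK (num_real u)) -exprMn lerXn2r ?nnegrE ?normc_ge0//.
  by rewrite mulr_ge0// ltW.
by rewrite normcM mulrC -mulrA ler_wpM2l ?normc_ge0// cd.
Qed.

Lemma curve_derive_eta_quotient mu (c : R -> R[i]) s (d : R[i]) (K : R) :
  on_nonneg mu ->
  offcut (c s) -> (forall u : R, normc (c (s + u) - c s - u%:C * d) <= K * u ^+ 2) ->
  curve_derive (fun u => eta_quotient mu (c u)) s
    (d * (1 - g2 mu (c s) * (g1 mu (c s))^-1 ^+ 2)).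
Proof.
move=> h oz cd.
have C : curve_derive c s d by apply: (curve_derive_quadratic ltr01) => u _; exact: cd.
have G := curve_deriveV (resolvent_moment_neq0 h oz) (curve_derive_resolvent mu oz cd).
apply: curve_derive_eq (curve_deriveD C (curve_deriveN G)) _.
ring.
Qed.

(** The expression A' B - t A B' times g_nu^2 g_mu^2, where g = 1/F: multiplying out
    the inverses leaves a polynomial in z and in the first two resolvent moments. *)
Definition wronskian t mu nu z : R[i] :=
  (g1 nu z ^+ 2 - g2 nu z) * (g1 mu z * (z * g1 mu z - 1)) -
  t%:C * (g1 nu z * (z * g1 nu z - 1)) * (g1 mu z ^+ 2 - g2 mu z).

Lemma wronskianE t mu nu z : on_nonneg mu -> on_nonneg nu -> offcut z ->
  wronskian t mu nu z = g1 nu z ^+ 2 * g1 mu z ^+ 2 *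
   ((1 - g2 nu z * (g1 nu z)^-1 ^+ 2) * eta_quotient mu z -
    t%:C * eta_quotient nu z * (1 - g2 mu z * (g1 mu z)^-1 ^+ 2)).
Proof.
move=> hm hn oz; have := resolvent_moment_neq0 hm oz.
have := resolvent_moment_neq0 hn oz.
rewrite /wronskian /eta_quotient => n0 m0; field.
by rewrite n0 m0.
Qed.

Variables (mu nu : probability R R) (t : R).
Hypotheses (mu_nonneg : on_nonneg mu) (nu_nonneg : on_nonneg nu).
Hypotheses (mu_nd : nondegenerate mu) (t_gt0 : 0 < t).
Hypothesis power_neg : forall s, s < 0 ->
  eta_quotient nu s%:C = ((Re (eta_quotient mu s%:C)) `^ t)%:C.

(** On the negative axis A = B^t is an identity between real functions and can be
    differentiated there. *)
Lemma wronskian_neg s : s < 0 -> wronskian t mu nu s%:C = 0.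
Proof.
move=> s0; have oz : offcut s%:C by rewrite /offcut /= s0 orbT.
have cd (u : R) : normc ((s + u)%:C - s%:C - u%:C * 1) <= 0 * u ^+ 2.
  by rewrite mulr1 rmorphD [s%:C + _]addrC addrK subrr normc0 mul0r.
have [M1 M2] := curve_derive_eta_quotient mu_nonneg oz cd.
have [N1 N2] := curve_derive_eta_quotient nu_nonneg oz cd.
rewrite mul1r in M1 M2; rewrite mul1r in N1 N2.
set m' := (1 - g2 mu _ * _) in M1 M2.
set n' := (1 - g2 nu _ * _) in N1 N2.
have near_neg (P : R -> Prop) : (forall u, u < 0 -> P u) -> \forall u \near s, P u.
  move=> H; near=> u; apply: H; near: u.
  exact: lt_nbhsl.
have real_m u : u < 0 -> Im (eta_quotient mu u%:C) = 0.
  by move=> u0; have [b ->] := eta_quotient_neg mu_nonneg u0.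
have der0 (f : R -> R) (a : R) : is_derive s 1 f a -> (forall u, u < 0 -> f u = 0) -> a = 0.
  move=> [_ <-] f0; rewrite (@near_eq_derive _ _ _ f (cst 0)) ?derive_cst//.
  exact: near_neg.
have m'E : m' = (Re m')%:C by apply: complex_ext => //=; exact: der0 M2 real_m.
have n'i : Im n' = 0 by apply: der0 N2 _ => u u0; rewrite power_neg.
have [b bE /(_ mu_nd) b0] := eta_quotient_neg mu_nonneg s0.
have bRe : b = Re (eta_quotient mu s%:C) by rewrite bE.
have P : is_derive s 1 (fun u => (Re (eta_quotient mu u%:C)) `^ t)
    (t * b `^ (t - 1) * Re m').
  rewrite bRe in b0 *.
  have H := is_derive1_powR t b0.
  exact: (@is_derive1_comp _ (fun x => x `^ t) (fun u => Re (eta_quotient mu u%:C)) s _ _ H M1).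
have n'r : Re n' = t * b `^ (t - 1) * Re m'.
  have [_ <-] := N1; have [_ <-] := P.
  apply: near_eq_derive => //.
  by apply: near_neg => u u0; rewrite power_neg.
have n'E : n' = (t * b `^ (t - 1) * Re m')%:C by apply: complex_ext.
rewrite wronskianE// -/m' -/n' power_neg// -bRe bE n'E m'E -!rmorphM -rmorphB /=.
rewrite (_ : _ - _ = 0) ?mulr0//.
rewrite -(mulr_powRB1 (ltW b0) t_gt0); ring.
Unshelve. all: by end_near.
Qed.

End wronskian.

(** * Continuity of the logarithm up to the real axis *)

Section acos_continuity.
Context {R : realType}.

Lemma within_continuous_acos : {within `[(-1), 1], continuous (@acos R)}.
Proof.
have B (x : R) : x \in `[(-1), 1] -> acos x \in `[0, pi].
  by rewrite !in_itv /= => h; rewrite acos_ge0// acos_lepi.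
apply: segment_dec_surj_continuous.
  move=> x y xi yi; rewrite leNgt -ltr_cos ?B// !acosK// -leNgt //.
move=> y /=; rewrite acos1 acosN1 => y0pi; exists (cos y); last exact: cosK.
by rewrite /= in_itv/= cos_geN1 cos_le1.
Qed.

(** acos is continuous on the closed segment, but not differentiable at its ends; the
    ends correspond to boundary values of B on the real axis. *)
Lemma cvg_acos (T : Type) (F : set_system T) {FF : Filter F} (f : T -> R) (l : R) :
  (\forall x \near F, -1 <= f x <= 1) -> -1 <= l <= 1 ->
  f x @[x --> F] --> l -> acos (f x) @[x --> F] --> acos l.
Proof.
move=> fF l1 fl.
have /(_ l) C := (subspace_continuousP _ _).1 within_continuous_acos.
have {}C : acos @ within `[(-1), 1] (nbhs l) --> acos l by apply: C; rewrite /= in_itv.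
move=> A /C /fl H.
by apply: filterS2 fF H => x /= fx; apply; rewrite /= in_itv.
Qed.

Lemma ratio_bounds (w : R[i]) : -1 <= Re w / normc w <= 1.
Proof.
have [->|w0] := eqVneq w 0; first by rewrite mul0r lerN10 ler01.
rewrite -ler_norml normrM normfV [X in _ / X]ger0_norm ?normc_ge0//.
by rewrite ler_pdivrMr ?normc_gt0// mul1r norm_Re_le.
Qed.

Lemma cvg_normc (T : Type) (F : set_system T) {FF : Filter F} (f : T -> R[i]) (l : R[i]) :
  Re (f x) @[x --> F] --> Re l -> Im (f x) @[x --> F] --> Im l ->
  normc (f x) @[x --> F] --> normc l.
Proof.
move=> f1 f2.
have E (w : R[i]) : normc w = Num.sqrt (Re w ^+ 2 + Im w ^+ 2).
  by rewrite -sqr_normcE sqrtr_sqr ger0_norm ?normc_ge0.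
rewrite E; under eq_fun do rewrite E.
apply: (cvg_comp _ (@Num.sqrt R) _ (@sqrt_continuous R _)).
by apply: cvgD; rewrite expr2; under eq_fun do rewrite expr2; exact: cvgM.
Qed.

Lemma cvg_lower_log (T : Type) (F : set_system T) {FF : Filter F} (f : T -> R[i]) (l : R[i]) :
  l != 0 ->
  Re (f x) @[x --> F] --> Re l -> Im (f x) @[x --> F] --> Im l ->
  Re (lower_log (f x)) @[x --> F] --> Re (lower_log l) /\
  Im (lower_log (f x)) @[x --> F] --> Im (lower_log l).
Proof.
move=> l0 f1 f2; have n0 : 0 < normc l by rewrite normc_gt0.
have N := @cvg_normc T F FF f l f1 f2.
split; first exact: (cvg_comp _ (@ln R) N (continuous_ln n0)).
apply: cvgN; apply: cvg_acos; first by near=> x; exact: ratio_bounds.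
  exact: ratio_bounds.
by apply: cvgM => //; apply: cvgV => //; rewrite gt_eqF.
Unshelve. all: by end_near.
Qed.

Lemma cvg_cexp (T : Type) (F : set_system T) {FF : Filter F} (f : T -> R[i]) (l : R[i]) :
  Re (f x) @[x --> F] --> Re l -> Im (f x) @[x --> F] --> Im l ->
  Re (cexp (f x)) @[x --> F] --> Re (cexp l) /\
  Im (cexp (f x)) @[x --> F] --> Im (cexp l).
Proof.
move=> f1 f2; have E := cvg_comp _ (@expR R) f1 (@continuous_expR R _).
split; apply: cvgM => //.
  exact: (cvg_comp _ (@cos R) f2 (@continuous_cos R _)).
exact: (cvg_comp _ (@sin R) f2 (@continuous_sin R _)).
Qed.

Lemma cvg_cmul (T : Type) (F : set_system T) {FF : Filter F} (f g : T -> R[i]) (l m : R[i]) :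
  Re (f x) @[x --> F] --> Re l -> Im (f x) @[x --> F] --> Im l ->
  Re (g x) @[x --> F] --> Re m -> Im (g x) @[x --> F] --> Im m ->
  Re (f x * g x) @[x --> F] --> Re (l * m) /\
  Im (f x * g x) @[x --> F] --> Im (l * m).
Proof.
move=> f1 f2 h1 h2; rewrite ReM ImM.
under eq_fun do rewrite ReM; under [X in _ /\ X @ _ --> _]eq_fun do rewrite ImM.
by split; [apply: cvgB; exact: cvgM|apply: cvgD; exact: cvgM].
Qed.

End acos_continuity.

(** * Analytic continuation of A = B^t to the upper half-plane *)

Section continuation.
Context {R : realType}.
Implicit Types (mu nu : probability R R) (z w h : R[i]) (a s t : R).
Local Notation D0 := (@halfline R).
Local Notation g1 mu z := (resolvent_moment mu 1 z).
Local Notation g2 mu z := (resolvent_moment mu 2 z).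
Let mD0 := @measurable_halfline R.

(** Square of a point of the right half-plane, turned by a half-turn: the disc
    |h| < 1 avoids [0, +oo[, and its real diameter covers part of the negative axis. *)
Definition disc_chart a h : R[i] := - (a ^+ 2)%:C * (1 + h) ^+ 2.

(** Since p^2 + q^2 = p <= 1, the reciprocal is a product of two geometric series of
    ratio at most |h| in modulus, uniformly in x >= 0. *)
Lemma disc_chart_factor a x h : 0 < a -> 0 <= x ->
  let p := a ^+ 2 / (a ^+ 2 + x) in let q := a * Num.sqrt x / (a ^+ 2 + x) in
  disc_chart a h - x%:C =
    - (a ^+ 2 + x)%:C * (1 + (p -i* q) * h) * (1 + (p +i* q) * h).
Proof.
move=> a0 x0 p q; have d0 : a ^+ 2 + x != 0.
  by rewrite gt_eqF// ltr_wpDr// exprn_gt0.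
have pq : p ^+ 2 + q ^+ 2 = p.
  by rewrite /p /q !exprMn sqr_sqrtr//; field.
have S : (p -i* q) + (p +i* q) = (2 * p)%:C.
  by apply: complex_ext; rewrite ?ReD ?ImD /=; ring.
have P : (p -i* q) * (p +i* q) = p%:C.
  by apply: complex_ext; rewrite ?ReM ?ImM /=; [rewrite -[RHS]pq|]; ring.
have -> : - (a ^+ 2 + x)%:C * (1 + (p -i* q) * h) * (1 + (p +i* q) * h) =
   - (a ^+ 2 + x)%:C * (1 + ((p -i* q) + (p +i* q)) * h + ((p -i* q) * (p +i* q)) * h ^+ 2).
  by ring.
rewrite S P rmorphM /= /disc_chart.
have E : (a ^+ 2)%:C = (a ^+ 2 + x)%:C * p%:C.
  by rewrite -rmorphM /= /p mulrC mulfVK.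
have E2 : x%:C = (a ^+ 2 + x)%:C - (a ^+ 2 + x)%:C * p%:C.
  by rewrite -E -rmorphB /= addrC addKr.
rewrite (E2) E; have -> : 2%:C = 2 :> R[i] by rewrite rmorphMn.
by ring.
Qed.

Lemma analytic_family_resolvent a : 0 < a ->
  analytic_family D0 (fun x h => (disc_chart a h - x%:C)^-1).
Proof.
move=> a0.
have D0ge x : D0 x -> 0 <= x by rewrite /halfline /= in_itv /= andbT.
pose p (x : R) := a ^+ 2 / (a ^+ 2 + `|x|).
pose q (x : R) := a * Num.sqrt x / (a ^+ 2 + `|x|).
have d0 x : 0 < a ^+ 2 + `|x| by rewrite ltr_wpDr// exprn_gt0.
have mV : measurable_fun D0 (fun x : R => (a ^+ 2 + `|x|)^-1).
  apply: measurable_fun_inv_ge0 => [x|]; first exact: ltW.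
  apply: measurable_funD; first exact: measurable_cst.
  exact: normr_measurable.
have mp : measurable_fun D0 p by apply: measurable_funM => //; exact: measurable_cst.
have mq : measurable_fun D0 q.
  apply: measurable_funM => //; apply: measurable_funM; first exact: measurable_cst.
  apply: (measurable_funS measurableT) => //.
  exact: continuous_measurable_fun (@sqrt_continuous R).
have pq x : D0 x -> p x ^+ 2 + q x ^+ 2 = p x.
  move=> /D0ge x0; rewrite /p /q !exprMn sqr_sqrtr// ger0_norm//; field.
  by rewrite gt_eqF// ltr_wpDr// exprn_gt0.
have p1 x : p x <= 1 by rewrite /p ler_pdivrMr// mul1r lerDl.
have k1 x (k : R[i]) : D0 x -> normc k ^+ 2 = p x ^+ 2 + q x ^+ 2 -> normc k <= 1.
  move=> Dx h; rewrite -(@ler_pXn2r _ 2) ?nnegrE ?normc_ge0//.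
  by rewrite h pq// expr1n.
have AF : analytic_family D0 (fun x h => (- (a ^+ 2 + `|x|)^-1)%:C *
   ((1 + (p x -i* q x) * h)^-1 * (1 + (p x +i* q x) * h)^-1)).
  apply: analytic_familyM => //.
    apply: analytic_family_cst.
      by split => /=; [exact: measurable_funN|exact: measurable_cst].
    exists (a ^+ 2)^-1 => x _; rewrite normc_real normrN normfV gtr0_norm//.
    by rewrite lef_pV2 ?posrE ?exprn_gt0// lerDl.
  apply: analytic_familyM => //; apply: analytic_family_geom => //.
  - by split => //=; exact: measurable_funN.
  - by move=> x Dx; apply: (k1 x) => //; rewrite sqr_normcE /= sqrrN.
  - by move=> x Dx; apply: (k1 x) => //; rewrite sqr_normcE.
apply: eq_analytic_family AF => x h Dx h1.
rewrite (disc_chart_factor _ a0 (D0ge _ Dx)) /p /q ger0_norm ?D0ge//.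
by rewrite !invfM -!mulrA rmorphN /= fmorphV invrN.
Qed.

Lemma analytic_family_resolvent_moment mu n a : 0 < a ->
  analytic_family D0 (fun (_ : R) h => resolvent_moment mu n (disc_chart a h)).
Proof.
move=> a0; apply: (analytic_family_int mD0 mu).
by apply: analytic_familyX => //; exact: analytic_family_resolvent.
Qed.

Lemma wronskian_disc mu nu t : (forall s, s < 0 -> wronskian t mu nu s%:C = 0) ->
  forall a h, 0 < a -> normc h < 1 -> wronskian t mu nu (disc_chart a h) = 0.
Proof.
move=> W0 a h a0 h1.
have D00 : D0 0 by rewrite /halfline /= in_itv /= lexx.
have cst c : analytic_family D0 (fun (_ : R) (_ : R[i]) => c).
  apply: analytic_family_cst; first exact: cmeas_cst.
  by exists (normc c).
apply: (analytic_family_eq0 (f := fun _ h => wronskian t mu nu (disc_chart a h)) D00 _ _ h1) => //.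
  have A m n := analytic_family_resolvent_moment m n a0.
  have N f : analytic_family D0 f -> analytic_family D0 (fun (x : R) h => - f x h).
    move=> af; apply: (eq_analytic_family (f := fun x h => -1 * f x h)).
      by move=> x h' _ _; rewrite mulN1r.
    by apply: analytic_familyM => //; exact: cst.
  have Z : analytic_family D0 (fun (_ : R) h => disc_chart a h).
    apply: analytic_familyM => //.
    apply: analytic_familyX => //; apply: analytic_familyD => //.
    exact: analytic_family_id.
  have Q m : analytic_family D0 (fun (_ : R) h => g1 m (disc_chart a h) *
      (disc_chart a h * g1 m (disc_chart a h) - 1)).
    apply: analytic_familyM => //; apply: analytic_familyD => //.
    exact: analytic_familyM.
  have P m : analytic_family D0 (fun (_ : R) h => g1 m (disc_chart a h) ^+ 2 - g2 m (disc_chart a h)).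
    apply: analytic_familyD => //; first exact: analytic_familyX.
    exact: N.
  apply: analytic_familyD => //; first exact: analytic_familyM.
  apply: N; apply: analytic_familyM => //; apply: analytic_familyM => //.
move=> r /andP[r1 r2]; rewrite /disc_chart.
have -> : - (a ^+ 2)%:C * (1 + r%:C) ^+ 2 = (- (a ^+ 2) * (1 + r) ^+ 2)%:C.
  by rewrite [RHS]rmorphM [in RHS]rmorphN [X in _ = _ * X]rmorphXn rmorphD.
apply: W0; rewrite mulNr oppr_lt0 mulr_gt0 ?exprn_gt0//.
by rewrite -ltrBlDl sub0r.
Qed.

(** Take the square root v = p + i q of z with p, q > 0 and a = (p^2 + q^2) / q; then
    h = v / (i a) - 1 satisfies |h|^2 = 1 - q^2 / (p^2 + q^2).  The sign of Im h keeps
    the whole path s |-> s h, 0 < s <= 1, above the real axis. *)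
Lemma disc_chart_surj z : 0 < Im z -> exists2 a : R, 0 < a &
  exists2 h : R[i], disc_chart a h = z & normc h < 1 /\ Im h < 0.
Proof.
move=> y0.
have [v vz q0] : exists2 v : R[i], v ^+ 2 = z & 0 < Im v.
  have [q0|q0|q0] := ltgtP 0 (Im (sqrtc z)).
  - by exists (sqrtc z) => //; exact: sqr_sqrtc.
  - by exists (- sqrtc z); rewrite ?sqrrN ?sqr_sqrtc// ImN oppr_gt0.
  - by move: y0; rewrite -(sqr_sqrtc z) expr2 ImM -q0 mulr0 mul0r addr0 ltxx.
have p0 : 0 < Re v.
  move: y0; rewrite -vz expr2 ImM [Im v * _]mulrC -mulr2n pmulrn_lgt0//.
  by rewrite pmulr_lgt0.
set p := Re v in p0; set q := Im v in q0.
pose a := (p ^+ 2 + q ^+ 2) / q.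
have pq0 : 0 < p ^+ 2 + q ^+ 2 by rewrite addr_gt0// exprn_gt0.
have a0 : 0 < a by rewrite divr_gt0.
exists a => //; exists ((q / a - 1) -i* (p / a)).
  rewrite /disc_chart -vz.
  have -> : v = a%:C * 'i%C * (1 + ((q / a - 1) -i* (p / a))).
    have ? : a != 0 by rewrite gt_eqF.
    by apply: complex_ext; rewrite !(ReM, ImM, ReD, ImD) /= -/p -/q; field.
  rewrite [in RHS]exprMn [in RHS]exprMn sqr_i rmorphXn; ring.
rewrite /= oppr_lt0 divr_gt0//; split => //.
rewrite -[ltRHS]sqrtr1 ltr_sqrt//.
have -> : (q / a - 1) ^+ 2 + (- (p / a)) ^+ 2 = 1 - q ^+ 2 / (p ^+ 2 + q ^+ 2).
  rewrite /a; field.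
  by rewrite !gt_eqF.
by rewrite ltrBlDr ltrDl divr_gt0// exprn_gt0.
Qed.

Variables (mu nu : probability R R) (t : R).
Hypotheses (mu_nonneg : on_nonneg mu) (nu_nonneg : on_nonneg nu).
Hypotheses (mu_nd : nondegenerate mu) (t_gt0 : 0 < t).
Hypothesis power_neg : forall s, s < 0 ->
  eta_quotient nu s%:C = ((Re (eta_quotient mu s%:C)) `^ t)%:C.

(** Along the path c joining the negative axis to z, the function A exp(-t log B) has
    derivative 0 for s > 0.  At s = 0, where B is real and the logarithm is not
    differentiable, continuity gives it the value 1. *)
Theorem eta_quotient_power z : 0 < Im z ->
  eta_quotient nu z = cexp (t%:C * lower_log (eta_quotient mu z)).
Proof.
move=> y0; have [a a0 [h <- [h1 hI]]] := disc_chart_surj y0.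
pose c (u : R) := disc_chart a (u%:C * h).
have c1 : disc_chart a h = c 1 by rewrite /c mul1r.
pose d (s : R) := - (a ^+ 2)%:C * (2 * h * (1 + s%:C * h)).
have cd s u : normc (c (s + u) - c s - u%:C * d s) <= (a ^+ 2 * normc h ^+ 2) * u ^+ 2.
  have -> : c (s + u) - c s - u%:C * d s = - (a ^+ 2)%:C * h ^+ 2 * u%:C ^+ 2.
    by rewrite /c /d /disc_chart rmorphD; ring.
  rewrite (normcM _ (u%:C ^+ 2)) (normcX u%:C) (normcM _ (h ^+ 2)) (normcX h) normcN.
  by rewrite !normc_real real_normK ?num_real// ger0_norm ?sqr_ge0.
have un s : 0 <= s <= 1 -> normc (s%:C * h) < 1.
  move=> /andP[s0 s1]; rewrite normcM normc_real ger0_norm//.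
  by rewrite (le_lt_trans _ h1)// ler_piMl// normc_ge0.
have cI s : 0 < s <= 1 -> 0 < Im (c s).
  move=> /andP[s0 s1]; have -> : Im (c s) = a ^+ 2 * (2 * ((1 + s * Re h) * (s * - Im h))).
    rewrite /c /disc_chart expr2 !(ReM, ImM, ReN, ImN, ReD, ImD) /=; ring.
  rewrite !mulr_gt0 ?exprn_gt0 ?oppr_gt0// -ltrBlDl sub0r.
  have : `|s * Re h| < 1.
    rewrite normrM ger0_norm ?(ltW s0)// (le_lt_trans _ h1)//.
    by rewrite (le_trans _ (norm_Re_le _))// ler_piMl.
  by rewrite ltr_norml => /andP[].
have c0 : c 0 = (- a ^+ 2)%:C.
  by rewrite /c /disc_chart mul0r addr0 expr1n mulr1 rmorphN.
have a2 : - a ^+ 2 < 0 by rewrite oppr_lt0 exprn_gt0.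
have oz s : 0 <= s <= 1 -> offcut (c s).
  move=> /andP[]; rewrite le_eqVlt => /predU1P[<- _|s0 s1].
    by rewrite c0 /offcut /= a2 orbT.
  by rewrite /offcut gt_eqF// cI// s0 s1.
pose A u := eta_quotient nu (c u); pose B u := eta_quotient mu (c u).
pose dA s := d s * (1 - g2 nu (c s) * (g1 nu (c s))^-1 ^+ 2).
pose dB s := d s * (1 - g2 mu (c s) * (g1 mu (c s))^-1 ^+ 2).
have cA s : 0 <= s <= 1 -> curve_derive A s (dA s).
  by move=> s01; exact: (curve_derive_eta_quotient nu_nonneg (oz _ s01) (cd s)).
have cB s : 0 <= s <= 1 -> curve_derive B s (dB s).
  by move=> s01; exact: (curve_derive_eta_quotient mu_nonneg (oz _ s01) (cd s)).
have BI s : 0 < s <= 1 -> Im (B s) < 0.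
  by move=> s01; apply: Im_eta_quotient_lt0 => //; exact: cI.
have ode s : 0 <= s <= 1 -> dA s * B s = t%:C * A s * dB s.
  move=> s01; have := wronskian_disc (wronskian_neg mu_nonneg nu_nonneg mu_nd t_gt0 power_neg) a0 (un _ s01).
  rewrite -/(c s) wronskianE//; last exact: oz.
  move/eqP; rewrite mulf_eq0 (negbTE (mulf_neq0 _ _)) ?expf_neq0 ?resolvent_moment_neq0 ?oz//=.
  rewrite subr_eq0 => /eqP E.
  by rewrite /dA /dB -mulrA [X in d s * X]E mulrCA.
pose M u := A u * cexp (- (t%:C * lower_log (B u))).
have dM s : 0 < s <= 1 -> curve_derive M s 0.
  move=> s01; have s01' : 0 <= s <= 1 by case/andP: s01 => /ltW -> ->.
  have L := curve_derive_lower_log (BI _ s01) (cB _ s01').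
  have T := curve_derive_cexp (curve_deriveN (curve_deriveM (curve_derive_cst t%:C s) L)).
  apply: curve_derive_eq (curve_deriveM (cA _ s01') T) _.
  have B0 : B s != 0 by apply: contraTneq (BI _ s01) => ->; rewrite ltxx.
  rewrite mul0r add0r; set ex := cexp _.
  have -> : dA s = t%:C * A s * dB s / B s by rewrite -ode// mulfK.
  ring.
have [b bE /(_ mu_nd) b0] := eta_quotient_neg mu_nonneg a2.
have B0E : B 0 = b%:C by rewrite /B c0.
have A0E : A 0 = (b `^ t)%:C by rewrite /A c0 power_neg// bE.
have z01 : (0 : R) <= 0 <= (1 : R) by rewrite lexx /= ler01.
have [A1 A2] := curve_derive_cvg (cA _ z01).
have [B1 B2] := curve_derive_cvg (cB _ z01).
rewrite A0E /= in A1 A2; rewrite B0E /= in B1 B2.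
have right (f : R -> R) (l : R) : f u @[u --> 0] --> l -> f u @[u --> 0^'+] --> l.
  by move=> fl; exact: cvg_at_right_filter.
move: A1 A2 B1 B2 => /right A1 /right A2 /right B1 /right B2.
have bn0 : b%:C != 0 by rewrite eq_complex /= eqxx andbT gt_eqF.
have llb : lower_log b%:C = (ln b)%:C.
  rewrite /lower_log normc_real gtr0_norm//= divff ?gt_eqF// acos1 oppr0.
  by [].
have [L1 L2] := cvg_lower_log bn0 B1 B2.
have t1 : Re t%:C @[_ --> (0 : R)^'+] --> Re t%:C by exact: cvg_cst.
have t2 : Im t%:C @[_ --> (0 : R)^'+] --> Im t%:C by exact: cvg_cst.
have [T1 T2] := cvg_cmul t1 t2 L1 L2.
have [||E1 E2] := @cvg_cexp R R (0 : R)^'+ _ (fun u => - (t%:C * lower_log (B u))) (- (t%:C * lower_log b%:C)).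
- by rewrite ReN; under eq_fun do rewrite ReN; exact: cvgN.
- by rewrite ImN; under eq_fun do rewrite ImN; exact: cvgN.
have [M1 M2] := cvg_cmul (l := (b `^ t)%:C) A1 A2 E1 E2.
have M0 : (b `^ t)%:C * cexp (- (t%:C * lower_log b%:C)) = 1.
  rewrite llb -rmorphM -rmorphN /cexp /= cos0 sin0 mulr0 mulr1 -rmorphM /=.
  by rewrite expRN /powR gt_eqF// divff// gt_eqF// expR_gt0.
rewrite M0 in M1 M2.
have limE (f : R -> R) l : (forall u, 0 < u <= 1 -> f u = f 1) ->
    f u @[u --> 0^'+] --> l -> f 1 = l.
  move=> fc fl; apply: (cvg_unique _ _ fl) => //.
  apply: cvg_near_cst; near=> u; apply: fc.
  by apply/andP; split; near: u; [exact: nbhs_right_gt|exact: nbhs_right_le].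
have Mc : M 1 = 1.
  apply: complex_ext.
  - apply: limE M1; apply: is_derive0_cst_oc => // u u01.
    by have [] := dM _ u01.
  - apply: limE M2; apply: is_derive0_cst_oc => // u u01.
    by have [] := dM _ u01.
rewrite c1 -/(A 1) -/(B 1).
have := cexpD (t%:C * lower_log (B 1)) (- (t%:C * lower_log (B 1))).
rewrite subrr cexp0 => /esym EE.
apply: (mulIf (cexp_neq0 (- (t%:C * lower_log (B 1))))).
by rewrite EE -Mc.
Unshelve. all: by end_near.
Qed.

End continuation.

(** * Boundary values near 1 *)

Section boundary.
Context {R : realType}.
Implicit Types (mu nu : probability R R) (z w : R[i]) (x t : R).
Let mD0 := @measurable_halfline R.
Local Notation D0 := (@halfline R).

Lemma cvg_ReIm (T : Type) (F : set_system T) {FF : Filter F} (h : T -> R[i]^o) (l : R[i]^o) :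
  h x @[x --> F] --> l ->
  Re (h x : R[i]) @[x --> F] --> Re (l : R[i]) /\
  Im (h x : R[i]) @[x --> F] --> Im (l : R[i]).
Proof.
move=> hl.
have H (e : R) : 0 < e -> \forall x \near F, normc ((l : R[i]) - h x) < e.
  move=> e0; have /cvgrPdist_lt /(_ e%:C) := hl; rewrite ltcR => /(_ e0).
  by apply: filterS => x; rewrite (_ : `|_| = (normc ((l : R[i]) - h x))%:C)// ltcR.
split; apply/cvgrPdist_lt => e /H; apply: filterS => x; apply: le_lt_trans.
  by rewrite -ReN -ReD norm_Re_le.
by rewrite -ImN -ImD norm_Im_le.
Qed.

Lemma cvg_ImV (T : Type) (F : set_system T) {FF : Filter F} (f : T -> R[i]) (l : R[i]) :
  l != 0 -> Re (f x) @[x --> F] --> Re l -> Im (f x) @[x --> F] --> Im l ->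
  Im (f x)^-1 @[x --> F] --> Im l^-1.
Proof.
move=> l0 f1 f2; rewrite ImV; under eq_fun do rewrite ImV.
apply: cvgN; apply: cvgM => //; apply: cvgV.
  by rewrite sqrf_eq0 gt_eqF// normc_gt0.
have N : normc (f x) @[x --> F] --> normc l by exact: cvg_normc.
by rewrite expr2; under eq_fun do rewrite expr2; exact: cvgM.
Qed.

Lemma F_transformE mu z : on_nonneg mu ->
  F_transform mu z = (resolvent_moment mu 1 z)^-1.
Proof. by move=> h; rewrite /F_transform G_transformE. Qed.

Lemma eta_quotientE mu z : on_nonneg mu -> eta_quotient mu z = z - F_transform mu z.
Proof. by move=> h; rewrite F_transformE. Qed.

Lemma mboolean_power_neg mu nu t : on_nonneg mu -> is_mboolean_power mu t nu ->
  forall s, s < 0 -> eta_quotient nu s%:C = ((Re (eta_quotient mu s%:C)) `^ t)%:C.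
Proof.
move=> h [hn H] s s0.
have E m : on_nonneg m -> eta_transform m (s^-1)%:C / (s^-1)%:C = eta_quotient m s%:C.
  move=> hm; rewrite fmorphV /eta_transform invrK eta_quotientE//.
  rewrite mulrBl mul1r mulrAC mulVf ?mul1r//.
  by rewrite eq_complex /= eqxx andbT lt_eqF.
by rewrite -!E// H// invr_lt0.
Qed.

Lemma dirac_resolvent mu (c : R) z : {ae mu, forall x, x = c} -> on_nonneg mu ->
  offcut z -> resolvent_moment mu 1 z = (z - c%:C)^-1.
Proof.
move=> mc h oz; have [i1 i2] := integrable_resolvent mu 1 oz.
have H (f : R -> R) : mu.-integrable D0 (EFin \o f) ->
    \int[mu]_(x in D0) f x = f c.
  move=> fi; rewrite -[RHS]mulr1 -(fine_mu_halfline h) -Rintegral_cst//.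
  rewrite /Rintegral; congr fine; apply: ae_eq_integral => //.
  - exact: measurable_int fi.
  - by apply: filterS mc => x -> _.
apply: complex_ext => /=.
  by rewrite (H (fun x => Re ((z - x%:C)^-1 ^+ 1)))// expr1.
by rewrite (H (fun x => Im ((z - x%:C)^-1 ^+ 1)))// expr1.
Qed.

(** For the Dirac mass at c >= 0 one has F(1 + i 0) = 1 - c, a real number at most 1. *)
Lemma nondegenerate_of_boundary mu : on_nonneg mu ->
  cvg (F_vertical mu 1 y @[y --> 0^'+]) ->
  0 < complex.Im (F_boundary mu 1) \/
    complex.Im (F_boundary mu 1) = 0 /\ 1 < complex.Re (F_boundary mu 1) ->
  nondegenerate mu.
Proof.
move=> h Fc F1 c mc.
have c0 : 0 <= c.
  have mu0 : (0 < mu [set: R])%E by rewrite probability_setT lte01.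
  have PF := ae_properfilter_algebraOfSetsType mu0.
  have [x [-> ]] := @filter_ex _ _ PF _ (filterI mc (on_nonneg_ae h)).
  by rewrite /halfline /= in_itv /= andbT.
have [C1 C2] := cvg_ReIm Fc.
have E : \forall y \near (0 : R)^'+, (F_vertical mu 1 y : R[i]) = (1 - c) +i* y.
  near=> y; have y0 : 0 < y by near: y; exact: nbhs_right_gt.
  rewrite /F_vertical F_transformE// (dirac_resolvent mc)//; last first.
    by rewrite /offcut /= gt_eqF.
  by rewrite invrK; apply: complex_ext; rewrite ?ReD ?ImD ?ReN ?ImN //= subr0.
have R1 : Re (F_boundary mu 1) = 1 - c.
  apply: (cvg_unique _ C1) => //; apply: cvg_near_cst.
  by apply: filterS E => y ->.
have I1 : Im (F_boundary mu 1) = 0.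
  apply: (cvg_unique _ C2) => //; apply: (@cvg_trans _ (y @[y --> 0^'+])).
    by apply: near_eq_cvg; apply: filterS E => y ->.
  exact: cvg_at_right_filter cvg_id.
case: F1 => [|[_]]; first by rewrite I1 ltxx.
by rewrite R1 ltNge gerBl c0.
Unshelve. all: by end_near.
Qed.

Lemma log_one_minus_i0E w : 0 < Im w \/ Im w = 0 /\ 1 < Re w ->
  log_one_minus_i0 w = lower_log (1 - w).
Proof.
rewrite /log_one_minus_i0; case=> [w0|[w0 w1]].
  rewrite w0 /clog /lower_log /carg leNgt.
  by rewrite (_ : Im (1 - w) < 0)// ImD ImN /= sub0r oppr_lt0.
rewrite w0 ltxx /lower_log.
have -> : 1 - w = (1 - Re w)%:C.
  by apply: complex_ext; rewrite ?ReD ?ReN ?ImD ?ImN /= ?w0 ?subr0.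
have r0 : 1 - Re w < 0 by rewrite subr_lt0.
rewrite normc_real ltr0_norm// opprB /=.
have -> : (1 - Re w) / (Re w - 1) = -1 by field; rewrite subr_eq0 gt_eqF.
by rewrite acosN1.
Qed.

Definition boundary_eta mu x : R[i] := x%:C - F_boundary mu x.
Definition boundary_log mu x : R[i] := lower_log (boundary_eta mu x).

(** The boundary value of F_nu at x. *)
Definition power_denominator mu t x : R[i] :=
  x%:C - cexp (t%:C * boundary_log mu x).

Definition power_density mu t x : R := - Im ((power_denominator mu t x)^-1) / pi.

Lemma cvg_eta_quotient mu x : on_nonneg mu ->
  cvg (F_vertical mu x y @[y --> 0^'+]) ->
  Re (eta_quotient mu (x +i* y)) @[y --> 0^'+] --> Re (boundary_eta mu x) /\
  Im (eta_quotient mu (x +i* y)) @[y --> 0^'+] --> Im (boundary_eta mu x).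
Proof.
move=> h /cvg_ReIm[C1 C2]; rewrite /boundary_eta ReD ReN ImD ImN; split.
  under eq_fun do rewrite eta_quotientE// ReD ReN.
  by apply: cvgB; [exact: cvg_cst|exact: C1].
under eq_fun do rewrite eta_quotientE// ImD ImN.
by apply: cvgB; [exact: cvg_at_right_filter cvg_id|exact: C2].
Qed.

Lemma ImV_gt0 w : 0 < Im w -> 0 < - Im w^-1.
Proof.
move=> w0; rewrite ImV opprK divr_gt0// exprn_gt0// normc_gt0.
by apply: contraTneq w0 => ->; rewrite ltxx.
Qed.

(** The argument of exp(t log B) lies strictly between -pi and 0 because t < 1 and
    the argument of B is in [-pi, 0[. *)
Lemma Im_power_denominator mu t x : 0 < t -> t < 1 ->
  0 < - Im (boundary_log mu x) -> 0 < Im (power_denominator mu t x).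
Proof.
move=> t0 t1 p0; rewrite /power_denominator ImD ImN /= add0r -mulrN -sinN.
rewrite !mul0r addr0 mulrN opprK mulr_gt0 ?expR_gt0// sin_gt0_pi//.
move: p0; rewrite /boundary_log /= opprK => p0.
rewrite mulr_gt0//= (lt_le_trans _ (acos_lepi (ratio_bounds (boundary_eta mu x))))//.
by rewrite gtr_pMl.
Qed.

(** Since B(x) lies in the closed lower half-plane minus 0, where the logarithm is
    continuous, A(x + i y) converges, and so does G_nu = 1 / (z - A). *)
Lemma cvg_boundary_density mu nu t x : on_nonneg mu -> on_nonneg nu ->
  nondegenerate mu -> 0 < t -> t < 1 -> is_mboolean_power mu t nu ->
  cvg (F_vertical mu x y @[y --> 0^'+]) ->
  boundary_eta mu x != 0 -> 0 < - Im (boundary_log mu x) ->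
  - Im (G_transform nu (x +i* y)) / pi @[y --> 0^'+] --> power_density mu t x.
Proof.
move=> hm hn nd t0 t1 bp Fc w0 p0.
have neg := mboolean_power_neg hm bp.
have P z : 0 < Im z -> eta_quotient nu z = cexp (t%:C * lower_log (eta_quotient mu z)).
  exact: eta_quotient_power hm hn nd t0 neg z.
have [E1 E2] := cvg_eta_quotient hm Fc.
have [L1 L2] := cvg_lower_log w0 E1 E2.
have t1' : Re t%:C @[_ --> (0 : R)^'+] --> Re t%:C by exact: cvg_cst.
have t2' : Im t%:C @[_ --> (0 : R)^'+] --> Im t%:C by exact: cvg_cst.
have [T1 T2] := cvg_cmul t1' t2' L1 L2.
have [C1 C2] := cvg_cexp T1 T2.
pose D y := x +i* y - cexp (t%:C * lower_log (eta_quotient mu (x +i* y))).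
have D1 : Re (D y) @[y --> 0^'+] --> Re (power_denominator mu t x).
  rewrite /power_denominator ReD ReN; under eq_fun do rewrite /D ReD ReN.
  by apply: cvgB => //; exact: cvg_cst.
have D2 : Im (D y) @[y --> 0^'+] --> Im (power_denominator mu t x).
  rewrite /power_denominator ImD ImN; under eq_fun do rewrite /D ImD ImN.
  by apply: cvgB => //; exact: cvg_at_right_filter cvg_id.
have n0 : power_denominator mu t x != 0.
  have := Im_power_denominator t0 t1 p0.
  by apply: contraTneq => ->; rewrite ltxx.
rewrite /power_density.
apply: (@cvg_trans _ (- Im ((D y)^-1) / pi @[y --> 0^'+])).
  apply: near_eq_cvg; near=> y; have y0 : 0 < y by near: y; exact: nbhs_right_gt.
  congr (- Im _ / pi); rewrite /D -P//= eta_quotientE//.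
  by rewrite opprB addrC subrK /F_transform invrK.
apply: cvgM; last exact: cvg_cst.
by apply: cvgN; exact: cvg_ImV.
Unshelve. all: by end_near.
Qed.

End boundary.

(** * Stieltjes inversion with a bounded limit *)

Section poisson_bounds.
Context {R : realType}.
Variable nu : probability R R.
Implicit Types (a b c x r s e C : R).

Local Notation mass A := (fine (nu A)).

Lemma mass_le (A B : set R) : measurable A -> measurable B -> A `<=` B ->
  mass A <= mass B.
Proof.
move=> mA mB AB; apply: fine_le; rewrite ?fin_num_measure//.
by apply: le_measure; rewrite ?inE.
Qed.

Lemma massU_le (A B : set R) : measurable A -> measurable B ->
  mass (A `|` B) <= mass A + mass B.
Proof.
move=> mA mB; rewrite -fineD ?fin_num_measure//.
apply: fine_le; rewrite ?fin_numD ?fin_num_measure//; first exact: measurableU.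
exact: measureU2.
Qed.

(** Supremum argument: the set of x for which the bound holds on [a, x] contains a and
    its supremum s, and the hypothesis at s extends it beyond s.  An interval
    ]x, y] around s lies in the ball of centre s and radius y - x, which is why the
    hypothesis compares the mass of a ball with its radius and not its length. *)
Lemma mass_le_of_upper_density a b C : a <= b -> 0 <= C ->
  (forall x, a <= x <= b -> exists2 d, 0 < d &
    forall r, 0 < r < d -> mass `[x - r, x + r]%classic <= C * r) ->
  mass `[a, b]%classic <= C * (b - a).
Proof.
move=> ab C0 H.
have mI (i : interval R) : measurable [set` i] by exact: measurable_itv.
pose S := [set x | a <= x <= b /\ mass `[a, x]%classic <= C * (x - a)].
have Sa : S a.
  split; first by rewrite lexx.
  rewrite subrr mulr0; have [|d d0 Hd] := H a; first by rewrite lexx.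
  apply/ler_addgt0Pl => e e0; rewrite addr0.
  pose r := Num.min (d / 2) (e / (C + 1)).
  have C1 : 0 < C + 1 by rewrite ltr_wpDl.
  have r0 : 0 < r by rewrite lt_min !divr_gt0.
  have rd : r < d by rewrite gt_min ltr_pdivrMr// ltr_pMr// ltr1n.
  apply: (@le_trans _ _ (mass `[a - r, a + r]%classic)).
    apply: mass_le => // x /=; rewrite !in_itv /= => /andP[x1 x2].
    by rewrite (le_trans _ x1) ?(le_trans x2) ?lerDl ?gerBl// ltW.
  apply: (le_trans (Hd r _)); first by rewrite r0.
  apply: (@le_trans _ _ ((C + 1) * r)); first by rewrite ler_wpM2r ?(ltW r0)// lerDl.
  by rewrite mulrC -ler_pdivlMr// ge_min lexx orbT.
have hS : has_sup S by split; [exists a|exists b => x [/andP[]]].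
set s := sup S.
have as_ : a <= s by apply: ub_le_sup => //; case: hS.
have sb : s <= b by apply: ge_sup; [exists a|move=> x [/andP[]]].
have [|d d0 Hd] := H s; first by rewrite as_.
have step x y : S x -> x <= s -> s <= y -> y - x < d -> y <= b -> S y.
  move=> [/andP[ax xb] Sx] xs sy yx yb.
  have [->|xy] := eqVneq y x; first by split => //; rewrite ax.
  have {}xy : x < y by rewrite lt_neqAle eq_sym xy (le_trans xs).
  split; first by rewrite (le_trans as_).
  apply: (@le_trans _ _ (mass `[a, x]%classic + mass `[s - (y - x), s + (y - x)]%classic)).
    apply: le_trans (massU_le (mI _) (mI _)); apply: mass_le => //; first exact: measurableU.
    move=> u /=; rewrite !in_itv /= => /andP[au uy].
    have [ux|ux] := leP u x; first by left; rewrite au.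
    right; apply/andP; split; lra.
  rewrite (_ : C * (y - a) = C * (x - a) + C * (y - x)); last by ring.
  by rewrite lerD// Hd// subr_gt0 xy.
have d20 : 0 < d / 2 by rewrite divr_gt0.
have [x Sx sx] := sup_adherent d20 hS.
have xs : x <= s by apply: ub_le_sup => //; case: hS.
have yS y : s <= y -> y <= s + d / 4 -> y <= b -> S y.
  by move=> sy yd yb; apply: (step x) => //; rewrite -/s in sx; lra.
have [bs|bs] := leP b (s + d / 4); first by have [] := yS b sb bs (lexx b).
have Sy : S (s + d / 4) by apply: yS; [lra|lra|exact: ltW].
have : s + d / 4 <= s by apply: ub_le_sup => //; case: hS.
lra.
Qed.

(** The factor 1 / pi of the Poisson kernel is left out. *)
Definition poisson_kernel e s := e / (s ^+ 2 + e ^+ 2).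

Definition poisson e x : R := \int[nu]_s poisson_kernel e (x - s).

Lemma poisson_kernel_gt0 e s : 0 < e -> 0 < poisson_kernel e s.
Proof. by move=> e0; rewrite divr_gt0// ltr_wpDl ?sqr_ge0// exprn_gt0. Qed.

Lemma poisson_kernel_le e s : 0 < e -> poisson_kernel e s <= e^-1.
Proof.
move=> e0; rewrite /poisson_kernel ler_pdivrMr; last by rewrite ltr_wpDl ?sqr_ge0// exprn_gt0.
by rewrite mulrDr (expr2 e) mulKf ?gt_eqF// lerDr mulr_ge0 ?invr_ge0 ?(ltW e0)// sqr_ge0.
Qed.

Lemma poisson_kernel_far e s r : 0 < e -> 0 < r -> r <= `|s| ->
  poisson_kernel e s <= e / r ^+ 2.
Proof.
move=> e0 r0 rs; rewrite ler_wpM2l ?(ltW e0)// lef_pV2 ?posrE ?exprn_gt0//; last first.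
  by rewrite ltr_wpDl ?sqr_ge0// exprn_gt0.
rewrite (@le_trans _ _ (s ^+ 2))// ?lerDl ?sqr_ge0//.
by rewrite -[leRHS]real_normK ?num_real// lerXn2r// nnegrE ltW.
Qed.

Lemma poisson_kernel_near e s : 0 < e -> `|s| <= e -> (2 * e)^-1 <= poisson_kernel e s.
Proof.
move=> e0 se; have s2 : s ^+ 2 <= e ^+ 2.
  by rewrite -[leLHS]real_normK ?num_real// lerXn2r// nnegrE ltW.
rewrite /poisson_kernel ler_pdivlMr; last by rewrite ltr_wpDl ?sqr_ge0// exprn_gt0.
rewrite mulrC ler_pdivrMr ?mulr_gt0// [leRHS](_ : _ = e ^+ 2 + e ^+ 2); last by ring.
by rewrite lerD2r.
Qed.

Lemma measurable_poisson_kernel d (T : measurableType d) (D : set T) e (f : T -> R) :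
  measurable_fun D f -> measurable_fun D (fun u => poisson_kernel e (f u)).
Proof.
move=> mf; apply: measurable_funM; first exact: measurable_cst.
apply: measurable_fun_inv_ge0 => [x|]; first by rewrite addr_ge0 ?sqr_ge0.
apply: measurable_funD; first exact: measurable_funX.
exact: measurable_cst.
Qed.

Lemma measurable_poisson_shift e x : measurable_fun setT (fun s => poisson_kernel e (x - s)).
Proof.
apply: measurable_poisson_kernel; apply: measurable_funB; first exact: measurable_cst.
exact: measurable_id.
Qed.

Lemma integrable_bounded_setT (f : R -> R) M : measurable_fun setT f ->
  (forall s, `|f s| <= M) -> nu.-integrable setT (EFin \o f).
Proof.
by move=> mf fM; apply: (@bounded_integrable _ _ _ setT measurableT nu f M) => // s _.
Qed.

Lemma integrable_poisson e x : 0 < e ->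
  nu.-integrable setT (EFin \o (fun s => poisson_kernel e (x - s))).
Proof.
move=> e0; apply: (integrable_bounded_setT (M := e^-1)).
  exact: measurable_poisson_shift.
by move=> s; rewrite gtr0_norm ?poisson_kernel_gt0// poisson_kernel_le.
Qed.

Lemma Rintegral_scaled_indic c (B : set R) : measurable B ->
  \int[nu]_s (c * \1_B s) = c * mass B.
Proof.
move=> mB; rewrite RintegralZl//.
  by rewrite /Rintegral integral_indic// setIT.
apply: (integrable_bounded_setT (M := 1)) => //.
by move=> s; rewrite indicE; case: (_ \in _); rewrite ?normr1 ?normr0.
Qed.

Lemma integrable_scaled_indic c (B : set R) : measurable B ->
  nu.-integrable setT (EFin \o (fun s => c * \1_B s)).
Proof.
move=> mB; apply: (integrable_bounded_setT (M := `|c|)).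
  apply: measurable_funM; first exact: measurable_cst.
  exact: measurable_indic.
by move=> s; rewrite normrM ler_piMr// indicE; case: (_ \in _); rewrite ?normr1 ?normr0.
Qed.

Lemma mass_ball_le_poisson e x : 0 < e ->
  mass `[x - e, x + e]%classic <= 2 * e * poisson e x.
Proof.
move=> e0; rewrite -ler_pdivrMl ?mulr_gt0// -Rintegral_scaled_indic//.
apply: le_Rintegral => //.
- by apply: integrable_scaled_indic; exact: measurable_itv.
- exact: integrable_poisson.
move=> s _; rewrite indicE; have [|_] := boolP (_ \in _).
  rewrite inE /= in_itv /= => /andP[s1 s2]; rewrite mulr1 poisson_kernel_near//.
  by rewrite ler_norml; apply/andP; split; lra.
by rewrite mulr0 ltW// poisson_kernel_gt0.
Qed.

(** The kernel is at most 1/e on the ball of radius e and at most 1 / (4^n e) on the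
    shell between the radii 2^n e and 2^(n+1) e, so the shells contribute a geometric
    series.  Beyond radius d / 2 the kernel is at most 4 / d. *)
Lemma poisson_le x e d C : 0 < e -> e <= d -> 0 <= C ->
  (forall r, 0 < r <= d -> mass `[x - r, x + r]%classic <= C * r) ->
  poisson e x <= 5 * C + 4 / d.
Proof.
move=> e0 ed C0 H; have d0 : 0 < d by exact: lt_le_trans ed.
pose B n := `[x - 2 ^+ n * e, x + 2 ^+ n * e]%classic.
have mB n : measurable (B n) by exact: measurable_itv.
have BE n s : (s \in B n) = (`|x - s| <= 2 ^+ n * e).
  rewrite ler_norml; apply/idP/idP.
    by rewrite inE /B /= in_itv /= => /andP[? ?]; apply/andP; split; lra.
  by move=> /andP[? ?]; rewrite inE /B /= in_itv /=; apply/andP; split; lra.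
pose K s := poisson_kernel e (x - s).
have mK : measurable_fun setT K by exact: measurable_poisson_shift.
have iKB n : nu.-integrable setT (EFin \o (fun s => K s * \1_(B n) s)).
  apply: (integrable_bounded_setT (M := e^-1)).
    by apply: measurable_funM => //; exact: measurable_indic.
  move=> s; rewrite normrM -[leRHS]mulr1 ler_pM//.
    by rewrite gtr0_norm ?poisson_kernel_gt0// poisson_kernel_le.
  by rewrite indicE; case: (_ \in _); rewrite ?normr1 ?normr0.
have pos n : 0 < 2 ^+ n * e :> R by rewrite mulr_gt0// exprn_gt0.
have I n : 2 ^+ n * e <= d -> \int[nu]_s (K s * \1_(B n) s) <= 5 * C - 4 * C / 2 ^+ n.
  elim: n => [|n IH] hn.
    apply: (@le_trans _ _ (\int[nu]_s (e^-1 * \1_(B 0%N) s))).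
      apply: le_Rintegral => //; first exact: integrable_scaled_indic.
      move=> s _; rewrite ler_wpM2r//; last exact: poisson_kernel_le.
    rewrite Rintegral_scaled_indic// ler_pdivrMl//.
    have := H (2 ^+ 0 * e); rewrite pos hn => /(_ isT) h.
    by apply: (le_trans h); rewrite expr0; lra.
  have hn' : 2 ^+ n * e <= d by apply: le_trans hn; rewrite exprS -mulrA ler_peMl ?(ltW (pos _))// ler1n.
  have {}IH := IH hn'.
  apply: (@le_trans _ _ (\int[nu]_s (K s * \1_(B n) s + e / (2 ^+ n * e) ^+ 2 * \1_(B n.+1) s))).
    apply: le_Rintegral => //.
      have := @integrableD _ _ _ nu setT measurableT _ _ (iKB n)
        (integrable_scaled_indic (e / (2 ^+ n * e) ^+ 2) (mB n.+1)).
      exact.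
    move=> s _; rewrite !indicE; have [h|h] := boolP (s \in B n).
      rewrite mulr1 (_ : s \in B n.+1) ?mulr1 ?lerDl ?divr_ge0 ?sqr_ge0 ?(ltW e0)//.
      move: h; rewrite !BE => h; apply: (le_trans h).
      by rewrite exprS -mulrA ler_peMl ?(ltW (pos _))// ler1n.
    rewrite mulr0 add0r ler_wpM2r//; apply: poisson_kernel_far => //.
    by move: h; rewrite BE -ltNge => /ltW.
  rewrite RintegralD//; last exact: integrable_scaled_indic.
  rewrite Rintegral_scaled_indic//.
  apply: (@le_trans _ _ (5 * C - 4 * C / 2 ^+ n + e / (2 ^+ n * e) ^+ 2 * (C * (2 ^+ n.+1 * e)))).
    rewrite lerD// ler_wpM2l ?divr_ge0 ?sqr_ge0 ?(ltW e0)// H// pos.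
    by [].
  rewrite le_eqVlt; apply/orP; left; apply/eqP; rewrite !(exprS 2 n).
  have : 2 ^+ n != 0 :> R by rewrite expf_neq0.
  move: (2 ^+ n : R) => q q0; field.
  by rewrite q0 gt_eqF.
have [n nd dn] : exists2 n, 2 ^+ n * e <= d & d < 2 ^+ n.+1 * e.
  have ex : exists n, d < 2 ^+ n.+1 * e.
    exists (Num.truncn (d / e)); rewrite -ltr_pdivrMr//.
    apply: (lt_le_trans (truncnS_gt _)); rewrite -natrX ler_nat.
    exact: ltnW (ltn_expl _ _).
  exists (ex_minn ex); case: ex_minnP => [[|n] hn min] //.
    by rewrite expr0 mul1r.
  rewrite leNgt; apply/negP => h; have := min _ h.
  by rewrite ltnn.
have ic : nu.-integrable setT (EFin \o (fun=> 4 / d)).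
  apply: (integrable_bounded_setT (M := 4 / d)); first exact: measurable_cst.
  by move=> s; rewrite ger0_norm// divr_ge0// ltW.
apply: (@le_trans _ _ (\int[nu]_s (K s * \1_(B n) s + 4 / d))).
  apply: le_Rintegral => //.
  - exact: integrable_poisson.
  - exact: (@integrableD _ _ _ nu setT measurableT _ _ (iKB n) ic).
  move=> s _; rewrite indicE; have [h|h] := boolP (s \in B n).
    by rewrite mulr1 lerDl divr_ge0// ltW.
  rewrite mulr0 add0r.
  apply: (@le_trans _ _ (e / (d / 2) ^+ 2)).
    apply: poisson_kernel_far; rewrite ?divr_gt0//.
    move: h; rewrite BE -ltNge => /ltW; apply: le_trans.
    by rewrite ler_pdivrMr// mulrC mulrA -exprS ltW.
  rewrite exprMn invfM exprVn invrK.
  rewrite (_ : e * _ = (e / d) * (4 / d)); last by field; rewrite gt_eqF.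
  by rewrite ler_piMl ?divr_ge0 ?(ltW d0)// ler_pdivrMr// mul1r.
rewrite RintegralD//.
rewrite lerD//; last first.
  by rewrite Rintegral_cst// [X in fine X](probability_setT nu) mulr1.
by apply: (le_trans (I _ nd)); rewrite gerBl divr_ge0 ?mulr_ge0// exprn_ge0.
Qed.

Lemma is_derive_atan_shift e s (m : R -> R) (y dy : R) : 0 < e ->
  is_derive y 1 m dy ->
  is_derive y 1 (fun u => atan ((m u - s) / e)) (dy * poisson_kernel e (m y - s)).
Proof.
move=> e0 my; have A : is_derive y 1 (fun u => (m u - s) / e) (dy / e).
  have := is_derive_mulf (is_derive_addf my (is_derive_cst (- s) y 1)) (is_derive_cst e^-1 y 1).
  by move/is_derive_congr; apply; rewrite addr0 /cst mulr0 addr0.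
apply: (is_derive_congr (@is_derive1_comp _ (@atan R) _ y _ _ (is_derive1_atan _) A)).
rewrite /poisson_kernel; field.
have h : (m y - s) ^+ 2 + e ^+ 2 != 0 by rewrite gt_eqF// ltr_wpDl ?sqr_ge0// exprn_gt0.
by rewrite h gt_eqF.
Qed.

Lemma continuous_poisson_kernel e s : 0 < e ->
  continuous (fun u => poisson_kernel e (u - s)).
Proof.
move=> e0 x; apply: cvgM; first exact: cvg_cst.
apply: cvgV; first by rewrite gt_eqF// ltr_wpDl ?sqr_ge0// exprn_gt0.
apply: cvgD; last exact: cvg_cst.
have C : u - s @[u --> x] --> x - s by apply: cvgB; [exact: cvg_id|exact: cvg_cst].
by rewrite expr2; under eq_fun do rewrite expr2; exact: cvgM.
Qed.

Lemma integral_is_derive (f F : R -> R) a b : a < b ->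
  (forall y, a <= y <= b -> is_derive y 1 F (f y)) ->
  (forall y, a <= y <= b -> {for y, continuous f}) ->
  (\int[@lebesgue_measure R]_(y in `[a, b]) (f y)%:E = (F b - F a)%:E)%E.
Proof.
move=> ab dF cf.
have cF y : a <= y <= b -> {for y, continuous F}.
  by move=> /dF[dy _]; apply: differentiable_continuous; exact/derivable1_diffP.
rewrite EFinB; apply: (@continuous_FTC2 _ f F a b ab).
- by apply: continuous_in_subspaceT => y /set_mem /=; rewrite in_itv /= => /cf.
- split.
  + move=> y; rewrite in_itv /= => /andP[y1 y2].
    by have [] := dF y; rewrite ?(ltW y1) ?(ltW y2).
  + by apply: cvg_at_right_filter; apply: cF; rewrite lexx ltW.
  + by apply: cvg_at_left_filter; apply: cF; rewrite lexx ltW.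
- move=> y; rewrite in_itv /= => /andP[y1 y2]; rewrite derive1E.
  by have [] := dF y; rewrite ?(ltW y1) ?(ltW y2).
Qed.

Section change_of_variables.
Variables (m dm : R -> R) (al be : R).
Hypotheses (albe : al < be) (mm : measurable_fun setT m) (mdm : measurable_fun setT dm).
Hypothesis dm_ge0 : forall y, al <= y <= be -> 0 <= dm y.
Hypothesis der_m : forall y, al <= y <= be -> is_derive y 1 m (dm y).
Hypothesis cont_dm : forall y, al <= y <= be -> {for y, continuous dm}.
Local Notation D := `[al, be]%classic.
Local Notation lebesgue := (@lebesgue_measure R).

Let cont_m y : al <= y <= be -> {for y, continuous m}.
Proof.
by move=> /der_m[dy _]; apply: differentiable_continuous; exact/derivable1_diffP.
Qed.

Let kernel e (p : R * R) := ((dm \_ D) p.1 * poisson_kernel e (m p.1 - p.2))%:E.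

Let kernel_ge0 e p : 0 < e -> (0 <= kernel e p)%E.
Proof.
move=> e0; rewrite lee_fin mulr_ge0 ?(ltW (poisson_kernel_gt0 _ _))//.
by rewrite patchE; case: ifPn => // /set_mem /=; rewrite in_itv /= => /dm_ge0.
Qed.

Let measurable_kernel e : measurable_fun setT (kernel e).
Proof.
apply/measurable_EFinP; apply: measurable_funM.
  apply: (@measurableT_comp _ _ _ _ _ _ (dm \_ D)) => //.
  by apply/measurable_restrict => //; exact: measurable_funTS.
apply: measurable_poisson_kernel; apply: measurable_funB.
  exact: (@measurableT_comp _ _ _ _ _ _ m).
exact: measurable_snd.
Qed.

Let kernel_F e y : 0 < e -> fubini_F nu (kernel e) y = ((fun y => dm y * poisson e (m y)) \_ D y)%:E.
Proof.
move=> e0; rewrite /fubini_F /kernel /= !patchE; case: ifPn => yD; last first.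
  by under eq_integral do rewrite mul0r; rewrite integral0.
under eq_integral do rewrite EFinM.
rewrite integralZl//; last exact: integrable_poisson.
rewrite EFinM /poisson /Rintegral fineK//.
by apply: integrable_fin_num => //; exact: integrable_poisson.
Qed.

Let kernel_G e s : 0 < e ->
  fubini_G lebesgue (kernel e) s = (atan ((m be - s) / e) - atan ((m al - s) / e))%:E.
Proof.
move=> e0; pose F y := atan ((m y - s) / e).
pose f y := dm y * poisson_kernel e (m y - s).
have <- : (\int[lebesgue]_(y in D) (f y)%:E = (F be - F al)%:E)%E.
  apply: integral_is_derive => // y yD.
    by apply: is_derive_atan_shift => //; exact: der_m.
  apply: cvgM; first exact: cont_dm.
  apply: (cvg_comp m (fun u => poisson_kernel e (u - s)) (cont_m yD)).
  exact: (continuous_poisson_kernel e0).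
rewrite /fubini_G [RHS]integral_mkcond; apply: eq_integral => y _.
by rewrite /kernel /= !patchE; case: ifPn => // _; rewrite mul0r.
Qed.

(** Tonelli: for fixed s the inner integral of m'(y) e / ((m(y) - s)^2 + e^2) is an
    increment of atan((m(y) - s) / e). *)
Lemma integral_poisson_pullback e : 0 < e ->
  (\int[lebesgue]_(y in D) (dm y * poisson e (m y))%:E =
   \int[nu]_s (atan ((m be - s) / e) - atan ((m al - s) / e))%:E)%E.
Proof.
move=> e0; rewrite integral_mkcond.
transitivity (\int[lebesgue]_y fubini_F nu (kernel e) y)%E.
  by apply: eq_integral => y _; rewrite kernel_F// !patchE; case: ifPn.
transitivity (\int[nu]_s fubini_G lebesgue (kernel e) s)%E; last first.
  by apply: eq_integral => s _; rewrite kernel_G.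
apply: (@fubini_tonelli _ _ _ _ _ lebesgue nu (kernel e)); first exact: measurable_kernel.
by move=> p; exact: kernel_ge0.
Qed.

Lemma measurable_poisson_pullback e : 0 < e ->
  measurable_fun D (fun y => dm y * poisson e (m y)).
Proof.
move=> e0.
have := @measurable_fun_fubini_tonelli_F _ _ _ _ _ nu (kernel e)
  (measurable_kernel e) (fun p => kernel_ge0 p e0).
move=> /(measurable_funTS (D := D)) H; apply/measurable_EFinP.
apply: eq_measurable_fun H => y yD; rewrite kernel_F// patchE yD.
by [].
Qed.

Variables (P : R -> R) (a b M : R).
Hypotheses (a_lt : a < m al) (lt_b : m be < b) (M0 : 0 <= M).
Hypothesis m_range : forall y, al <= y <= be -> m al <= m y <= m be.
Hypothesis P_lim : forall x, a < x < b -> poisson e x @[e --> 0^'+] --> P x.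
Hypothesis P_le : forall x, a < x < b -> P x <= M.

Let K0 := 4 * (M + 1).
Let d0 := Num.min (m al - a) (b - m be) / 2.

Let d0_gt0 : 0 < d0.
Proof. by rewrite divr_gt0// lt_min !subr_gt0 a_lt. Qed.

Let mass_ball x r : m al <= x <= m be -> 0 < r <= d0 ->
  mass `[x - r, x + r]%classic <= K0 * r.
Proof.
move=> /andP[x1 x2] /andP[r0 rd].
have d1 : d0 <= (m al - a) / 2 by rewrite ler_pM2r ?invr_gt0// ge_min lexx.
have d2 : d0 <= (b - m be) / 2 by rewrite ler_pM2r ?invr_gt0// ge_min lexx orbT.
have M1 : 0 <= 2 * (M + 1) by rewrite mulr_ge0// addr_ge0.
have -> : K0 * r = 2 * (M + 1) * ((x + r) - (x - r)) by rewrite /K0; ring.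
have a1 : a < m al := a_lt; have b1 : m be < b := lt_b.
apply: mass_le_of_upper_density => // [|z /andP[z1 z2]]; first by lra.
have az : a < z < b by apply/andP; split; lra.
have /cvgrPdist_lt /(_ _ ltr01) H := P_lim az.
have [d /= dpos Hd] : \forall e \near (0 : R)^'+, poisson e z < M + 1.
  near=> e; have : `|P z - poisson e z| < 1 by near: e; exact: H.
  by rewrite ltr_distl => /andP[h _]; have := P_le az; lra.
exists d => // e /andP[e0 ed].
apply: (le_trans (mass_ball_le_poisson _ e0)).
rewrite mulrAC ler_wpM2r ?(ltW e0)// ler_wpM2l// ltW// Hd//=.
by rewrite sub0r normrN gtr0_norm.
Unshelve. all: by end_near.
Qed.

Let point_null x : m al <= x <= m be -> nu [set x] = 0%E.
Proof.
move=> xm; have K0_ge0 : 0 <= K0 by rewrite mulr_ge0// addr_ge0.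
suff h : mass [set x] = 0 by rewrite -[LHS]fineK ?fin_num_measure// h.
apply/eqP; rewrite eq_le fine_ge0 ?andbT//.
apply/ler_addgt0Pl => e e0; rewrite addr0.
have K1 : 0 < K0 + 1 by rewrite ltr_wpDl.
pose r := Num.min d0 (e / (K0 + 1)).
have r0 : 0 < r by rewrite lt_min d0_gt0 divr_gt0.
apply: (@le_trans _ _ (mass `[x - r, x + r]%classic)).
  apply: mass_le => // _ -> /=; rewrite in_itv /= lerDl gerBl (ltW r0).
  by [].
apply: (le_trans (mass_ball xm _)); first by rewrite r0 ge_min lexx.
apply: (@le_trans _ _ ((K0 + 1) * r)); first by rewrite ler_wpM2r ?(ltW r0)// lerDl.
by rewrite mulrC -ler_pdivlMr// ge_min lexx orbT.
Qed.

Let mesh n : R := d0 / n.+1%:R.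

Let mesh_gt0 n : 0 < mesh n.
Proof. by rewrite divr_gt0. Qed.

Let mesh_le n : mesh n <= d0.
Proof. by rewrite /mesh ler_pdivrMr// ler_peMr ?(ltW d0_gt0)// ler1n. Qed.

Let mesh_cvg : mesh n @[n --> \oo] --> (0 : R).
Proof. by rewrite -[X in _ --> X](mulr0 d0); apply: cvgM; [exact: cvg_cst|exact: cvg_harmonic]. Qed.

Let theta (v : R) : R := if 0 < v then pi / 2 else if v < 0 then - (pi / 2) else 0.

Let atan_lim (v : R) : atan (v / mesh n) @[n --> \oo] --> theta v.
Proof.
have pos (w : R) : 0 < w -> atan (w / mesh n) @[n --> \oo] --> pi / 2.
  move=> w0; have W : w / mesh n @[n --> \oo] --> +oo%R.
    apply/cvgryPge => A; exists (Num.truncn (A * d0 / w)) => // n /= hn.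
    have d00 := d0_gt0; rewrite ler_pdivlMr// /mesh; have h : A * d0 / w < n.+1%:R.
      by apply: (lt_le_trans (truncnS_gt _)); rewrite ler_nat ltnS.
    rewrite mulrA ler_pdivrMr// -ler_pdivrMl// mulrC; exact: ltW.
  exact: (cvg_comp _ (@atan R) W (@cvgy_atan R)).
rewrite /theta; have [v0|v0|<-] := ltgtP 0 v; first exact: pos.
  have /cvgN := pos (- v) ltac:(by rewrite oppr_gt0).
  by apply: cvg_trans; apply: near_eq_cvg; near=> n; rewrite fctE mulNr atanN opprK.
by under eq_fun do rewrite mul0r atan0; exact: cvg_cst.
Unshelve. all: by end_near.
Qed.

(** If the Poisson integrals have a limit P bounded by M on ]a, b[, the mass of small
    balls is at most a constant times the radius.  This bounds the Poisson integrals
    uniformly, so that the limit e -> 0 may be taken on the left of the preceding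
    formula; on the right the increments of atan tend to pi times an indicator, except
    at the two ends, which have mass 0.  The change of variable m is built in so that
    the density of a push-forward is obtained directly. *)
Lemma stieltjes_inversion :
  measurable_fun D (fun y => dm y * P (m y)) /\
  (\int[lebesgue]_(y in D) (dm y * P (m y))%:E = (pi : R)%:E * nu `]m al, m be]%classic)%E.
Proof.
have mD : measurable D by exact: measurable_itv.
have mrange y : D y -> m al <= m y <= m be by rewrite /= in_itv /= => /m_range.
have inab y : D y -> a < m y < b.
  by move=> /mrange /andP[h1 h2]; rewrite (lt_le_trans a_lt)//= (le_lt_trans h2).
have limP y : D y -> dm y * poisson (mesh n) (m y) @[n --> \oo] --> dm y * P (m y).
  move=> Dy; apply: cvgM; first exact: cvg_cst.
  by have /cvg_at_rightP := P_lim (inab _ Dy); apply; split.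
have mP n : measurable_fun D (fun y => dm y * poisson (mesh n) (m y)).
  exact: measurable_poisson_pullback.
have mlim : measurable_fun D (fun y => dm y * P (m y)).
  by apply: (measurable_fun_cvg mP) => y Dy; exact: limP.
split => //.
have [c _ dm_max] : exists2 c, c \in `[al, be] & forall y, y \in `[al, be] -> dm y <= dm c.
  apply: EVT_max; first exact: ltW.
  by apply: continuous_in_subspaceT => y /set_mem /=; rewrite in_itv /= => /cont_dm.
pose K := 5 * K0 + 4 / d0.
have K_bound n y : D y -> poisson (mesh n) (m y) <= K.
  move=> Dy; apply: poisson_le => //; last by move=> r; exact: mass_ball (mrange _ Dy).
  by rewrite mulr_ge0// addr_ge0.
have poisson_ge0 n x : 0 <= poisson (mesh n) x.
  by apply: Rintegral_ge0 => s _; rewrite ltW// poisson_kernel_gt0.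
have dmge y : D y -> 0 <= dm y by rewrite /= in_itv /=; exact: dm_ge0.
have [_ _ C1] := @dominated_convergence _ _ _ lebesgue D mD
  (fun n y => (dm y * poisson (mesh n) (m y))%:E) (fun y => (dm y * P (m y))%:E)
  (EFin \o (fun=> dm c * K))
  (fun n => (measurable_EFinP _ _).2 (mP n)) ((measurable_EFinP _ _).2 mlim)
  ltac:(by apply: aeW => y Dy; apply: cvg_EFin; [exact: nearW|exact: limP])
  ltac:(by apply: continuous_compact_integrable; [exact: segment_compact|exact: cst_continuous])
  ltac:(apply: aeW => y Dy n; rewrite lee_fin ger0_norm ?mulr_ge0 ?dmge//;
    by rewrite ler_pM ?dmge// ?K_bound// dm_max).
have mmab : m al <= m be by have /andP[] := m_range (y := be) ltac:(by rewrite lexx ltW).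
(* The limit of the increments of atan: apart from the two ends, pi inside the interval
   and 0 outside. *)
pose kk (s : R) : \bar R := (theta (m be - s) - theta (m al - s))%:E.
have lim_kk s : (atan ((m be - s) / mesh n) - atan ((m al - s) / mesh n))%:E @[n --> \oo] --> kk s.
  by apply: cvg_EFin; [exact: nearW|apply: cvgB; exact: atan_lim].
have mh n : measurable_fun setT
    (fun s => (atan ((m be - s) / mesh n) - atan ((m al - s) / mesh n))%:E).
  apply/measurable_EFinP; apply: continuous_measurable_fun => s.
  have C (x : R) : atan ((x - u) / mesh n) @[u --> s] --> atan ((x - s) / mesh n).
    apply: (cvg_comp (fun u => (x - u) / mesh n) (@atan R)); last exact: continuous_atan.
    by apply: cvgM; [apply: cvgB; [exact: cvg_cst|exact: cvg_id]|exact: cvg_cst].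
  by apply: cvgB; exact: C.
have mkk : measurable_fun setT kk.
  apply/measurable_EFinP; apply: (measurable_fun_cvg (fun n => (measurable_EFinP _ _).1 (mh n))) => s _.
  by apply: cvgB; exact: atan_lim.
have ipi : nu.-integrable setT (EFin \o (fun=> (pi : R))).
  apply: (integrable_bounded_setT (M := pi)); first exact: measurable_cst.
  by move=> s; rewrite ger0_norm// pi_ge0.
have [_ _ C2] := @dominated_convergence _ _ _ nu setT measurableT
  (fun n s => (atan ((m be - s) / mesh n) - atan ((m al - s) / mesh n))%:E) kk
  (EFin \o (fun=> (pi : R))) mh mkk
  (aeW _ (fun s _ => lim_kk s))
  ipi
  ltac:(apply: aeW => s n _; rewrite lee_fin;
    have := atan_gtNpi2 ((m be - s) / mesh n); have := atan_ltpi2 ((m be - s) / mesh n);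
    have := atan_gtNpi2 ((m al - s) / mesh n); have := atan_ltpi2 ((m al - s) / mesh n);
    by move=> ? ? ? ?; rewrite ler_norml; apply/andP; split; lra).
transitivity (\int[nu]_s kk s)%E.
  apply: (cvg_unique _ C1) => //; apply: cvg_trans C2.
  apply: near_eq_cvg; near=> n => /=.
  by rewrite integral_poisson_pullback.
transitivity (\int[nu]_s ((pi : R) * \1_(`]m al, m be]%classic) s)%:E)%E; last first.
  under eq_integral do rewrite EFinM.
  rewrite integralZl//; first by rewrite integral_indic// setIT.
  apply: (integrable_bounded_setT (M := 1)); first exact: measurable_indic.
  by move=> s; rewrite indicE; case: (_ \in _); rewrite ?normr1 ?normr0.
apply: ae_eq_integral => //.
  apply/measurable_EFinP; apply: measurable_funM; first exact: measurable_cst.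
  exact: measurable_indic.
exists ([set m al] `|` [set m be]); split.
- by apply: measurableU; exact: measurable_set1.
- apply/eqP; rewrite -measure_le0.
  apply: (le_trans (measureU2 _ (measurable_set1 _) (measurable_set1 _))).
  have /= -> := point_null (x := m al) ltac:(by rewrite lexx mmab).
  have /= -> := point_null (x := m be) ltac:(by rewrite lexx mmab).
  by rewrite adde0.
move=> s /= h; apply: contrapT => hs; apply: h => _.
have [s1 s2] : s <> m al /\ s <> m be by split => e; apply: hs; [left|right].
rewrite /kk indicE; congr EFin; rewrite /theta !subr_gt0 !subr_lt0.
have [h|h|//] := ltgtP s (m al).
  rewrite (lt_le_trans h mmab) (_ : (s \in _) = false) ?mulr0 ?subrr//.
  by apply/negP => /set_mem /=; rewrite in_itv /= ltNge (ltW h).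
have [h2|h2|//] := ltgtP s (m be).
  rewrite (_ : (s \in _) = true) ?mulr1; first by rewrite opprK -splitr.
  by apply/mem_set; rewrite /= in_itv /= h ltW.
rewrite (_ : (s \in _) = false) ?mulr0 ?subrr//.
by apply/negP => /set_mem /=; rewrite in_itv /= h leNgt h2.
Unshelve. all: by end_near.
Qed.

End change_of_variables.

End poisson_bounds.

(** * Uniform limit of the rescaled density *)

Section difference_quotient.
Context {R : realType}.
Implicit Types (h : R -> R) (d s : R).

(** The difference quotient at 0, extended by the derivative d, so that the
    increment is s times a function continuous at 0, without a case distinction. *)
Definition slope h d s : R := if s == 0 then d else (h s - h 0) / s.

Lemma slopeE h d s : h s - h 0 = s * slope h d s.
Proof. by rewrite /slope; case: eqP => [->|/eqP s0]; rewrite ?subrr ?mul0r// mulrC divfK. Qed.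

Lemma cvg_slope h d : is_derive (0 : R) 1 h d -> slope h d s @[s --> 0] --> d.
Proof.
move=> [dh hE].
have : (fun s : R => s^-1 *: (h (s *: 1 + 0) - h 0)) @ 0^' --> d by rewrite -hE; exact: dh.
move=> H; have {}H : slope h d s @[s --> 0^'] --> slope h d 0.
  rewrite [in X in _ --> X]/slope eqxx; apply: cvg_trans H; apply: near_eq_cvg.
  near=> s; have s0 : s != 0 by near: s; exact: nbhs_dnbhs_neq.
  by rewrite /slope (negbTE s0) addr0 /GRing.scale /= mulr1 mulrC.
have := (@continuous_withinNx R R^o (slope h d) 0).2 H.
by rewrite /continuous_at [in X in _ --> X -> _]/slope eqxx.
Unshelve. all: by end_near.
Qed.

End difference_quotient.

Section joint_limit.
Context {R : realType}.
Implicit Types (mu : probability R R) (t x y : R).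

(** The density of the push-forward by x |-> x^(1/t), by the change of variable
    x = y^t. *)
Definition rescaled_density mu t y : R :=
  t * y `^ (t - 1) * power_density mu t (y `^ t).

Lemma power_densityE mu t x :
  power_density mu t x = Im (power_denominator mu t x) / pi /
    (Re (power_denominator mu t x) ^+ 2 + Im (power_denominator mu t x) ^+ 2).
Proof. by rewrite /power_density ImV opprK sqr_normcE mulrAC. Qed.

Lemma rescaled_densityE mu t y : t != 0 ->
  rescaled_density mu t y = y `^ (t - 1) / pi *
    ((Im (power_denominator mu t (y `^ t)) / t) /
     ((Re (power_denominator mu t (y `^ t)) / t) ^+ 2 +
      (Im (power_denominator mu t (y `^ t)) / t) ^+ 2)).
Proof.
move=> t0; rewrite /rescaled_density power_densityE.
set r := Re _; set i := Im _; rewrite !expr_div_n -mulrDl invfM invrK.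
set q := (r ^+ 2 + i ^+ 2)^-1.
have : (pi : R) != 0 by rewrite gt_eqF// pi_gt0.
by move: (pi : R) => p p0; field; rewrite t0.
Qed.

Variables (mu : probability R R) (beta gamma y0 : R).
Hypothesis y0_gt0 : 0 < y0.
Hypothesis gamma_gt0 : 0 < gamma.
Hypothesis Re_log : Re (boundary_log mu x) @[x --> (1 : R)] --> beta.
Hypothesis Im_log : Im (boundary_log mu x) @[x --> (1 : R)] --> - gamma.

Context {T : Type} {F : set_system T} {FF : Filter F}.
Variables tt yy : T -> R.
Hypothesis cvg_t : tt p @[p --> F] --> (0 : R).
Hypothesis t_gt0 : \forall p \near F, 0 < tt p.
Hypothesis cvg_y : yy p @[p --> F] --> y0.

Let y_gt0 : \forall p \near F, 0 < yy p.
Proof. by have := lt_nbhsr y0_gt0; exact: cvg_y. Qed.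

Let cvg_ln : ln (yy p) @[p --> F] --> ln y0.
Proof. by apply: (cvg_comp _ (@ln R)) cvg_y _; exact: continuous_ln. Qed.

Let cvg_tM (u : T -> R) (l : R) : u p @[p --> F] --> l -> tt p * u p @[p --> F] --> (0 : R).
Proof. by move=> ul; have := cvgM cvg_t ul; move=> /(_ FF); rewrite mul0r. Qed.

Let cvg_slope_tM (h : R -> R) (d : R) (u : T -> R) (l : R) : is_derive (0 : R) 1 h d ->
  u p @[p --> F] --> l -> (h (tt p * u p) - h 0) / tt p @[p --> F] --> l * d.
Proof.
move=> hd ul; have C := cvg_comp _ (slope h d) (cvg_tM ul) (cvg_slope hd).
apply: cvg_trans (cvgM ul C); apply: near_eq_cvg; near=> p.
have : tt p != 0 by rewrite gt_eqF//; near: p; exact: t_gt0.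
by move=> t0; rewrite (slopeE h d) fctE /=; field.
Unshelve. all: by end_near.
Qed.

Let powE : \forall p \near F, yy p `^ tt p = expR (tt p * ln (yy p)).
Proof. by near=> p; rewrite /powR gt_eqF//; near: p; exact: y_gt0. Unshelve. all: by end_near. Qed.

Lemma cvg_powR_one : yy p `^ tt p @[p --> F] --> (1 : R).
Proof.
rewrite -expR0; apply: cvg_trans (cvg_comp _ (@expR R) (cvg_tM cvg_ln) (@continuous_expR R 0)).
by apply: near_eq_cvg; near=> p; rewrite /=; apply/esym; near: p; exact: powE.
Unshelve. all: by end_near.
Qed.

Let b (p : T) := Re (boundary_log mu (yy p `^ tt p)).
Let g (p : T) := Im (boundary_log mu (yy p `^ tt p)).

Let cvg_b : b p @[p --> F] --> beta.
Proof. exact: (cvg_comp _ (fun x => Re (boundary_log mu x)) cvg_powR_one Re_log). Qed.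

Let cvg_g : g p @[p --> F] --> - gamma.
Proof. exact: (cvg_comp _ (fun x => Im (boundary_log mu x)) cvg_powR_one Im_log). Qed.

Let cvg_expb : expR (tt p * b p) @[p --> F] --> (1 : R).
Proof. by rewrite -expR0; apply: (cvg_comp _ (@expR R) (cvg_tM cvg_b)); exact: continuous_expR. Qed.

Let Re_denominator p : Re (power_denominator mu (tt p) (yy p `^ tt p)) =
  yy p `^ tt p - expR (tt p * b p) * cos (tt p * g p).
Proof. by rewrite /power_denominator ReD ReN /= !mul0r !subr0 !addr0. Qed.

Let Im_denominator p : Im (power_denominator mu (tt p) (yy p `^ tt p)) =
  - (expR (tt p * b p) * sin (tt p * g p)).
Proof. by rewrite /power_denominator ImD ImN /= !mul0r !subr0 !addr0 add0r. Qed.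

Let cvg_Im_denominator :
  Im (power_denominator mu (tt p) (yy p `^ tt p)) / tt p @[p --> F] --> gamma.
Proof.
have S : is_derive (0 : R) 1 (@sin R) 1 by have := is_derive_sin (0 : R); rewrite cos0.
have := cvgN (cvgM cvg_expb (cvg_slope_tM S cvg_g)).
move=> /(_ FF FF); rewrite mulr1 mul1r opprK; apply: cvg_trans; apply: near_eq_cvg; near=> p.
by rewrite Im_denominator !fctE /= sin0 subr0 mulrA mulNr.
Unshelve. all: by end_near.
Qed.

Let cvg_Re_denominator :
  Re (power_denominator mu (tt p) (yy p `^ tt p)) / tt p @[p --> F] --> ln y0 - beta.
Proof.
have E : is_derive (0 : R) 1 (@expR R) 1 by have := is_derive_expR (0 : R); rewrite expR0.
have C : is_derive (0 : R) 1 (@cos R) 0 by have := is_derive_cos (0 : R); rewrite sin0 oppr0.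
have := cvgB (cvg_slope_tM E cvg_ln)
  (cvgD (cvgM cvg_expb (cvg_slope_tM C cvg_g)) (cvg_slope_tM E cvg_b)).
move=> /(_ FF FF FF); rewrite mulr0 mulr0 add0r !mulr1; apply: cvg_trans; apply: near_eq_cvg; near=> p.
have pE : yy p `^ tt p = expR (tt p * ln (yy p)) by near: p; exact: powE.
rewrite Re_denominator !fctE cos0 expR0 -pE.
have : tt p != 0 by rewrite gt_eqF//; near: p; exact: t_gt0.
by move=> t0 /=; field.
Unshelve. all: by end_near.
Qed.

(** Numerator and denominator of the density are divided by t^2.  The pair (t, y) is
    replaced by functions on an arbitrary filter, so that the statement is a joint
    limit as soon as the filter is a product. *)
Lemma cvg_rescaled_density :
  rescaled_density mu (tt p) (yy p) @[p --> F] --> exp_cauchy_pdf beta gamma y0.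
Proof.
have -> : exp_cauchy_pdf beta gamma y0 =
    (1 / y0) / pi * (gamma / ((ln y0 - beta) ^+ 2 + gamma ^+ 2)).
  rewrite /exp_cauchy_pdf !invfM mul1r; ring.
have D : (Re (power_denominator mu (tt p) (yy p `^ tt p)) / tt p) ^+ 2 +
    (Im (power_denominator mu (tt p) (yy p `^ tt p)) / tt p) ^+ 2 @[p --> F] -->
    (ln y0 - beta) ^+ 2 + gamma ^+ 2.
  under eq_fun do rewrite !expr2; rewrite !expr2.
  exact: (cvgD (cvgM cvg_Re_denominator cvg_Re_denominator)
    (cvgM cvg_Im_denominator cvg_Im_denominator)).
have N : (ln y0 - beta) ^+ 2 + gamma ^+ 2 != 0.
  by rewrite gt_eqF// ltr_wpDl ?sqr_ge0// exprn_gt0.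
have Y : yy p `^ tt p / yy p @[p --> F] --> 1 / y0.
  by apply: cvgM cvg_powR_one _; apply: cvgV => //; rewrite gt_eqF.
have C := cvgM (cvgM Y (cvg_cst (pi : R)^-1)) (cvgM cvg_Im_denominator (cvgV N D)).
have {}C := C FF FF FF FF FF; apply: cvg_trans C; apply: near_eq_cvg; near=> p.
have t0 : 0 < tt p by near: p; exact: t_gt0.
have p0 : 0 < yy p by near: p; exact: y_gt0.
rewrite /= rescaled_densityE ?gt_eqF// powRB ?powRr1 ?(ltW p0)//.
by apply/implyP => _; rewrite gt_eqF.
Unshelve. all: by end_near.
Qed.

End joint_limit.

Section locally_uniform.
Context {R : realType}.

(** Each point x of K has a neighbourhood on which f t is close to g for t along F,
    because both are close to g x; compactness makes F see finitely many of them. *)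
Lemma uniform_of_joint_limit (F : set_system R) {FF : Filter F} (f : R -> R -> R)
    (g : R -> R) (K : set R) : compact K ->
  (forall x, K x -> {for x, continuous g}) ->
  (forall x, K x -> f p.2 p.1 @[p --> filter_prod (nbhs x) F] --> g x) ->
  {uniform K, f t @[t --> F] --> g}.
Proof.
move=> cK cg fg A /uniform_nbhs [E [entE EA]].
have [e /= e0 eE] : exists2 e : R, 0 < e & [set xy : R * R | ball xy.1 e xy.2] `<=` E.
  by move: entE; rewrite -entourage_ballE => -[e /= e0 eE]; exists e.
have /compact_near_coveringP := cK.
move=> /(_ _ F (fun t x => `|g x - f t x| < e) FF).
move=> H; apply: (filterS _ (H _)) => [t Ht|x Kx].
  by apply: EA => x Kx; apply: eE; exact: Ht.
have h : 0 < e / 2 by rewrite divr_gt0.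
have /cvgrPdist_lt /(_ _ h) C1 := fg _ Kx.
have /cvgrPdist_lt /(_ _ h) C2 := cg _ Kx.
have C3 : \forall p \near filter_prod (nbhs x) F, `|g x - g p.1| < e / 2.
  by have := C2; exact: cvg_fst.
apply: filterS2 C1 C3 => -[y t] /= C1 C3.
rewrite (_ : g y - f t y = (g x - f t y) - (g x - g y)); last by ring.
by rewrite (splitr e) (le_lt_trans (ler_normB _ _))// ltrD.
Qed.

End locally_uniform.

Section near_one.
Context {R : realType}.
Variables (mu : probability R R) (I : set R).
Hypotheses (I_open : open I) (I1 : I 1).
Hypothesis F_cont : F_boundary mu x @[x --> within I (nbhs (1 : R))] --> F_boundary mu 1.
Hypothesis F1 : 0 < Im (F_boundary mu 1) \/
  Im (F_boundary mu 1) = 0 /\ 1 < Re (F_boundary mu 1).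
Variables (beta gamma : R).
Hypothesis gamma_gt0 : 0 < gamma.
Hypothesis log_eq : log_one_minus_i0 (F_boundary mu 1) = beta -i* gamma.

Let boundary_log1 : boundary_log mu 1 = beta -i* gamma.
Proof. by rewrite /boundary_log -log_eq log_one_minus_i0E. Qed.

Let boundary_eta1_neq0 : boundary_eta mu 1 != 0.
Proof.
rewrite /boundary_eta; move: F1; move: (F_boundary mu 1 : R[i]) => w F1w.
apply/eqP => E; have := congr1 (@Re R) E; have := congr1 (@Im R) E.
rewrite ReD ReN ImD ImN /= add0r => /eqP; rewrite oppr_eq0 => /eqP i0 /eqP.
rewrite subr_eq0 => /eqP r1; case: F1w => [|[_]]; first by rewrite i0 ltxx.
by rewrite -r1 ltxx.
Qed.

Let near_I : \forall x \near (1 : R), I x.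
Proof. exact: open_nbhs_nbhs. Qed.

Let cvg_boundary_eta :
  Re (boundary_eta mu x) @[x --> (1 : R)] --> Re (boundary_eta mu 1) /\
  Im (boundary_eta mu x) @[x --> (1 : R)] --> Im (boundary_eta mu 1).
Proof.
have := F_cont; rewrite within_interior; last exact: near_I.
rewrite /boundary_eta; move: (F_boundary mu) => w.
move=> /(@cvg_ReIm R R (nbhs (1 : R)) _ w (w 1))[C1 C2].
rewrite ReD ReN ImD ImN; split.
  under eq_fun do rewrite ReD ReN.
  by apply: cvgB => //; exact: cvg_id.
under eq_fun do rewrite ImD ImN.
by apply: cvgB => //; exact: cvg_cst.
Qed.

Lemma near_boundary_eta_neq0 : \forall x \near (1 : R), boundary_eta mu x != 0.
Proof.
have [C1 C2] := cvg_boundary_eta; have C := @cvg_normc R R _ (nbhs_filter (1 : R)) (boundary_eta mu) _ C1 C2.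
have N : 0 < normc (boundary_eta mu 1) by rewrite normc_gt0.
have : \forall x \near (1 : R), 0 < normc (boundary_eta mu x) by exact: (cvgr_gt _ C).
by apply: filterS => x; rewrite normc_gt0.
Qed.

Lemma cvg_boundary_log :
  Re (boundary_log mu x) @[x --> (1 : R)] --> beta /\
  Im (boundary_log mu x) @[x --> (1 : R)] --> - gamma.
Proof.
have [C1 C2] := cvg_boundary_eta.
have := @cvg_lower_log R R _ (nbhs_filter (1 : R)) (boundary_eta mu) _ boundary_eta1_neq0 C1 C2.
have := boundary_log1; rewrite /boundary_log; move: (boundary_eta mu) => w.
by move=> ->.
Qed.

(** Strict positivity at 1 is the hypothesis gamma > 0; it excludes nearby points at
    which B is a positive real number. *)
Lemma near_Im_boundary_log : \forall x \near (1 : R), 0 < - Im (boundary_log mu x).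
Proof.
have [_ C0] := cvg_boundary_log.
have C : - Im (boundary_log mu x) @[x --> (1 : R)] --> gamma.
  by rewrite -[X in _ --> X]opprK; exact: cvgN.
exact: (cvgr_gt _ C).
Qed.

End near_one.

(** * From intervals to densities *)

Section density_from_intervals.
Context {R : realType}.
Local Notation lebesgue := (@lebesgue_measure R).

Section indefinite_integral.
Variable g : R -> R.
Hypotheses (g0 : forall x, 0 <= g x) (mg : measurable_fun setT g).

(** The two proofs are arguments so that the measure structure can be attached to the
    constant. *)
Definition indefinite_integral (g0 : forall x, 0 <= g x) (mg : measurable_fun setT g)
  (A : set R) : \bar R := (\int[lebesgue]_(x in A) (g x)%:E)%E.

Local Notation m := (indefinite_integral g0 mg).

Let m0 : m set0 = 0%E.
Proof. exact: integral_set0. Qed.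

Let m_ge0 A : (0 <= m A)%E.
Proof. by apply: integral_ge0 => x _; rewrite lee_fin. Qed.

Let m_sigma_additive : semi_sigma_additive m.
Proof.
move=> /= A mA tA mUA; apply: cvg_toP.
  apply: ereal_nondecreasing_is_cvgn => i j ij.
  by apply: lee_sum_nneg_natr => // k _ _; exact: m_ge0.
rewrite /indefinite_integral ge0_integral_bigcup//=.
- exact/measurable_EFinP/measurable_funTS.
- by move=> x _; rewrite lee_fin.
Qed.

HB.instance Definition _ := isMeasure.Build _ _ _ m m0 m_ge0 m_sigma_additive.

End indefinite_integral.

(** Both sides, restricted to ]c, d], are measures that agree on left-open intervals. *)
Lemma density_from_intervals (nu : probability R R) (f : R -> R) (c d : R) :
  measurable_fun `]c, d]%classic f -> (forall y, c < y <= d -> 0 <= f y) ->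
  (forall al be, c <= al -> al < be -> be <= d ->
    nu `]al, be]%classic = (\int[lebesgue]_(x in `]al, be]) (f x)%:E)%E) ->
  forall A, measurable A -> A `<=` `]c, d]%classic ->
    nu A = (\int[lebesgue]_(x in A) (f x)%:E)%E.
Proof.
set J := `]c, d]%classic => mf f0 fE A mA AJ.
have mJ : measurable J by exact: measurable_itv.
pose g := f \_ J.
have g0 x : 0 <= g x.
  by rewrite /g patchE; case: ifPn => // /set_mem; rewrite /J /= in_itv /= => /f0.
have mg : measurable_fun setT g by apply/measurable_restrict => //; rewrite setTI.
have gf (B : set R) : B `<=` J ->
    (\int[lebesgue]_(x in B) (g x)%:E)%E = (\int[lebesgue]_(x in B) (f x)%:E)%E.
  move=> BJ; apply: eq_integral => x /set_mem /BJ Jx.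
  by rewrite /g patchE mem_set.
have gJ (B : set R) : measurable B ->
    (\int[lebesgue]_(x in B) (g x)%:E)%E = (\int[lebesgue]_(x in B `&` J) (g x)%:E)%E.
  move=> mB; rewrite [LHS]integral_mkcond [RHS]integral_mkcond.
  apply: eq_integral => x _; rewrite !patchE in_setI.
  case: (x \in B) => //=; rewrite /g patchE; by case: (x \in J).
have nuJ : nu (A `&` J) = nu A by rewrite setIidl.
rewrite -nuJ -gf//.
suff : mrestr nu mJ A = indefinite_integral g0 mg A by [].
have G : (@measurable _ R) = <<s (@ocitv R) >> by [].
apply: (@measure_unique _ R R (@ocitv R) (fun n => `](- n%:R), n%:R]%classic)
  G (@ocitvI R) _ _ (mrestr nu mJ) (indefinite_integral g0 mg)) => //=.
- by move=> i; exists (- i%:R, i%:R).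
- rewrite -subTset => x _; exists (Num.truncn `|x|).+1 => //=; rewrite in_itv /=.
  have := truncnS_gt `|x|; rewrite ltr_norml => /andP[-> h]; exact: ltW.
- move=> _ [[a b] _ <-] /=; rewrite /indefinite_integral /mrestr gJ; last exact: measurable_itv.
  rewrite gf; last by move=> x [].
  have -> : `]a, b]%classic `&` J = `](Num.max a c), (Num.min b d)]%classic.
    apply/seteqP; split => x; rewrite /J /= !in_itv /= gt_max le_min.
      by move=> [/andP[-> ->] /andP[-> ->]].
    by move=> /andP[/andP[-> ->] /andP[-> ->]].
  have [h|h] := ltP (Num.max a c) (Num.min b d).
    apply: fE => //; first by rewrite le_max lexx orbT.
    by rewrite ge_min lexx orbT.
  by rewrite set_itv_ge ?measure0 ?integral_set0// bnd_simp -leNgt.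
- move=> k; apply: (@le_lt_trans _ _ 1%E); last exact: ltry.
  by rewrite /mrestr probability_le1//; apply: measurableI => //; exact: measurable_itv.
Qed.

End density_from_intervals.

Section rescaled_density.
Context {R : realType}.
Implicit Types (mu nu : probability R R) (t x y e : R).
Local Notation lebesgue := (@lebesgue_measure R).

Lemma poissonE nu e x : 0 < e -> poisson nu e x = - Im (G_transform nu (x +i* e)).
Proof.
move=> e0.
have -> : Im (G_transform nu (x +i* e)) = \int[nu]_s (- 1 * poisson_kernel e (x - s)).
  apply: eq_Rintegral => s _; rewrite mulN1r -[RHS]/(- (e / _)).
  by rewrite ImV sqr_normcE ReD ReN ImD ImN /= subr0.
by rewrite RintegralZl ?mulN1r ?opprK//; exact: integrable_poisson.
Qed.

(** The preimage may contain negative numbers, on which the real power is a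
    convention; these have mass 0. *)
Lemma power_pushforward_itv nu t al be : on_nonneg nu -> 0 < t -> 0 < al -> al < be ->
  power_pushforward nu t^-1 `]al, be]%classic = nu `](al `^ t), (be `^ t)]%classic.
Proof.
move=> hn t0 al0 albe.
have be0 : 0 < be by exact: lt_trans albe.
have mI (a b : itv_bound R) : measurable [set` Interval a b] by exact: measurable_itv.
have ti : 0 < t^-1 by rewrite invr_gt0.
have null (A B : set R) : measurable A -> measurable B ->
    A `&` `[0, +oo[%classic = B `&` `[0, +oo[%classic -> nu A = nu B.
  have D0 : nu (~` `[0, +oo[%classic) = 0%E.
    by rewrite probability_setC// hn subee.
  have H (C : set R) : measurable C -> nu C = nu (C `&` `[0, +oo[%classic).
    move=> mC; rewrite -[in LHS](setIT C) -(setUv (`[0, +oo[%classic)) setIUr.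
    rewrite measureU//; last by rewrite setIACA setICr setI0.
      rewrite [X in (_ + X)%E](_ : _ = 0%E) ?adde0//.
      apply/eqP; rewrite -measure_le0 -D0; apply: le_measure; rewrite ?inE//.
      - by apply: measurableI => //; exact: measurableC.
      - exact: measurableC.
    - exact: measurableI.
    - by apply: measurableI => //; exact: measurableC.
  by move=> mA mB AB; rewrite (H A)// (H B)// AB.
apply: null => //.
  by rewrite -[X in measurable X]setTI; exact: (@measurable_powR R t^-1).
apply/seteqP; split => x /=; rewrite !in_itv /= !andbT => -[/andP[h1 h2] x0]; split=> //;
  apply/andP; split.
- have := @gt0_ltr_powR R t t0 _ _ _ _ h1; rewrite -powRrM mulVf ?gt_eqF// powRr1//.
  by apply; rewrite nnegrE /power_map ?powR_ge0// ltW.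
- have := @ge0_ler_powR R t (ltW t0) _ _ _ _ h2; rewrite -powRrM mulVf ?gt_eqF// powRr1//.
  by apply; rewrite nnegrE /power_map ?powR_ge0// ltW.
- have := @gt0_ltr_powR R t^-1 ti _ _ _ _ h1; rewrite -powRrM mulfV ?gt_eqF// powRr1 ?ltW//.
  by apply; rewrite nnegrE ?powR_ge0.
- have := @ge0_ler_powR R t^-1 (ltW ti) _ _ _ _ h2; rewrite -powRrM mulfV ?gt_eqF// powRr1 ?(ltW be0)//.
  by apply; rewrite nnegrE ?powR_ge0.
Qed.

Variables (mu nu : probability R R) (t k1 k2 M : R).
Hypotheses (mu_nonneg : on_nonneg mu) (nu_nonneg : on_nonneg nu).
Hypotheses (mu_nd : nondegenerate mu) (t_gt0 : 0 < t) (t_lt1 : t < 1).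
Hypothesis nu_power : is_mboolean_power mu t nu.
Hypothesis k1_gt0 : 0 < k1.
Hypothesis boundary : forall y, k1 < y < k2 ->
  [/\ cvg (F_vertical mu (y `^ t) e @[e --> 0^'+]), boundary_eta mu (y `^ t) != 0
    & 0 < - Im (boundary_log mu (y `^ t))].
Hypothesis M_ge0 : 0 <= M.
Hypothesis density_le : forall y, k1 < y < k2 -> rescaled_density mu t y <= M.

Let f := rescaled_density mu t.

Let pi0 : (pi : R) != 0. Proof. by rewrite gt_eqF// pi_gt0. Qed.

Let rescaled_density_ge0 y : k1 < y < k2 -> 0 <= f y.
Proof.
move=> /boundary[_ _ h]; apply: mulr_ge0; first by rewrite mulr_ge0 ?powR_ge0// ltW.
by rewrite divr_ge0 ?pi_ge0// ltW// ImV_gt0// Im_power_denominator.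
Qed.

Let rescaled_density_itv al be : k1 < al -> al < be -> be < k2 ->
  measurable_fun `[al, be]%classic f /\
  power_pushforward nu t^-1 `]al, be]%classic =
    (\int[lebesgue]_(x in `]al, be]) (f x)%:E)%E.
Proof.
move=> k1al albe bek2.
have al0 : 0 < al by exact: lt_trans k1al.
have be0 : 0 < be by exact: lt_trans albe.
have k20 : 0 < k2 by exact: lt_trans bek2.
have ti : 0 < t^-1 by rewrite invr_gt0.
have inv_range x : k1 `^ t < x < k2 `^ t -> [/\ k1 < x `^ t^-1 < k2 & (x `^ t^-1) `^ t = x].
  move=> /andP[h1 h2]; have x0 : 0 < x by rewrite (lt_trans _ h1)// powR_gt0.
  split; last by rewrite -powRrM mulVf ?gt_eqF// powRr1// ltW.
  apply/andP; split.
    have := @gt0_ltr_powR R t^-1 ti _ _ _ _ h1; rewrite -powRrM mulfV ?gt_eqF// powRr1 ?ltW//.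
    by apply; rewrite nnegrE ?powR_ge0// ltW.
  have := @gt0_ltr_powR R t^-1 ti _ _ _ _ h2; rewrite -powRrM mulfV ?gt_eqF// powRr1 ?ltW//.
  by apply; rewrite nnegrE ?powR_ge0// ltW.
have pow_lt x y : 0 < x -> x < y -> x `^ t < y `^ t.
  by move=> x0 xy; apply: gt0_ltr_powR => //; rewrite nnegrE ltW// (lt_trans x0).
pose M' := pi * (M / (t * k2 `^ (t - 1))).
have c0 : 0 < t * k2 `^ (t - 1) by rewrite mulr_gt0// powR_gt0.
have [|||||||||||m1 m2] := @stieltjes_inversion R nu (fun y => y `^ t)
  (fun y => t * y `^ (t - 1)) al be albe _ _ _ _ _
  (fun x => pi * power_density mu t x) (k1 `^ t) (k2 `^ t) M'.
- exact: measurable_powR.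
- by apply: measurable_funM; [exact: measurable_cst|exact: measurable_powR].
- by move=> y _; rewrite mulr_ge0 ?powR_ge0// ltW.
- by move=> y /andP[h _]; apply: is_derive1_powR; exact: lt_le_trans h.
- move=> y /andP[h _].
  have C : {for y, continuous (fun u : R => u `^ (t - 1))}.
    have [dy _] := @is_derive1_powR R (t - 1) y (lt_le_trans al0 h).
    by apply: differentiable_continuous; exact/derivable1_diffP.
  by apply: cvgM; [exact: cvg_cst|exact: C].
- exact: pow_lt.
- exact: pow_lt.
- by rewrite mulr_ge0 ?pi_ge0// divr_ge0// ltW.
- move=> y /andP[h1 h2]; have yy0 := lt_le_trans al0 h1; apply/andP.
  by split; apply: ge0_ler_powR; rewrite ?nnegrE ?(ltW yy0) ?(ltW al0) ?(ltW be0) ?(ltW t_gt0).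
- move=> x /inv_range[xk xE]; have [b1 b2 b3] := boundary xk; rewrite xE in b1 b2 b3.
  have C : - Im (G_transform nu (x +i* e)) / pi @[e --> 0^'+] --> power_density mu t x.
    exact: cvg_boundary_density.
  have : pi * (- Im (G_transform nu (x +i* e)) / pi) @[e --> 0^'+] --> pi * power_density mu t x.
    by apply: cvgM => //; exact: cvg_cst.
  apply: cvg_trans; apply: near_eq_cvg; near=> e; have e0 : 0 < e by near: e; exact: nbhs_right_gt.
  by rewrite poissonE// mulrC divfK.
- move=> x /inv_range[xk xE]; rewrite ler_wpM2l ?pi_ge0//.
  have := density_le xk; rewrite /rescaled_density xE => h.
  rewrite ler_pdivlMr//; apply: le_trans h; rewrite mulrC ler_wpM2r//.
    have [b1 b2 b3] := boundary xk; rewrite xE in b1 b2 b3.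
    by rewrite divr_ge0 ?pi_ge0// ltW// ImV_gt0// Im_power_denominator.
  rewrite ler_wpM2l ?(ltW t_gt0)//.
  have /andP[xk1 xk2] := xk; have y0 := lt_trans k1_gt0 xk1.
  have x0 : 0 < x by rewrite -xE powR_gt0.
  have E : t - 1 = - (1 - t) by rewrite opprB.
  rewrite E !powRN lef_pV2 ?posrE ?powR_gt0//.
  by apply: ge0_ler_powR; rewrite ?subr_ge0 ?nnegrE ?(ltW t_lt1)// ltW.
have fE y : t * y `^ (t - 1) * (pi * power_density mu t (y `^ t)) = pi * f y.
  by rewrite mulrCA.
have mf : measurable_fun `[al, be]%classic f.
  have -> : f = (fun y => pi^-1 * (t * y `^ (t - 1) * (pi * power_density mu t (y `^ t)))).
    by apply/funext => y; rewrite fE mulKf.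
  by apply: measurable_funM m1; exact: measurable_cst.
split => //; rewrite power_pushforward_itv//.
have mf' : measurable_fun `]al, be]%classic f.
  by apply: measurable_funS mf => //; exact: subset_itv_oc_cc.
rewrite integral_itv_obnd_cbnd; last exact/measurable_EFinP.
have : (\int[lebesgue]_(y in `[al, be]) (pi%:E * (f y)%:E) = pi%:E * nu `](al `^ t)%R, (be `^ t)%R]%classic)%E.
  by rewrite -m2; apply: eq_integral => y _; rewrite -EFinM fE.
rewrite ge0_integralZl//; last 3 first.
- exact/measurable_EFinP.
- move=> y /=; rewrite in_itv /= => /andP[h1 h2]; rewrite lee_fin rescaled_density_ge0//.
  by rewrite (lt_le_trans k1al)//= (le_lt_trans h2).
- by rewrite lee_fin pi_ge0.
move=> /(congr1 (fun z => ((pi^-1)%:E * z)%E)); rewrite !muleA -EFinM mulVf// !mul1e.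
by move=> ->.
Unshelve. all: by end_near.
Qed.

(** A bound on the rescaled density on ]k1, k2[ bounds the density of nu on the image
    interval, because the Jacobian t y^(t-1) is bounded below there. *)
Lemma rescaled_density_is_density (K : set R) c d : k1 < c -> c < d -> d < k2 ->
  measurable K -> K `<=` `]c, d]%classic ->
  is_density_on K (power_pushforward nu t^-1) f.
Proof.
move=> k1c cd dk2 mK Kcd; have [mf _] := rescaled_density_itv k1c cd dk2.
have range y : c < y <= d -> k1 < y < k2.
  by move=> /andP[h1 h2]; rewrite (lt_trans k1c)//= (le_lt_trans h2).
have mf' : measurable_fun `]c, d]%classic f.
  by apply: measurable_funS mf => //; exact: subset_itv_oc_cc.
split.
- exact: measurable_funS mf'.
- by move=> y /Kcd /=; rewrite in_itv /= => /range /rescaled_density_ge0.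
- move=> A mA AK; apply: (density_from_intervals mf') => //.
  + by move=> y /range /rescaled_density_ge0.
  + move=> al be cal albe bed.
    by have [] := rescaled_density_itv (lt_le_trans k1c cal) albe (le_lt_trans bed dk2).
  + exact: subset_trans AK Kcd.
Qed.

End rescaled_density.

(** * Weak convergence by one-sided domination *)

Section weak_convergence.
Context {R : realType}.
Implicit Types (P Q : probability R R).
Local Notation lebesgue := (@lebesgue_measure R).

(** Apply the comparison of measures to h + B, which lies between 0 and 2 B; the
    constant B cancels because P and Q have the same total mass. *)
Lemma Rintegral_le_of_domination P Q (m : {measure set R -> \bar R}) (h : R -> R) B e :
  measurable_fun setT h -> (forall x, `|h x| <= B) -> (m setT <= e%:E)%E ->
  (forall A, measurable A -> (Q A <= P A + m A)%E) ->
  \int[Q]_x h x <= \int[P]_x h x + 2 * B * e.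
Proof.
move=> mh hB me QPm.
have B0 : 0 <= B by exact: le_trans (normr_ge0 _) (hB 0).
have g0 x : 0 <= h x + B by have := hB x; rewrite ler_norml => /andP[]; lra.
have gB x : h x + B <= 2 * B by have := hB x; rewrite ler_norml => /andP[]; lra.
have mg : measurable_fun setT (fun x => (h x + B)%:E).
  by apply/measurable_EFinP; apply: measurable_funD => //; exact: measurable_cst.
have E (S : probability R R) : (\int[S]_x (h x + B)%:E = (\int[S]_x h x + B)%:E)%E.
  have i1 : S.-integrable setT (EFin \o h) by exact: integrable_bounded_setT hB.
  have i2 : S.-integrable setT (EFin \o cst B).
    apply: (@integrable_bounded_setT _ S _ B) => // x; rewrite /cst ger0_norm//.
  rewrite -[in RHS](_ : \int[S]_x (h x + B) = \int[S]_x h x + B).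
    rewrite /Rintegral fineK//.
    by apply: integrable_fin_num => //; exact: (@integrableD _ _ _ S setT measurableT _ _ i1 i2).
  rewrite RintegralD//; congr (_ + _).
  by rewrite Rintegral_cst// [X in fine X](probability_setT S) mulr1.
suff : (\int[Q]_x (h x + B)%:E <= \int[P]_x (h x + B)%:E + (2 * B * e)%:E)%E.
  by rewrite !E -EFinD lee_fin; lra.
apply: (@le_trans _ _ (\int[measure_add P m]_x (h x + B)%:E)%E).
  apply: (@ge0_le_measure_integral _ _ R Q (measure_add P m)) => //.
  - move=> A mA.
    exact: (eq_ind_r (fun z => (Q A <= z)%E) (QPm A mA) (measure_addE P m A)).
rewrite ge0_integral_measure_add//; last by move=> x _; rewrite lee_fin.
rewrite leeD2l//; apply: (@le_trans _ _ (\int[m]_x (2 * B)%:E)%E).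
  by apply: ge0_le_integral => // x _; rewrite ?lee_fin// mulr_ge0.
by rewrite integral_cst// [leRHS]EFinM lee_wpmul2l// lee_fin mulr_ge0.
Qed.

(** The one-sided estimate is applied to h and to - h. *)
Lemma weak_cvg_of_domination (T : Type) (F : set_system T) {FF : Filter F}
    (P : T -> probability R R) Q :
  (forall e, 0 < e -> \forall t \near F, exists2 m : {measure set R -> \bar R},
     (m setT <= e%:E)%E & forall A, measurable A -> (Q A <= P t A + m A)%E) ->
  weak_cvg F P Q.
Proof.
move=> H h ch [M [_ bh]]; pose B := `|M| + 1.
have hB x : `|h x| <= B by apply: (bh (`|M| + 1)) => //; rewrite ltr_pwDr ?ler_norm.
have B0 : 0 < B by rewrite ltr_wpDl.
have mh : measurable_fun setT h by exact: continuous_measurable_fun.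
apply/cvgrPdist_le => e e0.
have := H (e / (2 * B)); rewrite divr_gt0 ?mulr_gt0// => /(_ isT).
apply: filterS => t [m me QPm].
have eE : 2 * B * (e / (2 * B)) = e by rewrite mulrC divfK// gt_eqF// mulr_gt0.
have h1 := Rintegral_le_of_domination mh hB me QPm.
have mh' : measurable_fun setT (fun x => - h x) by exact: measurable_funN.
have hB' x : `|- h x| <= B by rewrite normrN.
have h2 := Rintegral_le_of_domination mh' hB' me QPm.
have N (S : probability R R) : \int[S]_x (- h x) = - \int[S]_x h x.
  rewrite -mulN1r -RintegralZl//; last exact: integrable_bounded_setT hB.
  by apply: eq_Rintegral => x _; rewrite mulN1r.
rewrite !N eE in h2; rewrite eE in h1.
by rewrite ler_norml; apply/andP; split; lra.
Qed.

(** The small measure is Q outside the segment plus dlt times the Lebesgue measure on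
    the segment. *)
Lemma domination_of_density P Q (c d dlt e : R) (f p : R -> R) : c < d -> 0 <= dlt ->
  is_density_on `[c, d]%classic P f -> is_density_on `[c, d]%classic Q p ->
  (forall x, c <= x <= d -> `|p x - f x| <= dlt) ->
  (Q (~` `[c, d]%classic) <= e%:E)%E ->
  exists2 m : {measure set R -> \bar R}, (m setT <= (e + dlt * (d - c))%:E)%E &
    forall A, measurable A -> (Q A <= P A + m A)%E.
Proof.
set K := `[c, d]%classic => cd dlt0 [mf f0 fP] [mp p0 pQ] fp Qe.
have mK : measurable K by exact: measurable_itv.
pose g := (cst dlt : R -> R) \_ K.
have g0 x : 0 <= g x by rewrite /g patchE; case: ifPn.
have mg : measurable_fun setT g.
  by apply/measurable_restrict => //; rewrite setTI; exact: measurable_cst.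
have gE (A : set R) : (indefinite_integral g0 mg A = \int[lebesgue]_(x in A `&` K) dlt%:E)%E.
  rewrite /indefinite_integral [LHS]integral_mkcond [RHS]integral_mkcond.
  apply: eq_integral => x _; rewrite !patchE in_setI.
  by case: (x \in A) => //=; rewrite /g patchE; case: (x \in K).
pose m := measure_add (mrestr Q (measurableC mK)) (indefinite_integral g0 mg).
have mE (A : set R) : m A = (Q (A `&` ~` K) + \int[lebesgue]_(x in A `&` K) dlt%:E)%E.
  by rewrite /m measure_addE; congr (_ + _)%E; exact: gE.
exists m.
  suff : (Q (setT `&` ~` K) + \int[lebesgue]_(x in setT `&` K) dlt%:E <= (e + dlt * (d - c))%:E)%E.
    by rewrite -mE.
  have LK : lebesgue K = (d - c)%:E by rewrite lebesgue_measure_itv /= lte_fin cd -EFinB.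
  by rewrite !setTI EFinD leeD// EFinM -LK integral_cst.
move=> A mA.
suff : (Q A <= P A + (Q (A `&` ~` K) + \int[lebesgue]_(x in A `&` K) dlt%:E))%E.
  by rewrite -mE.
have mAK : measurable (A `&` K) by exact: measurableI.
have AK : A `&` K `<=` K by move=> x [].
have -> : Q A = (Q (A `&` K) + Q (A `&` ~` K))%E.
  rewrite -measureU//; last by rewrite setIACA setICr setI0.
    by rewrite -setIUr setUv setIT.
  by apply: measurableI => //; exact: measurableC.
rewrite [leRHS]addeCA [leLHS]addeC leeD2l//.
apply: (@le_trans _ _ (P (A `&` K) + \int[lebesgue]_(x in A `&` K) dlt%:E)%E); last first.
  by rewrite leeD2r// le_measure ?inE//; move=> x [].
rewrite (fP _ mAK AK) (pQ _ mAK AK) -ge0_integralD//.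
- apply: ge0_le_integral => //.
  + by move=> x /AK /p0; rewrite lee_fin.
  + by apply/measurable_EFinP; exact: measurable_funS mp.
  + by apply: emeasurable_funD => //; apply/measurable_EFinP; exact: measurable_funS mf.
  + move=> x /AK; rewrite /K /= in_itv /= => /fp; rewrite -EFinD lee_fin ler_norml => /andP[_ /=].
    by rewrite lerBlDl.
- by move=> x /AK /f0; rewrite lee_fin.
- by apply/measurable_EFinP; exact: measurable_funS mf.
Qed.

End weak_convergence.

(** * The law of the exponential of a Cauchy variable *)

Section exp_cauchy.
Context {R : realType}.
Variables (beta gamma : R).
Hypothesis gamma_gt0 : 0 < gamma.
Local Notation lebesgue := (@lebesgue_measure R).
Local Notation Q := (exp_cauchy_prob beta gamma_gt0).
Local Notation p := (exp_cauchy_pdf beta gamma).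

Let pi0 : (pi : R) != 0. Proof. by rewrite gt_eqF// pi_gt0. Qed.

Lemma cauchy_pdfE x : cauchy_pdf beta gamma x = pi^-1 * poisson_kernel gamma (x - beta).
Proof. by rewrite /cauchy_pdf /poisson_kernel mulrA (mulrC gamma). Qed.

Lemma exp_cauchy_pdfE x : p x = pi^-1 * (x^-1 * poisson_kernel gamma (ln x - beta)).
Proof. by rewrite /exp_cauchy_pdf /poisson_kernel !invfM; ring. Qed.

Lemma exp_cauchy_pdf_ge0 x : 0 < x -> 0 <= p x.
Proof.
move=> x0; rewrite exp_cauchy_pdfE mulr_ge0 ?invr_ge0 ?pi_ge0//.
by rewrite mulr_ge0 ?invr_ge0 ?(ltW x0)// ltW// poisson_kernel_gt0.
Qed.

Lemma continuous_exp_cauchy_pdf x : 0 < x -> {for x, continuous p}.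
Proof.
move=> x0; rewrite (_ : p = fun x => pi^-1 * (x^-1 * poisson_kernel gamma (ln x - beta))); last first.
  by apply/funext => y; exact: exp_cauchy_pdfE.
apply: cvgM; first exact: cvg_cst.
apply: cvgM; first by apply: cvgV; [rewrite gt_eqF|exact: cvg_id].
apply: (cvg_comp (@ln R) (fun u => poisson_kernel gamma (u - beta)) (continuous_ln x0)).
exact: (continuous_poisson_kernel gamma_gt0).
Qed.

(** Both sides are increments of explicit primitives, in terms of atan. *)
Lemma exp_cauchy_prob_itv a b : 0 < a -> a < b ->
  Q `]a, b]%classic = (\int[lebesgue]_(x in `]a, b]) (p x)%:E)%E.
Proof.
move=> a0 ab; have b0 : 0 < b by exact: lt_trans ab.
have lab : ln a < ln b by rewrite ltr_ln ?posrE.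
have pos y : a <= y <= b -> 0 < y by move=> /andP[h _]; exact: lt_le_trans h.
have -> : Q `]a, b]%classic = cauchy_prob beta gamma_gt0 `](ln a), (ln b)]%classic.
  rewrite /exp_cauchy_prob /distribution /pushforward /=; congr (cauchy_prob _ _ _).
  apply/seteqP; split => x /=; rewrite !in_itv /=.
    move=> /andP[h1 h2]; rewrite -(expRK x) ltr_ln ?posrE ?expR_gt0// h1 /=.
    by rewrite ler_ln ?posrE ?expR_gt0.
  by move=> /andP[h1 h2]; rewrite -[a]lnK ?posrE// -[b]lnK ?posrE// ltr_expR ler_expR h1.
rewrite /cauchy_prob integral_itv_obnd_cbnd; last first.
  by apply/measurable_EFinP; apply: measurable_funTS; exact: measurable_cauchy_pdf.
have cont : {in `[a, b], forall y, {for y, continuous p}}.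
  by move=> y; rewrite in_itv /= => /pos; exact: continuous_exp_cauchy_pdf.
rewrite integral_itv_obnd_cbnd; last first.
  apply/measurable_EFinP; apply: (@measurable_funS _ _ _ _ `[a, b]%classic) => //.
    exact: subset_itv_oc_cc.
  apply: subspace_continuous_measurable_fun => //.
  by apply: continuous_in_subspaceT => y /set_mem; exact: cont.
transitivity ((pi^-1 * atan ((ln b - beta) / gamma) - pi^-1 * atan ((ln a - beta) / gamma))%:E)%E.
  apply: (@integral_is_derive _ _ (fun x => pi^-1 * atan ((x - beta) / gamma)) _ _ lab) => y _.
    rewrite cauchy_pdfE.
    have D := @is_derive_atan_shift _ gamma beta id y 1 gamma_gt0 (is_derive_id y 1).
    have := is_derive_mulf (is_derive_cst pi^-1 y 1) D.
    by move/is_derive_congr; apply; rewrite /cst; ring.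
  rewrite (_ : cauchy_pdf beta gamma = fun x => pi^-1 * poisson_kernel gamma (x - beta)); last first.
    by apply/funext => x; exact: cauchy_pdfE.
  by apply: cvgM; [exact: cvg_cst|exact: (continuous_poisson_kernel gamma_gt0)].
apply/esym; apply: (@integral_is_derive _ _ (fun x => pi^-1 * atan ((ln x - beta) / gamma)) _ _ ab) => y /pos y0.
  rewrite exp_cauchy_pdfE.
  have D := @is_derive_atan_shift _ gamma beta (@ln R) y y^-1 gamma_gt0 (is_derive1_ln y0).
  have := is_derive_mulf (is_derive_cst pi^-1 y 1) D.
  by move/is_derive_congr; apply; rewrite /cst; ring.
exact: continuous_exp_cauchy_pdf.
Qed.

Lemma exp_cauchy_is_density c d : 0 < c -> c < d -> is_density_on `[c, d]%classic Q p.
Proof.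
move=> c0 cd; have c2 : c / 2 < c by rewrite ltr_pdivrMr// ltr_pMr// ltr1n.
have mp a : 0 < a -> measurable_fun `[a, d]%classic p.
  move=> a0; apply: subspace_continuous_measurable_fun => //.
  apply: continuous_in_subspaceT => y /set_mem /=; rewrite in_itv /= => /andP[h _].
  by apply: continuous_exp_cauchy_pdf; exact: lt_le_trans h.
have c20 : 0 < c / 2 by rewrite divr_gt0.
split.
- exact: mp.
- move=> x /=; rewrite in_itv /= => /andP[h _].
  by apply: exp_cauchy_pdf_ge0; exact: lt_le_trans h.
- move=> A mA AK; apply: (@density_from_intervals _ Q p (c / 2) d) => //.
  + by apply: measurable_funS (mp _ c20) => //; exact: subset_itv_oc_cc.
  + by move=> y /andP[h _]; apply: exp_cauchy_pdf_ge0; exact: lt_trans h.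
  + by move=> al be h1 h2 h3; apply: exp_cauchy_prob_itv => //; exact: lt_le_trans h1.
  + move=> x /AK /=; rewrite !in_itv /= => /andP[h ->]; rewrite andbT.
    exact: lt_le_trans h.
Qed.

Lemma exp_cauchy_tight e : 0 < e ->
  exists c d, [/\ 0 < c, c < d & (Q (~` `[c, d]%classic) <= e%:E)%E].
Proof.
move=> e0; pose C := cauchy_prob beta gamma_gt0.
pose A n := `[(- n.+1%:R : R), n.+1%:R]%classic.
have mA n : measurable (A n) by exact: measurable_itv.
have Acover : \bigcup_n A n = setT.
  rewrite -subTset => x _; exists (Num.truncn `|x|) => //; rewrite /A /= in_itv /=.
  by have /ltW := truncnS_gt `|x|; rewrite ler_norml.
have : C \o A @ \oo --> C setT.
  rewrite -Acover; apply: nondecreasing_cvg_mu => //; first by rewrite Acover.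
  move=> i j ij; apply/subsetPset => x; rewrite /A /= !in_itv /= => /andP[h1 h2].
  have ij' : i.+1%:R <= j.+1%:R :> R by rewrite ler_nat ltnS.
  by rewrite (le_trans _ h1) ?lerN2// (le_trans h2).
have -> : C setT = 1%E by exact: (probability_setT (cauchy_prob beta gamma_gt0)).
have e1 : ((1 - e)%:E < 1%:E :> \bar R)%E by rewrite lte_fin ltrBlDr ltrDl.
have e1' : nbhs 1%E [set y : \bar R | ((1 - e)%:E < y)%E].
  by apply: open_nbhs_nbhs; split => //; exact: open_ereal_gt_ereal.
move=> /(_ _ e1') [N _ /(_ N (leqnn _)) /= h].
have QC : Q (~` `[(expR (- N.+1%:R)), (expR N.+1%:R)]%classic) = C (~` A N).
  rewrite /exp_cauchy_prob /distribution /pushforward /=; congr (cauchy_prob _ _ _).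
  by apply/seteqP; split => x; rewrite /A /= !in_itv /= !ler_expR.
exists (expR (- N.+1%:R)), (expR N.+1%:R); split; first exact: expR_gt0.
  by rewrite ltr_expR; apply: (@lt_trans _ _ 0); rewrite ?oppr_lt0.
rewrite -[X in (X <= _)%E]/(Q (~` `[(expR (- N.+1%:R)), (expR N.+1%:R)]%classic)) QC.
have -> : C (~` A N) = (1 - C (A N))%E.
  exact: (probability_setC (cauchy_prob beta gamma_gt0) (mA N)).
have Cf : C (A N) \is a fin_num by exact: (fin_num_measure (cauchy_prob beta gamma_gt0) _ (mA N)).
rewrite leeBlDr//.
by rewrite -leeBlDl// -EFinB ltW.
Qed.

End exp_cauchy.

Theorem weak_cvg_exp_cauchy (R : realType) (T : Type) (F : set_system T) {FF : Filter F}
    (P : T -> probability R R) (f : T -> R -> R) (beta gamma : R) (gamma_gt0 : 0 < gamma) :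
  (forall c d, 0 < c -> c < d ->
     \forall t \near F, is_density_on `[c, d]%classic (P t) (f t)) ->
  (forall c d, 0 < c -> c < d ->
     {uniform `[c, d]%classic, f t @[t --> F] --> exp_cauchy_pdf beta gamma}) ->
  weak_cvg F P (exp_cauchy_prob beta gamma_gt0).
Proof.
move=> Pf fp; apply: weak_cvg_of_domination => e e0.
have e2 : 0 < e / 2 by rewrite divr_gt0.
have [c [d [c0 cd Qe]]] := exp_cauchy_tight beta gamma_gt0 e2.
pose dlt := e / 2 / (d - c).
have dlt0 : 0 < dlt by rewrite divr_gt0// subr_gt0.
have H : \forall t \near F, forall x, c <= x <= d -> `|exp_cauchy_pdf beta gamma x - f t x| <= dlt.
  have U := fp _ _ c0 cd.
  apply: (U [set g : R -> R | forall x, c <= x <= d -> `|exp_cauchy_pdf beta gamma x - g x| <= dlt]).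
  apply/uniform_nbhs; exists [set xy : R * R | ball xy.1 dlt xy.2]; split.
    by rewrite -entourage_ballE; exists dlt.
  by move=> g /= gb x xcd; apply: ltW; apply: gb; rewrite /= in_itv.
apply: filterS2 (Pf _ _ c0 cd) H => t dP close.
have [m m1 m2] := domination_of_density cd (ltW dlt0) dP
  (exp_cauchy_is_density beta gamma_gt0 c0 cd) close Qe.
exists m => //; apply: (le_trans m1); rewrite lee_fin /dlt divfK -?splitr//.
by rewrite gt_eqF// subr_gt0.
Qed.

(** * Convergence of the rescaled Boolean powers *)

Section main.
Context {R : realType}.

(** Each point of K has a neighbourhood inside [1/n, n] for large n, and compactness
    makes n uniform. *)
Lemma compact_in_itv (K : set R) : compact K -> K `<=` `]0, +oo[%classic ->
  exists c d, [/\ 0 < c, c < d & K `<=` `]c, d]%classic].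
Proof.
move=> /compact_near_coveringP cK K0.
have H : \forall n \near \oo, K `<=` [set x : R | n.+1%:R^-1 < x < n.+1%:R].
  apply: (cK _ _ (fun n (x : R) => n.+1%:R^-1 < x < n.+1%:R) _) => x /K0 /=.
  rewrite in_itv /= andbT => x0.
  have x2 : 0 < x / 2 by rewrite divr_gt0.
  have A1 : \forall y \near x, x / 2 < y < x + 1.
    near=> y; apply/andP; split; near: y.
      by apply: lt_nbhsr; rewrite ltr_pdivrMr// ltr_pMr// ltr1n.
    by apply: lt_nbhsl; rewrite ltrDl.
  have A2 : \forall n \near \oo, n.+1%:R^-1 < x / 2 :> R.
    have C : n.+1%:R^-1 @[n --> \oo] --> (0 : R) by exact: cvg_harmonic.
    exact: (cvgr_lt _ C).
  have A3 : \forall n \near \oo, x + 1 < n.+1%:R :> R.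
    exists (Num.truncn (x + 1)) => // n /= hn.
    by apply: (lt_le_trans (truncnS_gt _)); rewrite ler_nat ltnS.
  have A23 : \forall n \near \oo, n.+1%:R^-1 < x / 2 /\ x + 1 < n.+1%:R :> R.
    by apply: filterS2 A2 A3.
  exists ([set y | x / 2 < y < x + 1],
          [set n | n.+1%:R^-1 < x / 2 /\ x + 1 < n.+1%:R :> R]) => //=.
  move=> [y n] /= [/andP[h1 h2] [h3 h4]].
  by rewrite (lt_trans h3 h1) (lt_trans h2 h4).
have [N _ /(_ N (leqnn _)) h] := H.
exists N.+1%:R^-1, N.+2%:R; split; first by rewrite invr_gt0.
  by apply: (@le_lt_trans _ _ 1); rewrite ?invf_le1// ?ler1n// ltr1n.
move=> x /h /= /andP[h1 h2]; rewrite in_itv /= h1 (le_trans (ltW h2))//.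
by rewrite ler_nat.
Unshelve. all: by end_near.
Qed.

Lemma uniform_dist (K : set R) (f : R -> R -> R) (g : R -> R) e : 0 < e ->
  {uniform K, f t @[t --> (0 : R)^'+] --> g} ->
  \forall t \near (0 : R)^'+, forall x, K x -> `|g x - f t x| < e.
Proof.
move=> e0 U.
apply: (U [set h : R -> R | forall x, K x -> `|g x - h x| < e]).
apply/uniform_nbhs; exists [set xy : R * R | ball xy.1 e xy.2]; split.
  by rewrite -entourage_ballE; exists e.
by move=> h.
Qed.

Variables (mu : probability R R) (mu_nonneg : on_nonneg mu) (I : set R).
Hypotheses (I_open : open I) (I1 : I 1).
Hypothesis F_cvg : forall x : R, I x -> cvg (F_vertical mu x y @[y --> 0^'+]).
Hypothesis F_cont : F_boundary mu x @[x --> within I (nbhs (1 : R))] --> F_boundary mu 1.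
Hypothesis F1 : 0 < Im (F_boundary mu 1) \/
  Im (F_boundary mu 1) = 0 /\ 1 < Re (F_boundary mu 1).
Variables (beta gamma : R).
Hypothesis gamma_gt0 : 0 < gamma.
Hypothesis log_eq : log_one_minus_i0 (F_boundary mu 1) = beta -i* gamma.
Variable nu : R -> probability R R.
Hypothesis nuP : forall t : R, 0 <= t <= 1 -> is_mboolean_power mu t (nu t).

Lemma uniform_rescaled_density (K : set R) : compact K -> K `<=` `]0, +oo[%classic ->
  {uniform K, rescaled_density mu t @[t --> (0 : R)^'+] --> exp_cauchy_pdf beta gamma}.
Proof.
move=> cK K0; have pos x : K x -> 0 < x by move=> /K0 /=; rewrite in_itv /= andbT.
have [L1 L2] := cvg_boundary_log I_open I1 F_cont F1 log_eq.
apply: uniform_of_joint_limit => // x /pos x0.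
  exact: continuous_exp_cauchy_pdf.
apply: (cvg_rescaled_density x0 gamma_gt0 L1 L2).
- by apply: cvg_trans; first exact: cvg_snd; exact: cvg_at_right_filter.
- by have := nbhs_right_gt (0 : R); exact: cvg_snd.
- exact: cvg_fst.
Qed.

(** The powers y^t tend to 1 uniformly on a segment, and the three conditions hold on
    a neighbourhood of 1. *)
Lemma near_boundary_good k1 k2 : 0 < k1 ->
  \forall t \near (0 : R)^'+, forall y, k1 <= y <= k2 ->
  [/\ cvg (F_vertical mu (y `^ t) e @[e --> 0^'+]), boundary_eta mu (y `^ t) != 0
    & 0 < - Im (boundary_log mu (y `^ t))].
Proof.
move=> k1_gt0.
have G : \forall x \near (1 : R), [/\ cvg (F_vertical mu x e @[e --> 0^'+]),
    boundary_eta mu x != 0 & 0 < - Im (boundary_log mu x)].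
  have N1 : \forall x \near (1 : R), I x by exact: open_nbhs_nbhs.
  have N2 := near_boundary_eta_neq0 I_open I1 F_cont F1.
  have N3 := near_Im_boundary_log I_open I1 F_cont F1 gamma_gt0 log_eq.
  by apply: filterS3 N1 N2 N3 => x /F_cvg.
have [r /= r0 rG] := G.
have U : {uniform `[k1, k2]%classic, (fun y => y `^ t) @[t --> (0 : R)^'+] --> (cst 1 : R -> R)}.
  apply: (@uniform_of_joint_limit _ _ _ (fun t y => y `^ t)).
  - exact: segment_compact.
  - by move=> x _; exact: cst_continuous.
  - move=> x /=; rewrite in_itv /= => /andP[kx _]; have x0 := lt_le_trans k1_gt0 kx.
    apply: (cvg_powR_one x0); last exact: cvg_fst.
    by apply: cvg_trans; first exact: cvg_snd; exact: cvg_at_right_filter.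
have := uniform_dist r0 U; apply: filterS => t h y yk.
by apply: rG; apply: h; rewrite /= in_itv.
Qed.

(** The limit density is bounded on a segment slightly larger than [c, d], hence so is
    the rescaled density for small t, as Stieltjes inversion requires. *)
Lemma near_is_density c d : 0 < c -> c < d ->
  \forall t \near (0 : R)^'+, forall K : set R, measurable K -> K `<=` `]c, d]%classic ->
    is_density_on K (power_pushforward (nu t) t^-1) (rescaled_density mu t).
Proof.
move=> c0 cd; pose k1 := c / 2; pose k2 := d + 1.
have k1_gt0 : 0 < k1 by rewrite divr_gt0.
have k1c : k1 < c by rewrite ltr_pdivrMr// ltr_pMr// ltr1n.
have dk2 : d < k2 by rewrite ltrDl.
have k12 : k1 <= k2 by rewrite ltW// (lt_trans k1c)// (lt_trans cd).
have pos y : k1 <= y <= k2 -> 0 < y by move=> /andP[h _]; exact: lt_le_trans h.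
have [m _ m_max] : exists2 m, m \in `[k1, k2] &
    forall y, y \in `[k1, k2] -> exp_cauchy_pdf beta gamma y <= exp_cauchy_pdf beta gamma m.
  apply: EVT_max => //; apply: continuous_in_subspaceT => y /set_mem /=.
  by rewrite in_itv /= => /pos; exact: continuous_exp_cauchy_pdf.
pose M := `|exp_cauchy_pdf beta gamma m| + 1.
have U : {uniform `[k1, k2]%classic,
    rescaled_density mu t @[t --> (0 : R)^'+] --> exp_cauchy_pdf beta gamma}.
  apply: uniform_rescaled_density; first exact: segment_compact.
  by move=> y /=; rewrite !in_itv /= andbT => /pos.
have nd := nondegenerate_of_boundary mu_nonneg (F_cvg I1) F1.
have N1 := uniform_dist ltr01 U.
have N2 := near_boundary_good k2 k1_gt0.
near=> t.
have t0 : 0 < t by near: t; exact: nbhs_right_gt.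
have t1 : t < 1 by near: t; exact: nbhs_right_lt.
have [|nu_nonneg _] := nuP (t := t); first by rewrite !ltW.
have close y : k1 <= y <= k2 -> `|exp_cauchy_pdf beta gamma y - rescaled_density mu t y| < 1.
  move=> yk; have : `[k1, k2]%classic y by rewrite /= in_itv.
  by move: y {yk}; near: t; exact: N1.
have good y : k1 <= y <= k2 -> [/\ cvg (F_vertical mu (y `^ t) e @[e --> 0^'+]),
    boundary_eta mu (y `^ t) != 0 & 0 < - Im (boundary_log mu (y `^ t))].
  by move: y; near: t; exact: N2.
have open_le y : k1 < y < k2 -> k1 <= y <= k2 by move=> /andP[/ltW -> /ltW ->].
move=> K mK Kcd.
have M_ge0 : 0 <= M by rewrite addr_ge0.
have density_le y : k1 < y < k2 -> rescaled_density mu t y <= M.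
  move=> /open_le yk; have := close _ yk; rewrite ltr_distlC => /andP[_ h].
  rewrite (le_trans (ltW h))// lerD2r (le_trans _ (ler_norm _))// m_max//.
have good' y (yk : k1 < y < k2) := good y (open_le y yk).
have nu_power : is_mboolean_power mu t (nu t) by apply: nuP; rewrite !ltW.
exact: (rescaled_density_is_density mu_nonneg nu_nonneg nd t0 t1 nu_power k1_gt0
  good' M_ge0 density_le k1c cd dk2 mK Kcd).
Unshelve. all: by end_near.
Qed.

End main.
Theorem theorem5p1 (R : realType) (mu : probability R R)
    (mu_nonneg : on_nonneg mu)
    (I : set R) (I_open : open I) (I_itv : is_interval I)
    (I_pos : I `<=` `]0, +oo[%classic) (I1 : I 1)
    (F_cvg : forall x : R, I x -> cvg (F_vertical mu x y @[y --> 0^'+]))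
    (F_im_ge0 : forall x : R, I x -> 0 <= complex.Im (F_boundary mu x))
    (F_cont : F_boundary mu x @[x --> within I (nbhs (1 : R))]
                --> F_boundary mu 1)
    (F1 : 0 < complex.Im (F_boundary mu 1) \/
          complex.Im (F_boundary mu 1) = 0 /\
          1 < complex.Re (F_boundary mu 1))
    (beta gamma : R) (gamma_gt0 : 0 < gamma) (gamma_le_pi : gamma <= pi)
    (log_eq : log_one_minus_i0 (F_boundary mu 1) = beta -i* gamma)
    (nu : R -> probability R R)
    (nuP : forall t : R, 0 <= t <= 1 -> is_mboolean_power mu t (nu t)) :
  (forall K : set R, compact K -> K `<=` `]0, +oo[%classic ->
    exists f : R -> R -> R,
      (\forall t \near (0 : R)^'+,
         is_density_on K (power_pushforward (nu t) t^-1) (f t)) /\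
      {uniform K, f t @[t --> (0 : R)^'+] --> exp_cauchy_pdf beta gamma}) /\
  weak_cvg ((0 : R)^'+) (fun t => power_pushforward (nu t) t^-1)
    (exp_cauchy_prob beta gamma_gt0).
Proof.
split=> [K cK K0|].
  exists (rescaled_density mu); split; last first.
    exact: (uniform_rescaled_density I_open I1 F_cont F1 gamma_gt0 log_eq).
  have [c [d [c0 cd Kcd]]] := compact_in_itv cK K0.
  have := near_is_density mu_nonneg I_open I1 F_cvg F_cont F1 gamma_gt0 log_eq nuP c0 cd.
  apply: filterS => t; apply => //.
  apply: closed_measurable; exact: compact_closed.
apply: (@weak_cvg_exp_cauchy _ _ _ _ _ (rescaled_density mu)) => c d c0 cd.
  have c2 : 0 < c / 2 by rewrite divr_gt0.
  have c2c : c / 2 < c by rewrite ltr_pdivrMr// ltr_pMr// ltr1n.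
  have := near_is_density mu_nonneg I_open I1 F_cvg F_cont F1 gamma_gt0 log_eq nuP c2 (lt_trans c2c cd).
  apply: filterS => t; apply => //.
  move=> x /=; rewrite !in_itv /= => /andP[h ->]; rewrite andbT.
  exact: lt_le_trans h.
apply: (uniform_rescaled_density I_open I1 F_cont F1 gamma_gt0 log_eq); first exact: segment_compact.
move=> x /=; rewrite !in_itv /= andbT => /andP[h _]; exact: lt_le_trans h.
Qed.
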